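(* Let $m\ge1$, let $B=(B^1,\dots,B^m)$ be a boundary conditions operator on $\mathcal{H}^m$, let $(\tau_d)_{d\ge1}$ be a sequence of finite sampling grids $\tau_d=(t_l)_{l=1}^{|\tau_d|}$ in $[0,1]$ (points depending on $d$, in increasing order), and let $(\lambda_d)_{d\ge1}$ be a sequence of positive real numbers. Let $(X,Y)$ be a pair of random variables with $X$ taking values in $\mathcal{H}^m$ and $Y$ either taking values in $\{-1,1\}$ (binary classification case) or real valued (regression case). Assume: (A1) for every $d$, the points of $\tau_d$ are distinct, $|\tau_d|\ge m$, and $B^1,\dots,B^m$ are linearly independent from the $|\tau_d|$ linear forms $h\mapsto h(t_l)$ on $\mathcal{H}^m$; (A2) there is $R$ such that $\overline{\Delta}_{\tau_d}/\underline{\Delta}_{\tau_d}\le R$ for all $d$; (A3) $\lim_{d\to+\infty}|\tau_d|=+\infty$ and $\lim_{d\to+\infty}\lambda_d=0$; (A4) either (a) $\mathbb{E}(\|D^mX\|_{L^2}^2)$ is finite and $Y\in\{-1,1\}$ (binary classification case), or (b) $\tau_d\subset\tau_{d+1}$ for all $d$ and $\mathbb{E}(Y^2)$ is finite (binary classification or regression case). Then $$\lim_{d\to+\infty}L^*_d=L^*.$$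
   Context: $\mathcal{H}^m=\{h\in L^2([0,1]) : D^jh \text{ exists in the weak sense for } j=1,\dots,m \text{ and } D^mh\in L^2([0,1])\}$ is the Sobolev space on $[0,1]$, $D^jh=h^{(j)}$ being the $j$-th derivative (elements are identified with their continuous representatives). A boundary conditions operator is a full rank continuous linear operator $B=(B^j)_{j=1}^m:\mathcal{H}^m\to\mathbb{R}^m$ with $\mathrm{Ker}\,B\cap\mathbb{P}^{m-1}=\{0\}$, where $\mathbb{P}^{m-1}=\mathrm{Ker}\,D^m$ is the space of polynomial functions of degree at most $m-1$. $\mathcal{H}^m$ is equipped with the Hilbert space inner product $\langle u,v\rangle_{\mathcal{H}^m}=\int_0^1u^{(m)}(t)v^{(m)}(t)\,dt+\sum_{j=1}^mB^ju\,B^jv$. Grid quantities: $\overline{\Delta}_{\tau_d}=\max\{t_1,t_2-t_1,\dots,1-t_{|\tau_d|}\}$ and $\underline{\Delta}_{\tau_d}=\min_{1\le i<|\tau_d|}\{t_{i+1}-t_i\}$. For $x\in\mathcal{H}^m$ and $\lambda>0$, the smoothing spline estimate $\widehat{x}_{\lambda,\tau_d}$ is the unique solution of $$\arg\min_{h\in\mathcal{H}^m}\frac{1}{|\tau_d|}\sum_{l=1}^{|\tau_d|}(x(t_l)-h(t_l))^2+\lambda\int_{[0,1]}(h^{(m)}(t))^2\,dt ,$$ and $\widehat{X}_{\lambda,\tau_d}$ is obtained by applying this to each realization of $X$. Bayes risks (infima over measurable functions $\phi$): - binary classification case: $L^*=\inf_{\phi:\mathcal{H}^m\to\{-1,1\}}\mathbb{P}(\phi(X)\ne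 Y)$ and $L^*_d=\inf_{\phi:\mathcal{H}^m\to\{-1,1\}}\mathbb{P}(\phi(\widehat{X}_{\lambda_d,\tau_d})\ne Y)$; - regression case: $L^*=\inf_{\phi:\mathcal{H}^m\to\mathbb{R}}\mathbb{E}([\phi(X)-Y]^2)$ and $L^*_d=\inf_{\phi:\mathcal{H}^m\to\mathbb{R}}\mathbb{E}([\phi(\widehat{X}_{\lambda_d,\tau_d})-Y]^2)$. *)

(* Defs.v *)
From HB Require Import structures.
From mathcomp Require Import all_boot all_order all_algebra.
From mathcomp Require Import all_classical all_reals all_analysis.
From mathcomp Require Import measurable_realfun ring lra.

Set Implicit Arguments.
Unset Strict Implicit.
Unset Printing Implicit Defensive.

Import Order.TTheory GRing.Theory Num.Theory.
Import numFieldNormedType.Exports.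

Local Open Scope classical_set_scope.
Local Open Scope ring_scope.

Section weak_derivatives.
Variable R : realType.
Local Notation mu := (@lebesgue_measure R).
Local Notation I01 := (`[0, 1]%classic : set R).
Implicit Types f g h phi : R -> R.

Definition square_integrable01 f :=
  measurable_fun I01 f /\ (\int[mu]_(t in I01) ((f t) ^+ 2)%:E < +oo)%E.

Definition test_function phi :=
  let support := closure [set t | phi t != 0] in
  [/\ forall k t, derivable (derive1n k phi) t 1,
      compact support & support `<=` `]0, 1[%classic].

Definition is_weak_derivative (j : nat) h g :=
  locally_integrable `]0, 1[%classic g /\
  forall phi, test_function phi ->
    \int[mu]_(t in I01) (h t * derive1n j phi t) =
    (-1) ^+ j * \int[mu]_(t in I01) (g t * phi t).

(* A weak derivative is unique up to a null set, so the integrals below do not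
   depend on the version chosen here. *)
Definition weak_derivative (j : nat) h : R -> R :=
  xget (cst 0) [set g | is_weak_derivative j h g].

(* An element of the Sobolev space on [0, 1] is represented by its continuous
   version, extended by 0 outside [0, 1] so that Leibniz equality of the total
   functions R -> R is equality on [0, 1]. *)
Definition sobolev_fun (m : nat) : {pred (R -> R)} :=
  mem [set h : R -> R | [/\ (forall t, ~ I01 t -> h t = 0),
    {within I01, continuous h},
    square_integrable01 h,
    (forall j, (1 <= j <= m)%N -> exists g, is_weak_derivative j h g)
  & exists2 g, is_weak_derivative m h g & square_integrable01 g]].

Lemma test_function_continuous k phi : test_function phi ->
  continuous (derive1n k phi).
Proof.
move=> [d _ _] t; apply: differentiable_continuous.
exact/derivable1_diffP.
Qed.

Lemma test_function_eq0 phi t : ~ closure [set t | phi t != 0] t -> phi t = 0.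
Proof.
move=> nt; apply: contrapT => /eqP pt; apply: nt.
exact: subset_closure.
Qed.

Lemma integrable_cont_test k h phi : {within I01, continuous h} ->
  test_function phi ->
  mu.-integrable I01 (EFin \o (fun t => h t * derive1n k phi t)).
Proof.
move=> ch tp; apply: continuous_compact_integrable.
  exact: segment_compact.
move=> t; apply: cvgM; first exact: ch.
apply: continuous_subspaceT.
exact: test_function_continuous.
Qed.

Lemma integrable_loc_test g phi : locally_integrable `]0, 1[%classic g ->
  test_function phi ->
  mu.-integrable I01 (EFin \o (fun t => g t * phi t)).
Proof.
move=> [mg oI lg] tp; have [d cK K01] := tp.
set K := closure _ in cK K01.
have mK : measurable K by apply: closed_measurable; exact: closed_closure.
have cphi : continuous phi := @test_function_continuous 0 phi tp.
have gphiE : (EFin \o (fun t => g t * phi t)) =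
             (((EFin \o g) \* (EFin \o phi)) \_ K)%E.
  apply/funext => t; rewrite patchE; case: ifPn => // /negP nK.
  by rewrite /= (@test_function_eq0 phi t) ?mulr0// => Kt; apply: nK; rewrite inE.
apply: (@integrableS _ _ _ _ setT) => //; rewrite gphiE.
apply: (iffLR (@integrable_mkcond _ _ _ mu K _ mK)).
apply: (@integrableMl _ _ _ mu K mK).
- apply/integrableP; split; last exact: lg.
  apply/measurable_EFinP; exact: (measurable_funS (measurable_itv _) K01 mg).
- by apply: measurable_funTS; exact: continuous_measurable_fun.
- have cpK : {within K, continuous phi} by exact: continuous_subspaceT.
  have /compact_bounded[M [_ mrt]] := continuous_compact cpK cK.
  by exists M; split; rewrite ?num_real // => ? ? ? ?; exact: mrt.
Qed.

Lemma square_integrable01_lin (a : R) f g :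
  square_integrable01 f -> square_integrable01 g ->
  square_integrable01 (a *: f + g).
Proof.
move=> [mf f2] [mg g2].
have mZ : measurable_fun I01 (a *: f).
  exact: (measurable_funM (@measurable_cst _ _ _ _ _ a) mf).
have mfg : measurable_fun I01 (a *: f + g) by exact: measurable_funD.
have msq h : measurable_fun I01 h -> measurable_fun I01 (fun t => ((h t) ^+ 2)%:E).
  by move=> mh; apply/measurable_EFinP; exact: measurable_funX.
split => //.
apply: (@le_lt_trans _ _ (\int[mu]_(t in I01)
   ((2 * a ^+ 2)%:E * ((f t) ^+ 2)%:E + 2%:E * ((g t) ^+ 2)%:E))%E).
  apply: ge0_le_integral => //.
  - by move=> t _; rewrite lee_fin sqr_ge0.
  - exact: msq.
  - by apply: emeasurable_funD; apply: emeasurable_funM => //; exact: msq.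
  - move=> t _; rewrite -!EFinM -EFinD lee_fin.
    rewrite -subr_ge0 (_ : _ - _ = (a * f t - g t) ^+ 2) ?sqr_ge0//.
    rewrite (_ : (a *: f + g) t = a * f t + g t)//; ring.
have a0 : 0 <= 2 * a ^+ 2 by rewrite mulr_ge0// sqr_ge0.
have sq0 h t : (0 <= ((h t) ^+ 2)%:E :> \bar R)%E by rewrite lee_fin sqr_ge0.
have mM (c : R) h : measurable_fun I01 h ->
    measurable_fun I01 (fun t => c%:E * ((h t) ^+ 2)%:E)%E.
  by move=> mh; apply: emeasurable_funM => //; exact: msq.
rewrite ge0_integralD//; [|by move=> t _; exact: mule_ge0|exact: mM
  |by move=> t _; exact: mule_ge0|exact: mM].
rewrite !ge0_integralZl//; try exact: msq.
by rewrite lte_add_pinfty// lte_mul_pinfty// lee_fin.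
Qed.

Lemma is_weak_derivative_lin j (a : R) h1 h2 g1 g2 :
  {within I01, continuous h1} -> {within I01, continuous h2} ->
  is_weak_derivative j h1 g1 -> is_weak_derivative j h2 g2 ->
  is_weak_derivative j (a *: h1 + h2) (a *: g1 + g2).
Proof.
move=> c1 c2 [l1 w1] [l2 w2]; split.
  apply: locally_integrableD => //.
  have [mg1 oI b1] := l1; split => //.
    exact: (measurable_funM (@measurable_cst _ _ _ _ _ a) mg1).
  move=> K KI cK; have mK : measurable K.
    by apply: closed_measurable; apply: compact_closed.
  have mgK : measurable_fun K g1.
    by apply: measurable_funS mg1 => //; exact: open_measurable.
  under eq_integral do rewrite normrM EFinM.
  rewrite ge0_integralZl ?lte_mul_pinfty//; first exact: b1.
  by apply/measurable_EFinP; exact: measurableT_comp.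
move=> phi tp.
under eq_Rintegral do rewrite mulrDl -mulrA.
have i1 := integrable_cont_test j c1 tp.
have i2 := integrable_cont_test j c2 tp.
have k1 := integrable_loc_test l1 tp.
have k2 := integrable_loc_test l2 tp.
rewrite RintegralD//; last exact: (integrableZl _ a i1).
rewrite RintegralZl// w1// w2//.
under [in RHS]eq_Rintegral do rewrite mulrDl -mulrA.
rewrite RintegralD//; last exact: (integrableZl _ a k1).
rewrite RintegralZl//; ring.
Qed.


Lemma sobolev_submod_closed m : submod_closed (sobolev_fun m).
Proof.
have w0 j : is_weak_derivative j 0 0.
  split.
    apply: open_integrable_locally; first exact: interval_open.
    exact: integrable0.
  move=> phi _.
  by rewrite !(@eq_Rintegral _ _ _ mu I01 (cst 0)) ?Rintegral_cst// ?mul0r ?mulr0// => t _;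
    rewrite /= mul0r.
have s0 : square_integrable01 0.
  split; first exact: measurable_cst.
  by rewrite integral0_eq// => t _; rewrite expr0n.
split.
  apply/mem_set; split=> //.
  - by move=> t; exact: cvg_cst.
  - by move=> j _; exists 0.
  - by exists 0.
move=> a h1 h2 /set_mem[z1 c1 s1 w1 [g1 d1 q1]] /set_mem[z2 c2 s2 w2 [g2 d2 q2]].
apply/mem_set; split.
- by move=> t nt; rewrite [LHS](_ : _ = a * h1 t + h2 t)// z1// z2// mulr0 addr0.
- move=> t; apply: cvgD; last exact: c2.
  by apply: cvgZr; exact: c1.
- exact: square_integrable01_lin.
- move=> j jm; have [f1 e1] := w1 j jm; have [f2 e2] := w2 j jm.
  by exists (a *: f1 + f2); exact: is_weak_derivative_lin.
- exists (a *: g1 + g2); first exact: is_weak_derivative_lin.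
  exact: square_integrable01_lin.
Qed.

HB.instance Definition _ m := GRing.isSubmodClosed.Build R (R -> R)
  (sobolev_fun m) (@sobolev_submod_closed m).

Record sobolev (m : nat) := Sobolev {
  sobolev_val :> R -> R;
  sobolev_valP : sobolev_val \in sobolev_fun m }.

HB.instance Definition _ m := [isSub for @sobolev_val m].
HB.instance Definition _ m := [Choice of sobolev m by <:].
HB.instance Definition _ m := [SubChoice_isSubLmodule of sobolev m by <:].
HB.instance Definition _ m := isPointed.Build (sobolev m) 0.

End weak_derivatives.

Section boundary_conditions.
Variables (R : realType) (m : nat).
Local Notation mu := (@lebesgue_measure R).
Local Notation I01 := (`[0, 1]%classic : set R).
Local Notation H := (sobolev R m).
Implicit Types (h u v : H) (B : {linear H -> 'rV[R]_m}).

Definition energy h : R := \int[mu]_(t in I01) (weak_derivative m h t) ^+ 2.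

(* The usual Sobolev norm; it gives meaning to the continuity of B, on which the
   norm hilbert_norm depends. *)
Definition sobolev_norm h : R :=
  Num.sqrt (\int[mu]_(t in I01) (h t) ^+ 2 +
    \sum_(1 <= j < m.+1) \int[mu]_(t in I01) (weak_derivative j h t) ^+ 2).

Definition norm_open (N : H -> R) : set (set H) :=
  [set U | forall u, U u ->
    exists2 e, 0 < e & forall v, N (v - u) < e -> U v].

Definition polynomial_functions : set H :=
  [set h | exists2 p : {poly R}, (size p <= m)%N &
    forall t, I01 t -> h t = p.[t]].

Definition boundary_conditions_operator B :=
  [/\ forall V : set 'rV[R]_m, open V -> norm_open sobolev_norm (B @^-1` V),
      range B = setT
    & [set h | B h = 0] `&` polynomial_functions = [set 0]].

Definition sobolev_inner B u v : R :=
  \int[mu]_(t in I01) (weak_derivative m u t * weak_derivative m v t) +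
  \sum_(j < m) B u 0 j * B v 0 j.

Definition hilbert_norm B u : R := Num.sqrt (sobolev_inner B u u).

Definition hilbert_open B : set (set H) := norm_open (hilbert_norm B).

End boundary_conditions.

Section splines.
Variables (R : realType) (m : nat).
Local Notation H := (sobolev R m).
Implicit Types (tau : seq R) (x h : H) (B : {linear H -> 'rV[R]_m}).

Definition sampling_grid tau :=
  sorted <=%R tau /\ forall t, t \in tau -> t \in `[0, 1].

(* With t_0 = 0 and t_(n+1) = 1 adjoined to the grid t_1 <= ... <= t_n, the gaps
   are the t_(l+1) - t_l for l = 0, ..., n; they lie in [0, 1], so the default
   value 0 of the maximum is harmless. *)
Definition mesh_max tau : R :=
  \big[Num.max/0]_(l < (size tau).+1) (nth 1 tau l - nth 0 (0 :: tau) l).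

(* Only gaps between points of the grid count here. They are at most 1, so the
   default value 1 only matters for grids with fewer than two points. *)
Definition mesh_min tau : R :=
  \big[Num.min/1]_(l < (size tau).-1) (nth 0 tau l.+1 - nth 0 tau l).

(* No nontrivial linear combination of the B^j lies in the span of the
   evaluations at the grid points. *)
Definition independent_from_sampling B tau :=
  forall (a : 'I_m -> R) (c : 'I_(size tau) -> R),
    (forall h, \sum_(j < m) a j * B h 0 j =
               \sum_(l < size tau) c l * h (nth 0 tau l)) ->
  forall j, a j = 0.

Definition spline_criterion (lambda : R) tau x h : R :=
  (size tau)%:R^-1 * \sum_(t <- tau) (x t - h t) ^+ 2 + lambda * energy h.

Definition smoothing_spline (lambda : R) tau x : H :=
  xget 0 [set h | forall g : H,
    spline_criterion lambda tau x h <= spline_criterion lambda tau x g].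

End splines.

Variant learning_task := Classification | Regression.

Section bayes_risk.
Variables (R : realType) (m : nat) (B : {linear sobolev R m -> 'rV[R]_m}).
Local Notation Hborel := (g_sigma_algebraType (hilbert_open B)).
Variables (disp : measure_display) (Omega : measurableType disp).
Variable P : probability Omega R.

Definition task_valued (task : learning_task) (T : Type) (f : T -> R) :=
  match task with
  | Classification => forall x, f x = -1 \/ f x = 1
  | Regression => True
  end.

Definition decision_rules (task : learning_task) : set (Hborel -> R) :=
  [set phi | measurable_fun setT phi /\ task_valued task phi].

Definition risk (task : learning_task) (Z : Omega -> Hborel) (Y : Omega -> R)
    (phi : Hborel -> R) : \bar R :=
  match task with
  | Classification => P [set w | phi (Z w) <> Y w]
  | Regression => 'E_P[fun w => (phi (Z w) - Y w) ^+ 2]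
  end.

(* The infimum is taken in \bar R because the quadratic risk of some rules may be
   infinite. *)
Definition bayes_risk (task : learning_task) (Z : Omega -> Hborel)
    (Y : Omega -> R) : \bar R :=
  ereal_inf [set risk task Z Y phi | phi in decision_rules task].

End bayes_risk.

Arguments decision_rules {R m} B task.
Arguments risk {R m} B {disp Omega} P task Z Y phi.
Arguments bayes_risk {R m} B {disp Omega} P task Z Y.

(* Main.v *)
Require Import Defs.
From HB Require Import structures.
From mathcomp Require Import all_boot all_order all_algebra.
From mathcomp Require Import all_classical all_reals all_analysis.
From mathcomp Require Import measurable_realfun ring lra.

Set Implicit Arguments.
Unset Strict Implicit.
Unset Printing Implicit Defensive.

Import Order.TTheory GRing.Theory Num.Theory.
Import numFieldNormedType.Exports.

Local Open Scope classical_set_scope.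
Local Open Scope ring_scope.

(** Write [S_d x] for the smoothing spline of [x] on the [d]-th grid. The theorem
    rests on two facts: for every [x], [S_d x] converges to [x] in the Hilbert
    norm ([spline_hilbert_cvg]), and every [S_d] is Lipschitz for this norm
    ([smoothing_spline_lipschitz]), hence Borel measurable. By measurability, a
    decision rule applied to [S_d X] is also a decision rule applied to [X], so
    no [L*_d] is smaller than [L*]. By convergence, the information carried by
    [X] is asymptotically carried by [S_d X], so the upper limit of [L*_d] is at
    most [L*].

    Convergence of the splines. Let [u_d = x - S_d x]. Comparing the values of the
    criterion at [S_d x] and at [x] gives two inequalities: the mean of the
    squares of [u_d] over the grid is at most [lambda_d] times the energy of [x],
    and the energy of [S_d x] is at most the energy of [x]. By the first one,
    [u_d] tends to 0 in [L^2]: it is Hölder continuous, with a constant controlled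
    by its [L^2] norm and its energy, and the intervals around the points of a
    quasi-uniform grid cover the unit interval without too much overlap
    ([Rintegral_covering], [empirical_l2_bound]). Integrating by parts against test functions, which are
    dense in [L^2] ([square_integrable01_ind]), shows that the [m]-th derivatives
    of the [u_d], which are bounded in [L^2], tend weakly to 0
    ([spline_error_weak_cvg]). The second inequality says that the energy of [u_d]
    is at most twice the inner product of the [m]-th derivatives of [x] and [u_d]
    ([spline_error_energy_le]), so weak convergence implies convergence of the
    energy to 0. The Taylor coefficients of [u_d] at 0 are controlled by the [L^2]
    norms of [u_d] and of its [m]-th derivative, and they control the boundary
    part of the Hilbert norm ([taylor_coef_l2_bound], [hilbert_norm_le]).

    The Sobolev space is handled in Taylor coordinates: an element is a polynomial
    of degree less than [m] plus the [m]-th iterated primitive of its [m]-th weak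
    derivative ([sobolev_taylorP]). This follows from the fundamental lemma of the
    calculus of variations ([locally_integrable_eq0]). The spline is the
    combination of representers of evaluations and of monomials given by an
    invertible linear system ([grid_matrix_unit]), so it is a finite sum of
    evaluations of [x] times fixed elements ([smoothing_spline_sum]), which gives
    the Lipschitz bound.

    Recovery of decision rules. Call a Borel set [A] recoverable when the event
    that [X] lies in [A] is approximated in probability by events that depend only
    on [S_d X], for large [d]. Recoverable sets form a sigma-algebra, which contains
    the open sets since [S_d X] tends to [X] pointwise; hence every Borel set is
    recoverable ([hilbert_measurable_recoverable]). For classification, a rule is
    given by one Borel set and the conclusion follows. For regression, a nearly
    optimal rule is square integrable because [Y] is; it is approximated in mean
    square by simple functions of [X], hence by functions of [S_d X]
    ([ms_recoverableP]). *)

(** * Smooth bump functions *)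

Section bumps.
Variable R : realType.
Implicit Types (f g : R -> R) (p q : {poly R}).

(** The functions with [n.+1] derivatives everywhere. *)
Fixpoint derivable_upto n f : Prop :=
  (forall t, derivable f t 1) /\
  match n with 0%N => True | k.+1 => derivable_upto k (derive1 f) end.

Lemma derivable_uptoW n f : derivable_upto n.+1 f -> derivable_upto n f.
Proof.
elim: n f => [|n IHn] f [df h]; first by split.
by split=> //; exact: IHn.
Qed.

Lemma derivable_upto_derive1n n f : derivable_upto n f ->
  forall k, (k <= n)%N -> forall t, derivable (derive1n k f) t 1.
Proof.
elim: n f => [|n IHn] f /= [df hf] [|k] kn t; [exact: df|by []|exact: df|].
by rewrite derive1Sn; exact: IHn hf k kn t.
Qed.

Lemma derivable_uptoD n f g : derivable_upto n f -> derivable_upto n g ->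
  derivable_upto n (f + g).
Proof.
elim: n f g => [|n IHn] f g /= [df hf] [dg hg].
  by split=> [t|]; [exact: derivableD|].
split=> [t|]; first exact: derivableD.
rewrite (_ : derive1 (f + g) = derive1 f + derive1 g); first exact: IHn.
by apply/funext => t; rewrite derive1E (deriveD (df t) (dg t)) -!derive1E.
Qed.

Lemma derivable_uptoM n f g : derivable_upto n f -> derivable_upto n g ->
  derivable_upto n (f * g).
Proof.
elim: n f g => [|n IHn] f g.
  by move=> /= [df _] [dg _]; split=> [t|]; [exact: derivableM|].
move=> hf hg; have [df hf'] := hf; have [dg hg'] := hg.
split=> [t|]; first exact: derivableM.
rewrite (_ : derive1 (f * g) = f * derive1 g + g * derive1 f).
  by apply: derivable_uptoD; apply: IHn => //; exact: derivable_uptoW.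
by apply/funext => t; rewrite derive1E (deriveM (df t) (dg t)) -!derive1E.
Qed.

Lemma derivable_upto_affine n f (c a b : R) : derivable_upto n f ->
  derivable_upto n (fun t => c * f (a * t + b)).
Proof.
have da t : is_derive t (1 : R) (fun t => a * t + b) a.
  have -> : (fun t => a * t + b) = (a *: (id : R -> R)) + cst b by [].
  apply: is_derive_eq; rewrite addr0; exact: mulr1.
have dfa d (h : R -> R) t : (forall t, derivable h t 1) ->
    is_derive t (1 : R) (fun t => d * h (a * t + b)) (d * (derive1 h (a * t + b) * a)).
  move=> dh; have dh1 : is_derive (a * t + b) (1 : R) h (derive1 h (a * t + b)).
    by rewrite derive1E; apply: DeriveDef.
  have dha := @is_derive1_comp R h (fun t => a * t + b) t _ _ dh1 (da t).
  have -> : (fun t => d * h (a * t + b)) = d *: (h \o (fun t => a * t + b)) by [].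
  exact: is_deriveZ.
elim: n f c => [|n IHn] f c /= [df hf].
  by split=> [t|]; [case: (dfa c f t df)|].
split=> [t|]; first by case: (dfa c f t df).
rewrite (_ : derive1 (fun t => c * f (a * t + b)) =
   fun t => (c * a) * derive1 f (a * t + b)); first exact: IHn.
apply/funext => t; rewrite derive1E; case: (dfa c f t df) => _ ->.
by rewrite mulrA mulrAC.
Qed.

(** The functions [p(1/t) exp(-1/t)], extended by 0 to the negative half-line;
    this class is stable under derivation. *)
Definition exp_inv p (t : R) : R :=
  if 0 < t then p.[t^-1] * expR (- t^-1) else 0.

Lemma poly_expRN_bounded p : exists2 C : R, 0 <= C &
  forall y, 0 <= y -> `|p.[y] * expR (- y)| <= C.
Proof.
have mono (k : nat) : exists C : R, 0 <= C /\
    forall y, 0 <= y -> `|y ^+ k * expR (- y)| <= C.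
  (* [y ^+ k / k`!] is at most [expR y]. *)
  exists (k`!%:R + 1); split=> [|y y0]; first exact: addr_ge0.
  rewrite normrM !ger0_norm ?expR_ge0 ?exprn_ge0// expRN ler_pdivrMr ?expR_gt0//.
  case: k => [|k]; first by rewrite expr0 fact0; have := expR_ge1Dx y; nra.
  have := expR_ge1Dxn k y0.
  have k0 : (0 : R) < k.+1`!%:R by rewrite ltr0n fact_gt0.
  have {2}-> : y ^+ k.+1 = k.+1`!%:R * (y ^+ k.+1 / k.+1`!%:R).
    by rewrite mulrC divfK ?gt_eqF.
  by have := expR_ge0 y; nra.
have /choice[D hD] : forall i : 'I_(size p), exists C : R, 0 <= C /\
    forall y, 0 <= y -> `|y ^+ i * expR (- y)| <= C.
  by move=> i; exact: mono.
exists (\sum_(i < size p) `|p`_i| * D i).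
  by apply: sumr_ge0 => i _; rewrite mulr_ge0//; case: (hD i).
move=> y y0; rewrite horner_coef mulr_suml (le_trans (ler_norm_sum _ _ _))//.
apply: ler_sum => i _; rewrite -mulrA normrM ler_wpM2l//.
by case: (hD i) => _; exact.
Qed.

Lemma is_derive_exp_inv p t :
  is_derive t (1 : R) (exp_inv p) (exp_inv ('X^2 * (p - deriv p)) t).
Proof.
have [t0|t0|->] := ltgtP t 0.
- rewrite {2}/exp_inv ltNge (ltW t0)/=.
  apply: (@near_eq_is_derive R R R (cst 0)).
  near=> s; rewrite /exp_inv ltNge ifF//; apply/negbTE; rewrite negbK ltW//.
  by near: s; exact: lt_nbhsl.
- rewrite {2}/exp_inv t0.
  apply: (@near_eq_is_derive R R R (fun s => p.[s^-1] * expR (- s^-1))).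
    by near=> s; rewrite /exp_inv ifT//; near: s; exact: lt_nbhsr.
  have dV : is_derive t (1 : R) (fun s : R => s^-1) (- t ^- 2).
    have tn0 : (id : R -> R) t != 0 by rewrite gt_eqF.
    have := @is_deriveV _ (id : R -> R) t 1 1 tn0 _.
    by rewrite [_ *: 1]mulr1; exact.
  have dVN : is_derive t (1 : R) (fun s : R => - s^-1) (t ^- 2).
    have := @is_deriveN _ _ _ _ t 1 _ dV; rewrite opprK; exact.
  have dp := @is_derive1_comp R (horner p) (fun s => s^-1) t _ _ (is_derive_poly p t^-1) dV.
  have de := @is_derive1_comp R expR (fun s => - s^-1) t _ _ (is_derive_expR (- t^-1)) dVN.
  apply: (is_derive_eq (is_deriveM dp de)).
  by rewrite !hornerE /= /GRing.scale/= -exprVn; ring.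
- rewrite {2}/exp_inv ltxx.
  (* For positive [h] the difference quotient at 0 is [h] times the value at
     [h^-1] of a bounded function. *)
  have [C C0 hC] := poly_expRN_bounded ('X^2 * p).
  suff h : (fun h : R => h^-1 *: (exp_inv p (h *: 1 + 0) - exp_inv p 0)) @ 0^'
      --> (0 : R).
    apply: DeriveDef; first by apply/cvg_ex; exists 0; rewrite -[0]/0; exact: h.
    by apply/cvg_lim => //; exact: h.
  apply/cvgr0Pnorm_le => e e0; near=> h.
  have h0 : h != 0 by near: h; exact: nbhs_dnbhs_neq.
  rewrite /exp_inv ltxx subr0 addr0 [h *: 1]mulr1.
  case: ifPn => [hp|_]; last by rewrite scaler0 normr0 ltW.
  have := hC h^-1; rewrite invr_ge0 (ltW hp) => /(_ isT).
  rewrite !hornerE /= => {}hC.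
  apply: (@le_trans _ _ (h * C)).
    apply: (@le_trans _ _ (h * `|h^-1 ^+ 2 * p.[h^-1] * expR (- h^-1)|)).
      have hn (z : R) : h * `|z| = `|h * z| by rewrite normrM gtr0_norm.
      by rewrite hn /GRing.scale/= expr2 -!mulrA mulVKf.
    by rewrite ler_pM2l.
  have hd : `|h| <= e / (C + 1).
    near: h; apply: dnbhs0_le; rewrite divr_gt0// ltr_wpDl//.
  rewrite gtr0_norm// ler_pdivlMr ?ltr_wpDl// in hd.
  by rewrite (le_trans _ hd)// ler_pM2l// lerDl.
Unshelve. all: by end_near. Qed.

Lemma derivable_upto_exp_inv n p : derivable_upto n (exp_inv p).
Proof.
have dE q t : derivable (exp_inv q) t 1 by case: (is_derive_exp_inv q t).
elim: n p => [|n IHn] p; first by split=> [t|]; [exact: dE|].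
split=> [t|]; first exact: dE.
rewrite (_ : derive1 _ = exp_inv ('X^2 * (p - deriv p))); first exact: IHn.
by apply/funext => t; rewrite derive1E; case: (is_derive_exp_inv p t).
Qed.

(** For [0 <= a] and [b <= 1] these functions are test functions, with support at
    distance at least [1 / k] from [a] and [b]; they increase with [k] to the
    indicator of the open interval from [a] to [b]. *)
Definition smooth_bump (a b : R) (k : nat) (t : R) : R :=
  exp_inv 1 (k%:R * (t - a) - 1) * exp_inv 1 (k%:R * (b - t) - 1).

Lemma exp_inv1_ge0 t : 0 <= exp_inv 1 t.
Proof. by rewrite /exp_inv; case: ifP => // _; rewrite hornerE mul1r expR_ge0. Qed.

Lemma exp_inv1_le1 t : exp_inv 1 t <= 1.
Proof.
rewrite /exp_inv; case: ifPn => // t0.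
by rewrite hornerE mul1r -[leRHS]expR0 ler_expR oppr_le0 invr_ge0 ltW.
Qed.

Lemma smooth_bump_ge0 a b k t : 0 <= smooth_bump a b k t.
Proof. by rewrite mulr_ge0// exp_inv1_ge0. Qed.

Lemma smooth_bump_le1 a b k t : smooth_bump a b k t <= 1.
Proof. by rewrite mulr_ile1// ?exp_inv1_ge0 ?exp_inv1_le1. Qed.

Lemma smooth_bump_neq0 a b k t : smooth_bump a b k t != 0 ->
  k%:R * (t - a) > 1 /\ k%:R * (b - t) > 1.
Proof.
rewrite mulf_eq0 negb_or /exp_inv !subr_gt0 => /andP[].
by do 2 (case: ifPn => [? _|_]; last by rewrite eqxx).
Qed.

Lemma smooth_bump_test_function a b k : 0 <= a -> b <= 1 -> test_function (smooth_bump a b k).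
Proof.
move=> a0 b1.
have sub : closure [set t | smooth_bump a b k t != 0] `<=`
    `[a + k%:R^-1, b - k%:R^-1]%classic.
  rewrite closureE => t /(_ `[a + k%:R^-1, b - k%:R^-1]%classic); apply; split.
    exact: interval_closed.
  move=> s /= /smooth_bump_neq0[h1 h2].
  have k0 : 0 < (k%:R : R).
    by rewrite lt_def ler0n andbT; apply: contraTN h1 => /eqP->; rewrite mul0r -leNgt.
  rewrite in_itv/=; apply/andP; split.
    by rewrite addrC -lerBrDr -[leLHS]mul1r ler_pdivrMr// mulrC ltW.
  by rewrite lerBrDr addrC -lerBrDr -[leLHS]mul1r ler_pdivrMr// mulrC ltW.
split.
- move=> j; apply: (@derivable_upto_derive1n j) => //.
  rewrite (_ : smooth_bump a b k = (fun t => 1 * exp_inv 1 (k%:R * t + (- k%:R * a - 1))) *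
     (fun t => 1 * exp_inv 1 (- k%:R * t + (k%:R * b - 1)))).
    by apply: derivable_uptoM; apply: derivable_upto_affine;
      exact: derivable_upto_exp_inv.
  apply/funext => t; rewrite /smooth_bump.
  by congr (_ * _); rewrite mul1r; congr exp_inv; ring.
- by apply: subclosed_compact sub; [exact: closed_closure|exact: segment_compact].
- case: k sub => [|k] sub.
    suff -> : [set t | smooth_bump a b 0 t != 0] = set0 by rewrite closure0.
    by apply/seteqP; split=> [t /= /smooth_bump_neq0[]|t []]; rewrite mul0r ltr10.
  have k0 : 0 < (k.+1%:R^-1 : R) by rewrite invr_gt0.
  move: (k.+1%:R^-1) k0 sub => c c0 sub t /sub /=.
  rewrite !in_itv/= => /andP[h1 h2].
  by apply/andP; split; lra.
Qed.

Lemma smooth_bump_cvg a b t :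
  smooth_bump a b k t @[k --> \oo] --> (\1_(`]a, b[%classic) t : R).
Proof.
have large (c : R) : 0 < c -> exp_inv 1 (k%:R * c - 1) @[k --> \oo] --> (1 : R).
  move=> c0.
  have : expR (- (k%:R * c - 1)^-1) @[k --> \oo] --> (expR 0 : R).
    apply: (@cvg_comp _ _ _ (fun k : nat => - (k%:R * c - 1)^-1 : R) expR _ _ _ _
      (@continuous_expR R 0)).
    suff /cvgN : (k%:R * c - 1)^-1 @[k --> \oo] --> (0 : R) by rewrite oppr0.
    apply/gtr0_cvgV0.
      near=> k; rewrite subr_gt0 -ltr_pdivrMr//; near: k; exact: nbhs_infty_gtr.
    apply/cvgryPge => A; near=> k.
    rewrite lerBrDr -ler_pdivrMr//; near: k; exact: nbhs_infty_ger.
  rewrite expR0; apply: cvg_trans; apply: near_eq_cvg; near=> k.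
  rewrite /exp_inv ifT ?hornerE ?mul1r//.
  rewrite subr_gt0 -ltr_pdivrMr//; near: k; exact: nbhs_infty_gtr.
have [ab|ab] := boolP (t \in `]a, b[%classic).
  rewrite indicE ab -[1%:R]mulr1.
  move: ab; rewrite inE/= in_itv/= => /andP[h1 h2].
  by apply: cvgM; apply: large; rewrite subr_gt0.
rewrite indicE (negbTE ab); apply: cvg_near_cst; near=> k.
apply/eqP; apply: contraNT ab => /smooth_bump_neq0[h1 h2]; rewrite inE/= in_itv/=.
have k0 : 0 < (k%:R : R).
  by rewrite lt_def ler0n andbT; apply: contraTN h1 => /eqP->; rewrite mul0r -leNgt.
by apply/andP; split; rewrite -subr_gt0 -(pmulr_rgt0 _ k0); lra.
Unshelve. all: by end_near. Qed.

End bumps.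

(** * Integration on the unit interval *)

Section calculus.
Variable R : realType.
Local Notation mu := (@lebesgue_measure R).
Local Notation I01 := (`[0, 1]%classic : set R).
Local Notation sq := (@square_integrable01 R).
Implicit Types f g h : R -> R.

Lemma sq_sqr_integrable f : sq f -> mu.-integrable I01 (EFin \o (fun t => f t ^+ 2)).
Proof.
move=> [mf f2]; apply/integrableP; split.
  by apply/measurable_EFinP; exact: measurable_funX.
by under eq_integral do rewrite /= ger0_norm ?sqr_ge0//.
Qed.

Lemma integrable_sq f : measurable_fun I01 f ->
  mu.-integrable I01 (EFin \o (fun t => f t ^+ 2)) -> sq f.
Proof.
move=> mf /integrableP[_ f2]; split=> //.
by under eq_integral do rewrite -(ger0_norm (sqr_ge0 _)).
Qed.

Lemma integrable_cst01 (c : R) : mu.-integrable I01 (EFin \o cst c).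
Proof. by apply: continuous_compact_integrable; [exact: segment_compact|exact: cst_continuous]. Qed.

Lemma integrable01Z (c : R) f : mu.-integrable I01 (EFin \o f) ->
  mu.-integrable I01 (EFin \o (fun t => c * f t)).
Proof. by move=> h; have := @integrableZl _ _ _ mu I01 (measurable_itv _) c _ h. Qed.

Lemma integrable01D f g : mu.-integrable I01 (EFin \o f) ->
  mu.-integrable I01 (EFin \o g) -> mu.-integrable I01 (EFin \o (fun t => f t + g t)).
Proof. by move=> h k; have := @integrableD _ _ _ mu I01 (measurable_itv _) _ _ h k. Qed.

Lemma sq_mul_integrable f g : sq f -> sq g ->
  mu.-integrable I01 (EFin \o (fun t => f t * g t)).
Proof.
move=> sf sg; have if2 := sq_sqr_integrable sf; have ig2 := sq_sqr_integrable sg.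
apply: le_integrable (integrableD _ if2 ig2) => //.
  by apply/measurable_EFinP; apply: measurable_funM; [case: sf|case: sg].
move=> t _; rewrite /= lee_fin [leRHS]ger0_norm ?addr_ge0 ?sqr_ge0//.
rewrite normrM -(real_normK (num_real (f t))) -(real_normK (num_real (g t))).
have := normr_ge0 (f t); have := normr_ge0 (g t).
have := sqr_ge0 (`|f t| - `|g t|); nra.
Qed.

Lemma bounded_sq f (M : R) : measurable_fun I01 f ->
  (forall t, I01 t -> `|f t| <= M) -> sq f.
Proof.
move=> mf fM; apply: integrable_sq => //.
apply: le_integrable (integrable_cst01 (M ^+ 2)) => //.
  by apply/measurable_EFinP; exact: measurable_funX.
move=> t It; rewrite /= lee_fin normrX [leRHS]ger0_norm ?sqr_ge0//.
by rewrite lerXn2r ?nnegrE// ?fM// (le_trans _ (fM _ It)).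
Qed.

Lemma cst_sq (c : R) : sq (cst c).
Proof. by apply: (@bounded_sq _ `|c|) => //; exact: measurable_cst. Qed.

Lemma sq_integrable f : sq f -> mu.-integrable I01 (EFin \o f).
Proof.
move=> sf; have := sq_mul_integrable sf (cst_sq 1).
by congr (_.-integrable _ _); apply/funext => t /=; rewrite mulr1.
Qed.

Lemma within_continuous_sq f : {within I01, continuous f} -> sq f.
Proof.
move=> cf; have mf : measurable_fun I01 f.
  by apply: subspace_continuous_measurable_fun => //; exact: measurable_itv.
apply: integrable_sq => //; apply: continuous_compact_integrable.
  exact: segment_compact.
by move=> t; apply: cvgM; exact: cf.
Qed.

Lemma Rintegral_ae f g : measurable_fun I01 f -> measurable_fun I01 g ->
  {ae mu, forall t, I01 t -> f t = g t} ->
  \int[mu]_(t in I01) f t = \int[mu]_(t in I01) g t.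
Proof.
move=> mf mg fg; congr fine; apply: ae_eq_integral => //.
- exact/measurable_EFinP.
- exact/measurable_EFinP.
- apply: (@filterS _ _ (ae_filter_ringOfSetsType mu) _ _ _ fg) => t h It.
  by rewrite /= h.
Qed.

Lemma Rintegral_dominated (f_ : nat -> R -> R) f g :
  (forall n, measurable_fun I01 (f_ n)) ->
  (forall t, I01 t -> f_ n t @[n --> \oo] --> f t) ->
  mu.-integrable I01 (EFin \o g) ->
  (forall n t, I01 t -> `|f_ n t| <= g t) ->
  \int[mu]_(t in I01) f_ n t @[n --> \oo] --> \int[mu]_(t in I01) f t.
Proof.
move=> mf_ ff ig fg.
have mf : measurable_fun I01 f.
  by apply: (@measurable_fun_cvg _ _ _ _ f_).
have cv : (\int[mu]_(t in I01) (f_ n t)%:E @[n --> \oo] --> \int[mu]_(t in I01) (f t)%:E)%E.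
  apply: (@dominated_cvg _ _ _ mu I01 (measurable_itv _) (fun n => EFin \o f_ n) _ (EFin \o g)) => //.
  - by move=> n; apply/measurable_EFinP; exact: mf_.
  - by move=> t It; apply: cvg_EFin; [exact: nearW|exact: ff].
apply: fine_cvg; rewrite fineK//; apply: integrable_fin_num => //.
apply: le_integrable ig => //; first exact/measurable_EFinP.
move=> t It; rewrite /= lee_fin (le_trans _ (ler_norm _))//.
apply: (@closed_cvg _ _ \oo _ (fun n => `|f_ n t|) (fun x => x <= g t)).
- exact: closed_le.
- by apply: nearW => n; exact: fg.
- by apply: cvg_norm; exact: ff.
Qed.

Lemma Rintegral_CS f g : sq f -> sq g ->
  (\int[mu]_(t in I01) (f t * g t)) ^+ 2 <=
  \int[mu]_(t in I01) (f t ^+ 2) * \int[mu]_(t in I01) (g t ^+ 2).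
Proof.
move=> sf sg.
have if2 := sq_sqr_integrable sf; have ig2 := sq_sqr_integrable sg.
have ifg := sq_mul_integrable sf sg.
set A := \int[mu]_(t in I01) (f t ^+ 2); set C := \int[mu]_(t in I01) (g t ^+ 2).
set B := \int[mu]_(t in I01) _.
(* The quadratic form of the pair [f], [g] is nonnegative; it is evaluated below
   at [(- B, A)], [(C, - B)] and [(1, - B)]. *)
have h (x y : R) : 0 <= x ^+ 2 * A + x * y * 2 * B + y ^+ 2 * C.
  have : 0 <= \int[mu]_(t in I01) (x * f t + y * g t) ^+ 2.
    by apply: Rintegral_ge0 => t _; exact: sqr_ge0.
  under eq_Rintegral.
    move=> t _; rewrite (_ : _ ^+ 2 = x ^+ 2 * f t ^+ 2 + x * y * 2 * (f t * g t)
      + y ^+ 2 * g t ^+ 2); last by ring.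
    over.
  have i1 := integrable01Z (x ^+ 2) if2.
  have i2 := integrable01Z (x * y * 2) ifg.
  have i3 := integrable01Z (y ^+ 2) ig2.
  rewrite RintegralD//; last exact: integrable01D.
  by rewrite RintegralD// !RintegralZl.
have A0 : 0 <= A by apply: Rintegral_ge0 => t _; exact: sqr_ge0.
have C0 : 0 <= C by apply: Rintegral_ge0 => t _; exact: sqr_ge0.
have hA : 0 <= A * (A * C - B ^+ 2) by have := h (- B) A; nra.
have hC : 0 <= C * (A * C - B ^+ 2) by have := h C (- B); nra.
move: A0; rewrite le_eqVlt => /predU1P[A0|A0]; last first.
  by rewrite -subr_ge0 -(pmulr_rge0 _ A0).
move: C0; rewrite le_eqVlt => /predU1P[C0|C0]; last first.
  by rewrite -subr_ge0 -(pmulr_rge0 _ C0).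
by have := h 1 (- B); rewrite -A0 -C0; nra.
Qed.

End calculus.

(** * Weak derivatives *)

Section fundamental_lemma.
Variable R : realType.
Local Notation mu := (@lebesgue_measure R).
Local Notation I01 := (`[0, 1]%classic : set R).
Implicit Types g : R -> R.

Lemma locally_integrable_Rintegral_oo g (a b : R) :
  locally_integrable `]0, 1[%classic g ->
  (forall phi, test_function phi -> \int[mu]_(t in I01) (g t * phi t) = 0) ->
  0 < a -> b < 1 ->
  mu.-integrable `]a, b[%classic (EFin \o g) /\
  \int[mu]_(t in `]a, b[%classic) g t = 0.
Proof.
move=> lg gphi a0 b1; have [mg oI ig] := lg.
have sab : (`[a, b]%classic : set R) `<=` `]0, 1[%classic.
  by move=> t /=; rewrite !in_itv/= => /andP[at_ tb]; apply/andP; split; lra.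
have igab : mu.-integrable `[a, b]%classic (EFin \o g).
  apply/integrableP; split; last by apply: ig; [exact: sab|exact: segment_compact].
  by apply/measurable_EFinP; apply: measurable_funS mg.
have igo : mu.-integrable `]a, b[%classic (EFin \o g).
  by apply: integrableS igab => //; exact: subset_itv_oo_cc.
split=> //.
have sab1 : (`]a, b[%classic : set R) `<=` I01.
  by apply: subset_trans (@subset_itv_oo_cc _ _ _ _) _ => t /sab; exact: subset_itv_oo_cc.
have igr : mu.-integrable I01 (EFin \o (g \_ `]a, b[%classic)).
  by rewrite -restrict_EFin; apply/integrable_restrict => //; rewrite setIidr.
rewrite -[X in Rintegral _ X](setIidr sab1) Rintegral_mkcondr.
have mgk k : measurable_fun I01 (fun t => g t * smooth_bump a b k t).
  have /integrableP[] := @integrable_loc_test R g _ lg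
    (smooth_bump_test_function k (ltW a0) (ltW b1)).
  by move=> /measurable_EFinP.
have gE t : (g \_ `]a, b[%classic) t = g t * \1_(`]a, b[%classic) t.
  by rewrite patchE indicE; case: ifP; rewrite ?mulr1 ?mulr0.
have cv : \int[mu]_(t in I01) (g t * smooth_bump a b k t) @[k --> \oo] -->
    \int[mu]_(t in I01) (g \_ `]a, b[%classic) t.
  apply: (@Rintegral_dominated _ _ _ (fun t => `|(g \_ `]a, b[%classic) t|)) => //.
  - by move=> t It; rewrite gE; apply: cvgM; [exact: cvg_cst|exact: smooth_bump_cvg].
  - exact: integrable_norm.
  - move=> k t It; rewrite gE [leLHS]normrM [leRHS]normrM ler_wpM2l//.
    rewrite indicE; case: (boolP (t \in _)) => tab.
      by rewrite normr1 ger0_norm ?smooth_bump_ge0 ?smooth_bump_le1.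
    rewrite (_ : smooth_bump a b k t = 0) ?normr0//; apply/eqP; apply: contraNT tab.
    move=> /smooth_bump_neq0[h1 h2]; rewrite inE/= in_itv/=.
    have k0 : 0 < (k%:R : R).
      by rewrite lt_def ler0n andbT; apply: contraTN h1 => /eqP->; rewrite mul0r -leNgt.
    by apply/andP; split; rewrite -subr_gt0 -(pmulr_rgt0 _ k0); lra.
move: cv; under eq_cvg do rewrite (gphi _ (smooth_bump_test_function _ (ltW a0) (ltW b1))).
by move/cvg_lim => <-//; rewrite lim_cst.
Qed.

(** A locally integrable function annihilated by all test functions vanishes
    almost everywhere: its integrals over intervals vanish, as limits of
    integrals against bumps, so its primitive is constant. *)
Lemma locally_integrable_eq0 g : locally_integrable `]0, 1[%classic g ->
  (forall phi, test_function phi -> \int[mu]_(t in I01) (g t * phi t) = 0) ->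
  {ae mu, forall t, I01 t -> g t = 0}.
Proof.
move=> lg gphi.
have ae_oo (a b : R) : 0 < a -> b < 1 -> {ae mu, forall t, a < t < b -> g t = 0}.
  move=> a0 b1; have [igab _] := locally_integrable_Rintegral_oo lg gphi a0 b1.
  pose f := g \_ `]a, b[%classic.
  have fi : mu.-integrable setT (EFin \o f).
    by rewrite -restrict_EFin; apply/integrable_restrict => //; rewrite setTI.
  have fiy y : mu.-integrable `]-oo, y]%classic (EFin \o f) by exact: integrableS fi.
  have floc : locally_integrable setT f by apply: open_integrable_locally => //; exact: openT.
  have := FTC1Ny fiy floc.
  have F0 y : \int[mu]_(t in `]-oo, y]%classic) f t = 0.
    rewrite -Rintegral_mkcondr.
    have [yb|by_] := ltP y b; last first.
      rewrite setIidr; first by have [] := locally_integrable_Rintegral_oo lg gphi a0 b1.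
      by move=> t /=; rewrite !in_itv/= => /andP[_ /ltW/le_trans]; exact.
    have [igy gy] := locally_integrable_Rintegral_oo lg gphi a0 (lt_trans yb b1).
    rewrite (_ : _ `&` _ = `]a, y]%classic) -?Rintegral_itv_bndo_bndc//.
    apply/seteqP; split=> t /=; rewrite !in_itv/=.
      by move=> [-> /andP[->]].
    by move=> /andP[-> ty]; rewrite ty (le_lt_trans ty).
  have -> : (fun y => \int[mu]_(t in `]-oo, y]%classic) f t) = cst 0.
    by apply/funext => y; exact: F0.
  apply: (@filterS _ _ (ae_filter_ringOfSetsType mu)) => t [_].
  rewrite derive1E derive_cst /f patchE => ft tab; rewrite ft.
  by rewrite mem_set//= in_itv.
have /ae_foralln h : forall n : nat, {ae mu, forall t, n.+1%:R^-1 < t < 1 - n.+1%:R^-1 -> g t = 0}.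
  move=> n; apply: ae_oo; first by rewrite invr_gt0.
  by rewrite ltrBlDr ltrDl invr_gt0.
have h0 (c : R) : {ae mu, forall t, t <> c}.
  exists [set c]; split => //; first exact: lebesgue_measure_set1.
  by move=> t /= /contrapT.
have h01 := @filterI _ _ (ae_filter_ringOfSetsType mu) _ _ h
   (@filterI _ _ (ae_filter_ringOfSetsType mu) _ _ (h0 0) (h0 1)).
apply: (@filterS _ _ (ae_filter_ringOfSetsType mu) _ _ _ h01) => t [ht [/eqP t0 /eqP t1]].
rewrite /= in_itv/= !le_eqVlt eq_sym (negbTE t0) (negbTE t1)/= => /andP[t0' t1'].
have [n hn] : exists n : nat, n.+1%:R^-1 < Num.min t (1 - t).
  have m0 : 0 < Num.min t (1 - t) by rewrite lt_min t0' subr_gt0.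
  exists (Num.trunc (Num.min t (1 - t))^-1).
  by rewrite invf_plt ?posrE// truncnS_gt.
by apply: (ht n); move: hn; rewrite lt_min => /andP[-> h2]; rewrite ltrBrDr -ltrBrDl.
Qed.

End fundamental_lemma.

(** ** Primitives *)

Section primitives.
Variable R : realType.
Local Notation mu := (@lebesgue_measure R).
Local Notation I01 := (`[0, 1]%classic : set R).
Implicit Types f g : R -> R.

(** The primitive of [g] that vanishes at 0, for [t] in the unit interval. *)
Definition prim g (t : R) : R := \int[mu]_(s in `[0, t]%classic) g s.

(** The integral of [f] from [s] to 1: the adjoint of [prim]. *)
Definition coprim f (s : R) : R := \int[mu]_(t in `[s, 1]%classic) f t.

Lemma integrable_itv01 f (a b : R) : mu.-integrable I01 (EFin \o f) ->
  0 <= a -> b <= 1 -> mu.-integrable `[a, b]%classic (EFin \o f).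
Proof.
move=> fi a0 b1; apply: integrableS fi => //.
by move=> t /=; rewrite !in_itv/= => /andP[at_ tb]; apply/andP; split; lra.
Qed.

Let rT := measurableTypeR R.

Let tri : set (rT * rT) := [set x | x.2 <= x.1].

Let measurable_tri : measurable tri.
Proof.
have := @measurable_fun_le _ _ _ setT (@snd rT rT) (@fst rT rT) measurableT
  measurable_snd measurable_fst.
by rewrite setTI.
Qed.

(** Fubini on the triangle of the pairs [(t, s)] with [s <= t]. *)
Lemma Rintegral_mul_prim f g :
  mu.-integrable I01 (EFin \o f) -> mu.-integrable I01 (EFin \o g) ->
  \int[mu]_(t in I01) (f t * prim g t) = \int[mu]_(s in I01) (coprim f s * g s).
Proof.
move=> fi gi.
pose F := f \_ I01; pose G := g \_ I01.
have Fi : mu.-integrable setT (EFin \o F).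
  by rewrite -restrict_EFin; apply/integrable_restrict => //; rewrite setTI.
have Gi : mu.-integrable setT (EFin \o G).
  by rewrite -restrict_EFin; apply/integrable_restrict => //; rewrite setTI.
have mF : measurable_fun setT F by case/integrableP: Fi => /measurable_EFinP.
have mG : measurable_fun setT G by case/integrableP: Gi => /measurable_EFinP.
pose K (x : rT * rT) : R := F x.1 * G x.2 * \1_tri x.
have mK : measurable_fun setT K.
  apply: measurable_funM; last exact: measurable_indic.
  by apply: measurable_funM; exact: measurableT_comp.
have Ki : (mu \x mu)%E.-integrable setT (EFin \o K).
  apply/integrable12ltyP; first exact/measurable_EFinP.
  apply: (@le_lt_trans _ _ (\int[mu]_x (`|F x|%:E * \int[mu]_y `|G y|%:E))%E).
    apply: ge0_le_integral => //.
    - by move=> x _; exact: integral_ge0.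
    - apply: (@measurable_fun_fubini_tonelli_F _ _ rT rT _ mu (fun x : rT * rT => `|(K x)%:E|)%E).
        by apply: measurableT_comp => //; exact/measurable_EFinP.
      by move=> z; exact: abse_ge0.
    - apply: emeasurable_funM => //; apply/measurable_EFinP.
      exact: measurableT_comp.
    - move=> x _; rewrite -ge0_integralZl//.
      + apply: ge0_le_integral => //.
        * apply/measurable_EFinP; apply: measurableT_comp => //.
          exact: (measurableT_comp mK (pair1_measurable x)).
        * apply/measurable_EFinP; apply: measurable_funM => //.
          exact: measurableT_comp.
        * move=> y _; rewrite /K /= -EFinM lee_fin !normrM ler_piMr ?mulr_ge0//.
          by rewrite indicE; case: (_ \in _); rewrite ?normr1 ?normr0.
      + by apply/measurable_EFinP; exact: measurableT_comp.
  under eq_integral do rewrite muleC.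
  have /integrableP[_ Gy] := Gi; have /integrableP[_ Fy] := Fi.
  rewrite ge0_integralZl//; last 2 first.
  - by apply/measurable_EFinP; exact: measurableT_comp.
  - exact: integral_ge0.
  by rewrite lte_mul_pinfty// ?integral_ge0// ge0_fin_numE// integral_ge0.
have inner1 (x : R) : (\int[mu]_y (EFin \o K) (x, y) = (F x * prim g x)%:E)%E.
  rewrite /K /F /=; have [x01|x01] := boolP (x \in I01); last first.
    by rewrite patchE (negbTE x01) mul0r integral0_eq// => y _; rewrite /= !mul0r.
  have x1 : x <= 1 by move: x01; rewrite inE/= in_itv/= => /andP[].
  pose gx := g \_ (`[0, x]%classic : set R).
  have gi' := integrable_itv01 gi (lexx 0) x1.
  have -> : (fun y : R => (((f \_ I01) x * G y * \1_tri (x, y))%:E)) =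
      (fun y : R => ((f \_ I01) x)%:E * (gx y)%:E)%E.
    apply/funext => y; rewrite -EFinM -mulrA; congr (_ * _)%:E.
    rewrite /G /gx !patchE indicE.
    have -> : ((x, y) \in tri) = (y <= x) by apply/idP/idP; rewrite inE.
    rewrite !mem_setE/= !in_itv/=.
    case: (boolP (y <= x)) => yx; rewrite ?mulr0 ?mulr1 ?andbF// andbT.
    by rewrite (le_trans yx x1) andbT.
  have gx' : mu.-integrable setT (EFin \o gx).
    by rewrite -restrict_EFin; apply/integrable_restrict => //; rewrite setTI.
  rewrite integralZl// /prim Rintegral_mkcond /Rintegral EFinM fineK//.
  exact: integrable_fin_num.
have inner2 (y : R) : (\int[mu]_x (EFin \o K) (x, y) = (coprim f y * G y)%:E)%E.
  rewrite /K /G /=; have [y01|y01] := boolP (y \in I01); last first.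
    by rewrite patchE (negbTE y01) mulr0 integral0_eq// => x _; rewrite /= mulr0 mul0r.
  have y0 : 0 <= y by move: y01; rewrite inE/= in_itv/= => /andP[].
  pose fy := f \_ (`[y, 1]%classic : set R).
  have fi' := integrable_itv01 fi y0 (lexx 1).
  have -> : (fun x : R => ((F x * (g \_ I01) y * \1_tri (x, y))%:E)) =
      (fun x : R => ((g \_ I01) y)%:E * (fy x)%:E)%E.
    apply/funext => x; rewrite -EFinM mulrAC mulrC; congr (_ * _)%:E.
    rewrite /F /fy !patchE indicE.
    have -> : ((x, y) \in tri) = (y <= x) by apply/idP/idP; rewrite inE.
    rewrite !mem_setE/= !in_itv/=.
    case: (boolP (y <= x)) => yx; rewrite ?mulr0 ?mulr1 ?andbF//=.
    by rewrite (le_trans y0 yx).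
  have fy' : mu.-integrable setT (EFin \o fy).
    by rewrite -restrict_EFin; apply/integrable_restrict => //; rewrite setTI.
  rewrite integralZl// mulrC /coprim Rintegral_mkcond /Rintegral EFinM fineK//.
  exact: integrable_fin_num.
have := Fubini Ki.
under eq_integral do rewrite inner1.
under [in RHS]eq_integral do rewrite inner2.
move=> h; rewrite Rintegral_mkcond [RHS]Rintegral_mkcond /Rintegral.
rewrite (_ : (fun t => (f t * prim g t)) \_ I01 = fun t => F t * prim g t).
  rewrite h; congr (fine (integral _ _ _)); apply/funext => s.
  by rewrite /G !patchE; case: ifP; rewrite ?mulr0.
by apply/funext => s; rewrite /F !patchE; case: ifP; rewrite ?mul0r.
Qed.

Lemma prim_continuous g : mu.-integrable I01 (EFin \o g) ->
  {within I01, continuous (prim g)}.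
Proof. exact: parameterized_integral_continuous. Qed.

End primitives.

(** ** Test functions *)

Section test_functions.
Variable R : realType.
Local Notation mu := (@lebesgue_measure R).
Local Notation I01 := (`[0, 1]%classic : set R).
Implicit Types phi psi : R -> R.

Lemma test_function_itv phi : test_function phi ->
  exists a b : R, [/\ 0 < a, b < 1 & forall t, ~~ (a <= t <= b) -> phi t = 0].
Proof.
move=> tp; have [_ cK K01] := tp; set K := closure _ in cK K01.
have [K0|/set0P Kn0] := eqVneq K set0.
  exists 2^-1, 2^-1; split; [lra|lra|move=> t _].
  by apply: test_function_eq0; rewrite -/K K0.
have cid : {within K, continuous (id : R -> R)}.
  by apply: continuous_subspaceT => t; exact: cvg_id.
have [a Ka ha] := compact_EVT_min Kn0 cK cid.
have [b Kb hb] := compact_EVT_max Kn0 cK cid.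
exists a, b; split.
- by move: (K01 _ (set_mem Ka)) => /=; rewrite in_itv/= => /andP[].
- by move: (K01 _ (set_mem Kb)) => /=; rewrite in_itv/= => /andP[].
- move=> t /negP tab; apply: test_function_eq0 => /mem_set Kt; apply: tab.
  by rewrite ha// hb.
Qed.

Lemma closure_itv_test phi (a b : R) : 0 < a -> b < 1 ->
  (forall k t, derivable (derive1n k phi) t 1) ->
  (forall t, ~~ (a <= t <= b) -> phi t = 0) -> test_function phi.
Proof.
move=> a0 b1 dphi phi0.
have sub : closure [set t | phi t != 0] `<=` `[a, b]%classic.
  rewrite closureE => t /(_ `[a, b]%classic); apply; split.
    exact: interval_closed.
  by move=> s /=; rewrite in_itv/=; apply: contraNT => /phi0 ->.
split => //.
- by apply: subclosed_compact sub; [exact: closed_closure|exact: segment_compact].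
- by move=> t /sub /=; rewrite !in_itv/= => /andP[h1 h2]; apply/andP; split; lra.
Qed.

Lemma test_function_derive1 phi : test_function phi -> test_function (derive1 phi).
Proof.
move=> tp; have [a [b [a0 b1 h]]] := test_function_itv tp.
apply: (closure_itv_test a0 b1) => [k t|t tab].
  by have [d _ _] := tp; rewrite -derive1Sn; exact: d.
rewrite derive1E -(derive_cst (0 : R) (t : R) (1 : R)); apply: near_eq_derive.
move: tab; rewrite negb_and -!ltNge => /orP[ta|bt].
  near=> s; rewrite h//= negb_and -!ltNge; apply/orP; left.
  by near: s; exact: lt_nbhsl.
near=> s; rewrite h//= negb_and -!ltNge; apply/orP; right.
by near: s; exact: lt_nbhsr.
Unshelve. all: by end_near. Qed.

Lemma test_function_derive1n k phi : test_function phi -> test_function (derive1n k phi).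
Proof.
by move=> tp; elim: k => // k IHk; rewrite derive1nS; exact: test_function_derive1.
Qed.

Lemma derive1n_lin k (a : R) phi psi :
  (forall k t, derivable (derive1n k phi) t 1) ->
  (forall k t, derivable (derive1n k psi) t 1) ->
  derive1n k (a *: phi + psi) = a *: derive1n k phi + derive1n k psi.
Proof.
move=> dphi dpsi; elim: k => // k IHk; rewrite !derive1nS IHk.
apply/funext => t; rewrite derive1E.
have dZ : derivable (a *: derive1n k phi) t 1 by apply: derivableZ; exact: dphi.
rewrite (deriveD dZ (dpsi k t)) (deriveZ a (dphi k t)).
by rewrite -!derive1E.
Qed.

Lemma test_function_lin (a : R) phi psi :
  test_function phi -> test_function psi -> test_function (a *: phi + psi).
Proof.
move=> tp tq; have [dp _ _] := tp; have [dq _ _] := tq.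
have [a1 [b1 [a10 b11 h1]]] := test_function_itv tp.
have [a2 [b2 [a20 b21 h2]]] := test_function_itv tq.
apply: (@closure_itv_test _ (Num.min a1 a2) (Num.max b1 b2)).
- by rewrite lt_min a10.
- by rewrite gt_max b11.
- move=> k t; rewrite derive1n_lin//.
  by apply: derivableD => //; apply: derivableZ; exact: dp.
- move=> t tab; have -> : (a *: phi + psi) t = a * phi t + psi t by [].
  rewrite h1 ?h2 ?mulr0 ?addr0//; apply: contra tab => /andP[ha hb].
    by rewrite ge_min ha orbT le_max hb orbT.
  by rewrite ge_min ha le_max hb.
Qed.

Lemma test_function_sq phi : test_function phi -> square_integrable01 phi.
Proof.
move=> tp; apply: within_continuous_sq; apply: continuous_subspaceT.
exact: (@test_function_continuous _ 0).
Qed.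

Lemma test_function_integrable phi : test_function phi ->
  mu.-integrable I01 (EFin \o phi).
Proof. by move=> tp; apply: sq_integrable; exact: test_function_sq. Qed.

Lemma test_function_boundary phi (t : R) : test_function phi ->
  (t <= 0) || (1 <= t) -> phi t = 0.
Proof.
move=> tp h; have [a [b [a0 b1 ->]]] // := test_function_itv tp.
by apply/negP => /andP[]; case/orP: h; lra.
Qed.

Lemma coprim_derive1 phi (s : R) : test_function phi -> I01 s ->
  coprim (derive1 phi) s = - phi s.
Proof.
move=> tp; rewrite /= in_itv/= => /andP[s0]; rewrite le_eqVlt => /predU1P[->|s1].
  by rewrite /coprim set_itv1 Rintegral_set1 (test_function_boundary (t := 1) tp) ?lexx ?orbT ?oppr0.
have cphi := @test_function_continuous _ 0 _ tp.
have [d _ _] := tp.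
rewrite /coprim /Rintegral (@continuous_FTC2 _ _ phi)//.
- by rewrite (test_function_boundary (t := 1) tp) ?lexx ?orbT// -EFinB/= sub0r.
- by apply: continuous_subspaceT; exact: (@test_function_continuous _ 1).
- split.
  + by move=> t _; exact: (d 0%N).
  + by apply: cvg_at_right_filter; exact: cphi.
  + by apply: cvg_at_left_filter; exact: cphi.
Qed.

Lemma Rintegral_derive1_test phi : test_function phi ->
  \int[mu]_(t in I01) derive1 phi t = 0.
Proof.
move=> tp; have := coprim_derive1 (s := 0) tp.
rewrite (test_function_boundary (t := 0) tp) ?lexx// oppr0 /coprim; apply.
by rewrite /= in_itv/= lexx ler01.
Qed.

Lemma test_function_prim phi : test_function phi ->
  \int[mu]_(t in I01) phi t = 0 ->
  test_function (prim phi) /\ derive1 (prim phi) = phi.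
Proof.
move=> tp int0; have cphi := @test_function_continuous _ 0 _ tp.
have [a [b [a0 b1 h]]] := test_function_itv tp.
have primE t : prim phi t = \int[mu]_x ((phi \_ (`[0, t]%classic : set R)) x).
  by rewrite /prim Rintegral_mkcond.
have prim0 t : ~~ (a <= t <= b) -> prim phi t = 0.
  rewrite negb_and -!ltNge => /orP[ta|bt].
    rewrite primE (_ : phi \_ _ = cst 0) ?Rintegral_cst ?mul0r//.
    apply/funext => x; rewrite patchE; case: ifPn => // /set_mem/=.
    by rewrite in_itv/= => /andP[x0 xt]; apply: h; apply/negP => /andP[]; lra.
  rewrite primE -[RHS]int0 [RHS]Rintegral_mkcond; congr (Rintegral _ _ _).
  apply/funext => x; rewrite !patchE.
  have [xb|xb] := ltP b x.
    have px : phi x = 0 by apply: h; apply/negP => /andP[]; lra.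
    by rewrite px !if_same.
  rewrite !mem_setE/= !in_itv/=; congr (if _ && _ then _ else _).
  by apply/idP/idP => ?; lra.
have dprim t : derivable (prim phi) t 1 /\ derive1 (prim phi) t = phi t.
  have [t0|t0] := ltP 0 t.
    apply: (@continuous_FTC1_closed _ phi 0 t (t + 1)) => //; last exact: cphi.
      by rewrite ltrDl.
    apply: continuous_compact_integrable; first exact: segment_compact.
    exact: continuous_subspaceT.
  have near0 : \forall s \near t, cst 0 s = prim phi s.
    near=> s; rewrite prim0// negb_and -!ltNge; apply/orP; left.
    near: s; apply: lt_nbhsl; lra.
  split; first by apply: near_eq_derivable near0 _; exact: derivable_cst.
  rewrite derive1E -(near_eq_derive _ near0) derive_cst h//.
  by apply/negP => /andP[]; lra.
have dE : derive1 (prim phi) = phi by apply/funext => t; case: (dprim t).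
split=> //; apply: (closure_itv_test a0 b1) => // -[|k] t; first by case: (dprim t).
by rewrite derive1Sn dE; have [d _ _] := tp; exact: d.
Unshelve. all: by end_near. Qed.

Lemma test_function_unit : exists2 theta : R -> R, test_function theta &
  \int[mu]_(t in I01) theta t = 1.
Proof.
(* If all integrals of test functions were null, the constant 1 would vanish
   almost everywhere. *)
have [[th tth th0]|no] := pselect (exists2 th : R -> R, test_function th &
    \int[mu]_(t in I01) th t != 0); last first.
  have lc : locally_integrable (`]0, 1[%classic : set R) (cst 1).
    apply: open_integrable_locally; first exact: interval_open.
    by apply: integrableS (integrable_cst01 1) => //; exact: subset_itv_oo_cc.
  have [] := locally_integrable_eq0 lc.
    move=> phi tp; transitivity (\int[mu]_(t in I01) phi t).
      by apply: eq_Rintegral => t _; rewrite /= mul1r.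
    by apply: contrapT => /eqP h; apply: no; exists phi.
  move=> N [mN N0 sN]; have : (mu I01 <= mu N)%E.
    apply: le_measure; rewrite ?inE// => t It; apply: sN => /= /(_ It)/eqP.
    by rewrite oner_eq0.
  by rewrite N0 lebesgue_measure_itv/= lte_fin ltr01 oppr0 addr0 lee_fin ler10.
pose c := \int[mu]_(t in I01) th t.
(* This is [c^-1 *: th], in the form that stability under linear combinations
   covers. *)
exists ((c^-1 - 1) *: th + th); first exact: test_function_lin.
rewrite (_ : _ + _ = fun t => c^-1 * th t); last first.
  apply/funext => t; rewrite [LHS](_ : _ = (c^-1 - 1) * th t + th t)//.
  by rewrite mulrBl mul1r subrK.
by rewrite RintegralZl//; [rewrite mulVf|exact: test_function_integrable].
Qed.

End test_functions.

(** * Iterated primitives *)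

Section taylor.
Variable R : realType.
Local Notation mu := (@lebesgue_measure R).
Local Notation I01 := (`[0, 1]%classic : set R).
Local Notation integ g := (mu.-integrable I01 (EFin \o g)).
Local Notation sq := (@square_integrable01 R).
Implicit Types (f g phi psi : R -> R) (c : nat -> R).

(** The [n]-th iterated primitive of [g], with integration constants [c]: the
    Taylor formula with integral remainder, in recursive form. For [k < n], the
    constant [c k] is the value at 0 of the derivative of order [n - 1 - k]. *)
Fixpoint taylor n c g : R -> R :=
  match n with 0%N => g | k.+1 => fun t => c k + prim (taylor k c g) t end.

Lemma taylorSr n c g :
  taylor n.+1 c g = taylor n (fun i => c i.+1) (fun t => c 0%N + prim g t).
Proof. by elim: n => // n IHn; rewrite [RHS]/= -IHn. Qed.

Lemma prim_sq g (a : R) : integ g -> sq (fun t => a + prim g t).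
Proof.
move=> gi; apply: within_continuous_sq => t; apply: cvgD; first exact: cvg_cst.
exact: prim_continuous.
Qed.

Lemma taylor_integrable n c g : integ g -> integ (taylor n c g).
Proof. by move=> gi; elim: n => //= n IHn; apply: sq_integrable; exact: prim_sq. Qed.

Lemma taylor_sq n c g : sq g -> sq (taylor n c g).
Proof.
case: n => //= n gi; apply: prim_sq; apply: taylor_integrable; exact: sq_integrable.
Qed.

Lemma taylor_continuous n c g : integ g ->
  {within I01, continuous (taylor n.+1 c g)}.
Proof.
move=> gi t; apply: cvgD; first exact: cvg_cst.
by apply: prim_continuous; exact: taylor_integrable.
Qed.

Lemma integrable_itv0 g (t : R) : integ g -> I01 t ->
  mu.-integrable `[0, t]%classic (EFin \o g).
Proof.
by move=> gi; rewrite /= in_itv/= => /andP[_ t1]; exact: integrable_itv01.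
Qed.

Lemma prim_lin (a : R) f g t : integ f -> integ g -> I01 t ->
  prim (fun s => a * f s + g s) t = a * prim f t + prim g t.
Proof.
move=> fi gi It; have fi' := integrable_itv0 fi It; have gi' := integrable_itv0 gi It.
rewrite /prim RintegralD//; first by rewrite RintegralZl.
by have := @integrableZl _ _ _ mu `[0, t]%classic (measurable_itv _) a _ fi'.
Qed.

Lemma eq_prim f g t : I01 t -> {in I01, f =1 g} -> prim f t = prim g t.
Proof.
move=> It fg; apply: eq_Rintegral => s; rewrite inE/= in_itv/= => /andP[s0 st].
apply: fg; rewrite inE/= in_itv/= s0 (le_trans st)//.
by move: It; rewrite /= in_itv/= => /andP[].
Qed.

Lemma taylor_lin n (a : R) c c' f g t : integ f -> integ g -> I01 t ->
  taylor n (fun i => a * c i + c' i) (fun s => a * f s + g s) t =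
  a * taylor n c f t + taylor n c' g t.
Proof.
move=> fi gi; elim: n t => //= n IHn t It.
rewrite (@eq_prim _ (fun s => a * taylor n c f s + taylor n c' g s))//; last first.
  by move=> s /set_mem; exact: IHn.
by rewrite prim_lin//; [ring|exact: taylor_integrable..].
Qed.

Lemma ae_prim f g t : integ f -> integ g -> I01 t ->
  {ae mu, forall s, I01 s -> f s = g s} -> prim f t = prim g t.
Proof.
move=> fi gi It fg.
have /integrableP[mf _] := integrable_itv0 fi It.
have /integrableP[mg _] := integrable_itv0 gi It.
congr fine; apply: ae_eq_integral => //.
apply: (@filterS _ _ (ae_filter_ringOfSetsType mu) _ _ _ fg) => s + Is; rewrite /= => ->//.
move: Is It; rewrite /= !in_itv/= => /andP[s0 st] /andP[_ t1].
by rewrite s0 (le_trans st).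
Qed.

Lemma ae_taylor n c f g t : integ f -> integ g -> I01 t ->
  {ae mu, forall s, I01 s -> f s = g s} -> taylor n.+1 c f t = taylor n.+1 c g t.
Proof.
move=> fi gi It fg; elim: n t It => [|n IHn] t It.
  by congr (_ + _); exact: ae_prim.
by congr (_ + _); apply: eq_prim => // s /set_mem; exact: IHn.
Qed.

(** Integration by parts. *)
Lemma Rintegral_prim_derive1 (a : R) g phi : integ g -> test_function phi ->
  \int[mu]_(t in I01) ((a + prim g t) * derive1 phi t) =
  - \int[mu]_(t in I01) (g t * phi t).
Proof.
move=> gi tp; have tp1 := test_function_derive1 tp.
have sp1 := test_function_sq tp1; have ip1 := test_function_integrable tp1.
have pg : sq (prim g) by apply: within_continuous_sq; exact: prim_continuous.
under eq_Rintegral do rewrite mulrDl.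
rewrite RintegralD//; [|exact: integrable01Z|exact: sq_mul_integrable].
rewrite RintegralZl// Rintegral_derive1_test// mulr0 add0r.
under eq_Rintegral do rewrite mulrC.
rewrite Rintegral_mul_prim//.
rewrite (@eq_Rintegral _ _ _ mu I01 (fun t => -1 * (g t * phi t))); last first.
  by move=> t /set_mem It; rewrite coprim_derive1//; ring.
rewrite RintegralZl ?mulN1r//; apply: integrable_loc_test => //.
apply: open_integrable_locally; first exact: interval_open.
by apply: integrableS gi => //; exact: subset_itv_oo_cc.
Qed.

Lemma taylor_weak j n c g phi : integ g -> test_function phi ->
  \int[mu]_(t in I01) (taylor (j + n) c g t * derive1n j phi t) =
  (-1) ^+ j * \int[mu]_(t in I01) (taylor n c g t * phi t).
Proof.
move=> gi tp; elim: j => [|j IHj]; first by rewrite expr0 mul1r.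
rewrite addSn derive1nS /= Rintegral_prim_derive1 ?IHj; last 2 first.
- exact: taylor_integrable.
- exact: test_function_derive1n.
by rewrite exprS -mulrA mulN1r.
Qed.

Lemma integrable_locally01 g : integ g -> locally_integrable (`]0, 1[%classic : set R) g.
Proof.
move=> gi; apply: open_integrable_locally; first exact: interval_open.
by apply: integrableS gi => //; exact: subset_itv_oo_cc.
Qed.

(** Removing the last [j] integrations of an iterated primitive gives its [j]-th
    weak derivative. *)
Lemma taylor_is_weak_derivative j n c g h : integ g ->
  {in I01, h =1 taylor (j + n) c g} -> is_weak_derivative j h (taylor n c g).
Proof.
move=> gi hE; split; first by apply: integrable_locally01; exact: taylor_integrable.
move=> phi tp; rewrite -taylor_weak//; apply: eq_Rintegral => t It.
by rewrite hE.
Qed.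

Lemma is_weak_derivative_unique j h f g :
  is_weak_derivative j h f -> is_weak_derivative j h g ->
  {ae mu, forall t, I01 t -> f t = g t}.
Proof.
move=> [lf wf] [lg wg].
have := @locally_integrable_eq0 R (f - g) (locally_integrableB lf lg).
move=> /(_ _)/wrap[].
  move=> phi tp.
  have i1 := integrable_loc_test lf tp; have i2 := integrable_loc_test lg tp.
  transitivity (\int[mu]_(t in I01) (f t * phi t - g t * phi t)).
    by apply: eq_Rintegral => t _; rewrite -mulrBl.
  rewrite RintegralB//; apply/eqP; rewrite subr_eq0.
  have := wf _ tp; rewrite wg// => /esym/eqP.
  by rewrite (inj_eq (mulfI _)) // expf_neq0// oppr_eq0 oner_neq0.
apply: (@filterS _ _ (ae_filter_ringOfSetsType mu)) => t h0 It.
by apply/eqP; rewrite -subr_eq0; apply/eqP; exact: h0.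
Qed.

(** A function whose [n]-th distributional derivative is [g] is an [n]-th
    iterated primitive of [g]. Up to a multiple of [theta], every test function
    is the derivative of a test function, which lowers [n] by one. *)
Lemma weak_taylor n w g : integ w -> integ g ->
  (forall phi, test_function phi ->
    \int[mu]_(t in I01) (w t * derive1n n phi t) =
    (-1) ^+ n * \int[mu]_(t in I01) (g t * phi t)) ->
  exists c, {ae mu, forall t, I01 t -> w t = taylor n c g t}.
Proof.
move=> wi; elim: n g => [|n IHn] g gi hw.
  exists (fun=> 0); apply: (@is_weak_derivative_unique 0 w) => //.
    by split=> [|phi _]; [exact: integrable_locally01|rewrite mul1r].
  by split=> [|phi tp]; [exact: integrable_locally01|exact: hw].
have [theta tt int1] := test_function_unit R.
have lpg : sq (prim g) by apply: within_continuous_sq; exact: prim_continuous.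
pose K := \int[mu]_(t in I01) (w t * derive1n n theta t) -
  (-1) ^+ n * \int[mu]_(t in I01) (prim g t * theta t).
have wn phi : test_function phi -> integ (fun t => w t * derive1n n phi t).
  move=> tp; apply: integrable_loc_test; first exact: integrable_locally01.
  exact: test_function_derive1n.
have [//||c hc] := IHn (fun t => (-1) ^+ n * K + prim g t).
- by apply: sq_integrable; exact: prim_sq.
- move=> psi tpsi.
  pose I := \int[mu]_(t in I01) psi t.
  pose chi := (- I) *: theta + psi.
  have tchi : test_function chi by exact: test_function_lin.
  have ipsi := test_function_integrable tpsi; have ith := test_function_integrable tt.
  have chi0 : \int[mu]_(t in I01) chi t = 0.
    transitivity (\int[mu]_(t in I01) (- I * theta t + psi t)); first by [].
    rewrite RintegralD//; last exact: integrable01Z.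
    by rewrite RintegralZl// int1 mulr1 addNr.
  have [tPhi dPhi] := test_function_prim tchi chi0.
  have := hw _ tPhi; rewrite derive1Sn dPhi.
  have -> : \int[mu]_(t in I01) (g t * prim chi t) =
      - \int[mu]_(t in I01) (prim g t * chi t).
    rewrite -{2}dPhi; have := Rintegral_prim_derive1 0 gi tPhi.
    by under eq_Rintegral do rewrite add0r; move=> ->; rewrite opprK.
  have [dth _ _] := tt; have [dpsi _ _] := tpsi.
  rewrite /chi derive1n_lin//.
  have -> : \int[mu]_(t in I01) (w t * (- I *: derive1n n theta + derive1n n psi) t) =
    - I * \int[mu]_(t in I01) (w t * derive1n n theta t) +
    \int[mu]_(t in I01) (w t * derive1n n psi t).
    rewrite -RintegralZl ?wn// -RintegralD ?wn//; last by apply: integrable01Z; exact: wn.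
    apply: eq_Rintegral => t _.
    rewrite (_ : (_ + _) t = - I * derive1n n theta t + derive1n n psi t)//; ring.
  have ith' := sq_mul_integrable lpg (test_function_sq tt).
  have ipsi' := sq_mul_integrable lpg (test_function_sq tpsi).
  have -> : \int[mu]_(t in I01) (prim g t * (- I *: theta + psi) t) =
    - I * \int[mu]_(t in I01) (prim g t * theta t) +
    \int[mu]_(t in I01) (prim g t * psi t).
    rewrite -RintegralZl// -RintegralD//; last exact: integrable01Z.
    apply: eq_Rintegral => t _.
    rewrite (_ : (_ + _) t = - I * theta t + psi t)//; ring.
  have -> : \int[mu]_(t in I01) (((-1) ^+ n * K + prim g t) * psi t) =
    (-1) ^+ n * K * I + \int[mu]_(t in I01) (prim g t * psi t).
    rewrite -RintegralZl// -RintegralD//; last exact: integrable01Z.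
    by apply: eq_Rintegral => t _; ring.
  have sgn2 : ((-1) ^+ n * (-1) ^+ n = 1 :> R) by rewrite -expr2 sqrr_sign.
  rewrite mulrDr !mulrA sgn2 mul1r exprS /K.
  set A := Rintegral _ _ _; set Bb := Rintegral _ _ _; set C := Rintegral _ _ _;
  set D := Rintegral _ _ _; set s := (-1) ^+ n; clearbody s A Bb C D; lra.
by exists (fun i => if i is k.+1 then c k else (-1) ^+ n * K); rewrite taylorSr.
Qed.

End taylor.

(** ** Bounds on iterated primitives *)

Section taylor_bounds.
Variable R : realType.
Local Notation mu := (@lebesgue_measure R).
Local Notation I01 := (`[0, 1]%classic : set R).
Local Notation integ g := (mu.-integrable I01 (EFin \o g)).
Local Notation sq := (@square_integrable01 R).
Implicit Types (f g phi psi : R -> R) (c : nat -> R).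

(** The [L^2] norm on the unit interval. *)
Definition norm2 g : R := Num.sqrt (\int[mu]_(t in I01) g t ^+ 2).

Lemma norm2_ge0 g : 0 <= norm2 g. Proof. exact: sqrtr_ge0. Qed.

Lemma Rintegral_sqr_ge0 g : 0 <= \int[mu]_(t in I01) g t ^+ 2.
Proof. by apply: Rintegral_ge0 => t _; exact: sqr_ge0. Qed.

Lemma norm2_sqr g : norm2 g ^+ 2 = \int[mu]_(t in I01) g t ^+ 2.
Proof. by rewrite sqr_sqrtr// Rintegral_sqr_ge0. Qed.

Lemma Rintegral_cst01 (a : R) : \int[mu]_(t in I01) a = a.
Proof.
transitivity (a * fine (mu I01)); first exact: Rintegral_cst.
by rewrite lebesgue_measure_itv/= lte_fin ltr01 oppr0 adde0 mulr1.
Qed.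

Lemma norm_sq g : sq g -> sq (fun t => `|g t|).
Proof.
move=> [mg g2]; split; first exact: measurableT_comp.
by under eq_integral do rewrite real_normK ?num_real//.
Qed.

Lemma Rintegral_norm_le_norm2 g : sq g -> \int[mu]_(t in I01) `|g t| <= norm2 g.
Proof.
move=> sg; have := Rintegral_CS (norm_sq sg) (cst_sq 1).
under eq_Rintegral do rewrite mulr1.
under [X in _ <= X * _]eq_Rintegral do rewrite real_normK ?num_real//.
under [X in _ <= _ * X]eq_Rintegral do rewrite expr1n.
rewrite Rintegral_cst01 mulr1 => h.
rewrite -(@ler_pXn2r _ 2)// ?nnegrE ?norm2_ge0//; first by rewrite norm2_sqr.
by apply: Rintegral_ge0 => t _; exact: normr_ge0.
Qed.

Lemma integrable_norm01 g : integ g -> integ (fun t => `|g t|).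
Proof. exact: integrable_norm. Qed.

Lemma prim_bound g t : integ g -> I01 t ->
  `|prim g t| <= \int[mu]_(t in I01) `|g t|.
Proof.
move=> gi It; have gi' := integrable_itv0 gi It.
apply: (le_trans (le_normr_Rintegral _ gi')) => //.
have ni := integrable_norm01 gi.
have s01 : (`[0, t]%classic : set R) `<=` I01.
  move=> s; move: It; rewrite /= !in_itv/= => /andP[_ t1] /andP[-> st].
  exact: le_trans st t1.
rewrite -(setIidr s01) Rintegral_mkcondr; apply: le_Rintegral => //.
- rewrite -restrict_EFin; apply/integrable_restrict => //; rewrite setIidr//.
  exact: integrable_itv0.
- by move=> s _; rewrite patchE; case: ifP => _ /=; rewrite ?lexx ?normr_ge0.
Qed.

Lemma taylor_norm1 n c g : integ g ->
  \int[mu]_(t in I01) `|taylor n c g t| <=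
  \sum_(i < n) `|c i| + \int[mu]_(t in I01) `|g t|.
Proof.
move=> gi; elim: n => [|n IHn]; first by rewrite big_ord0 add0r.
rewrite big_ord_recr/= -[leRHS]Rintegral_cst01; apply: le_Rintegral => //.
- by apply: integrable_norm01; exact: (@taylor_integrable _ n.+1).
- exact: integrable_cst01.
- move=> t It; rewrite -addrAC addrC (le_trans (ler_normD _ _))// lerD2l.
  by apply: le_trans IHn; apply: prim_bound => //; exact: taylor_integrable.
Qed.

Lemma taylor_bound n c g t : integ g -> I01 t ->
  `|taylor n.+1 c g t| <= \sum_(i < n.+1) `|c i| + \int[mu]_(t in I01) `|g t|.
Proof.
move=> gi It; rewrite big_ord_recr/= -addrAC addrC (le_trans (ler_normD _ _))// lerD2l.
apply: le_trans (taylor_norm1 _ _ gi).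
by apply: prim_bound => //; exact: taylor_integrable.
Qed.

Lemma taylor_norm2 n c g : sq g ->
  norm2 (taylor n c g) <= \sum_(i < n) `|c i| + norm2 g.
Proof.
move=> sg; case: n => [|n]; first by rewrite big_ord0 add0r.
have gi := sq_integrable sg; have b := taylor_bound _ _ gi.
set M := \sum_(i < n.+1) `|c i| + norm2 g.
have M0 : 0 <= M by rewrite addr_ge0 ?norm2_ge0// sumr_ge0.
rewrite -(@ler_pXn2r _ 2)// ?nnegrE ?norm2_ge0// norm2_sqr -[leRHS]Rintegral_cst01.
apply: le_Rintegral => //.
- by apply: sq_sqr_integrable; exact: taylor_sq.
- exact: integrable_cst01.
- move=> t It; rewrite -(real_normK (num_real (taylor _ _ _ _))).
  rewrite lerXn2r ?nnegrE//; apply: (le_trans (b n c t It)).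
  by rewrite lerD2l Rintegral_norm_le_norm2.
Qed.

Lemma prim_holder g s t : sq g -> I01 s -> I01 t ->
  (prim g t - prim g s) ^+ 2 <= `|t - s| * norm2 g ^+ 2.
Proof.
move=> sg; wlog st : s t / s <= t.
  move=> H Is It; have [|/ltW ts] := leP s t; first by move=> /H; exact.
  by rewrite -sqrrN opprB distrC; exact: H.
rewrite /= !in_itv/= => /andP[s0 s1] /andP[t0 t1].
have It : I01 t by rewrite /= in_itv/= t0.
have gi := integrable_itv0 (sq_integrable sg) It.
rewrite /prim (@Rintegral_itvB _ g)//.
have s01 : (`]s, t]%classic : set R) `<=` I01.
  by move=> x; rewrite /= !in_itv/= => /andP[sx xt]; apply/andP; split; lra.
rewrite -(setIidr s01) Rintegral_mkcondr.
have sind : sq (\1_(`]s, t]%classic)).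
  by apply: (@bounded_sq _ _ 1) => [|x _]; [exact: measurable_indic|
    rewrite indicE; case: (_ \in _); rewrite ?normr1 ?normr0].
have -> : \int[mu]_(x in I01) (g \_ `]s, t]%classic) x =
    \int[mu]_(x in I01) (\1_(`]s, t]%classic) x * g x).
  by apply: eq_Rintegral => x _; rewrite patchE indicE; case: ifP => _; rewrite ?mul1r ?mul0r.
apply: (le_trans (Rintegral_CS sind sg)); rewrite norm2_sqr ler_wpM2r ?Rintegral_sqr_ge0//.
have -> : \int[mu]_(x in I01) (\1_(`]s, t]%classic) x ^+ 2) =
    \int[mu]_(x in I01 `&` `]s, t]%classic) 1.
  rewrite Rintegral_mkcondr; apply: eq_Rintegral => x _.
  by rewrite patchE indicE; case: ifP => _; rewrite ?expr1n ?expr0n.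
rewrite setIidr//.
have -> : \int[mu]_(x in `]s, t]%classic) 1 = 1 * fine (mu `]s, t]%classic).
  exact: Rintegral_cst.
rewrite mul1r lebesgue_measure_itv/=.
by case: ifP => _ /=; rewrite ?ler_norm// normr_ge0.
Qed.

Lemma taylor_holder n c g s t : sq g -> I01 s -> I01 t ->
  (taylor n.+1 c g t - taylor n.+1 c g s) ^+ 2 <=
  `|t - s| * (\sum_(i < n) `|c i| + norm2 g) ^+ 2.
Proof.
move=> sg Is It; rewrite /= opprD addrACA subrr add0r.
apply: (le_trans (prim_holder (taylor_sq n c sg) Is It)).
rewrite ler_wpM2l// lerXn2r ?nnegrE ?norm2_ge0 ?taylor_norm2//.
by rewrite addr_ge0 ?norm2_ge0// sumr_ge0.
Qed.

(** ** Polynomials *)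

(** The primitive of a polynomial that vanishes at 0. *)
Definition antideriv (p : {poly R}) : {poly R} :=
  \poly_(i < (size p).+1) (p`_i.-1 / i%:R).

Lemma coef_antideriv (p : {poly R}) i : (antideriv p)`_i = p`_i.-1 / i%:R.
Proof.
rewrite coef_poly; case: ltnP => // hi.
by case: i hi => [|i] hi /=; rewrite ?invr0 ?mulr0// nth_default ?mul0r.
Qed.

Lemma deriv_antideriv p : deriv (antideriv p) = p.
Proof.
apply/polyP => i; rewrite coef_deriv coef_antideriv/= -[_ *+ _]mulr_natr divfK//.
Qed.

Lemma horner_antideriv0 p : (antideriv p).[0] = 0.
Proof. by rewrite horner_coef0 coef_antideriv invr0 mulr0. Qed.

Lemma size_antideriv p : (size (antideriv p) <= (size p).+1)%N.
Proof. exact: size_poly. Qed.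

Lemma prim_horner (p : {poly R}) t : 0 <= t -> prim (horner p) t = (antideriv p).[t].
Proof.
rewrite le_eqVlt => /predU1P[<-|t0].
  by rewrite /prim set_itv1 Rintegral_set1 horner_antideriv0.
have dp (q : {poly R}) x : is_derive x (1 : R) (horner q) (deriv q).[x] by exact: is_derive_poly.
have cp (q : {poly R}) : continuous (horner q) by exact: continuous_horner.
rewrite /prim /Rintegral (@continuous_FTC2 _ _ (horner (antideriv p)))//.
- by rewrite -EFinB/= horner_antideriv0 subr0.
- exact: continuous_subspaceT.
- split.
  + by move=> x _; case: (dp (antideriv p) x).
  + by apply: cvg_at_right_filter; exact: cp.
  + by apply: cvg_at_left_filter; exact: cp.
- move=> x _; rewrite derive1E; case: (dp (antideriv p) x) => _ ->.
  by rewrite deriv_antideriv.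
Qed.

(** The polynomial with Taylor coefficients [c], in the order used by [taylor]. *)
Fixpoint taylor_poly n c : {poly R} :=
  match n with 0%N => 0 | k.+1 => (c k)%:P + antideriv (taylor_poly k c) end.

Lemma size_taylor_poly n c : (size (taylor_poly n c) <= n)%N.
Proof.
elim: n => [|n IHn]; first by rewrite size_poly0.
rewrite (leq_trans (size_polyD _ _))// geq_max (leq_trans (size_polyC_leq1 _))//=.
exact: leq_trans (size_antideriv _) _.
Qed.

Lemma taylor_polyE n c t : I01 t -> taylor n c (cst 0) t = (taylor_poly n c).[t].
Proof.
elim: n t => [|n IHn] t It; first by rewrite horner0.
rewrite /= (@eq_prim _ _ (horner (taylor_poly n c)))//; last by move=> s /set_mem /IHn.
rewrite prim_horner; first by rewrite !hornerE.
by move: It; rewrite /= in_itv/= => /andP[].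
Qed.

Lemma taylor_poly_eq0 n c : taylor_poly n c = 0 -> forall i, (i < n)%N -> c i = 0.
Proof.
elim: n => // n IHn /= h i; rewrite ltnS leq_eqVlt => /predU1P[->|hi].
  have /(congr1 (horner^~ 0)) := h.
  by rewrite !hornerE horner_antideriv0 addr0.
apply: IHn hi; have /(congr1 (@deriv R)) := h.
by rewrite derivD derivC add0r deriv_antideriv deriv0.
Qed.

(** Unisolvence: a polynomial of degree less than [n] with [n] roots is null. *)
Lemma taylor_unisolvent n c (s : seq R) : uniq s -> (n <= size s)%N ->
  (forall t, t \in s -> I01 t /\ taylor n c (cst 0) t = 0) ->
  forall i, (i < n)%N -> c i = 0.
Proof.
move=> us ns h; apply: taylor_poly_eq0; apply: (roots_geq_poly_eq0 _ us).
  by apply/allP => t ts; have [It ht] := h _ ts; rewrite /root -taylor_polyE// ht.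
exact: leq_trans (size_taylor_poly _ _) ns.
Qed.

(** ** Representation of evaluations *)

Lemma coprimE f (s : R) : integ f -> I01 s ->
  coprim f s = \int[mu]_(t in I01) f t - prim f s.
Proof.
move=> fi; rewrite /= in_itv/= => /andP[s0 s1].
rewrite /prim (@Rintegral_itvB _ f)//.
rewrite /coprim -[LHS]Rintegral_itv_obnd_cbnd//.
by apply: integrableS fi => // t; rewrite /= !in_itv/= => /andP[st ->]; rewrite andbT; lra.
Qed.

Lemma coprim_sq f : integ f -> sq (coprim f).
Proof.
move=> fi; have sf : sq (fun s => \int[mu]_(t in I01) f t + (- 1) * prim f s).
  apply: within_continuous_sq => t; apply: cvgD; first exact: cvg_cst.
  by apply: cvgM; [exact: cvg_cst|exact: prim_continuous].
have e : {in I01, coprim f =1 (fun s => \int[mu]_(t in I01) f t + (- 1) * prim f s)}.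
  by move=> s /set_mem Is; rewrite coprimE// mulN1r.
case: sf => mf f2; split; first by apply: eq_measurable_fun mf => s Is; rewrite e.
by under eq_integral => s Is do rewrite e//.
Qed.

Lemma iter_coprim_sq n f : sq f -> sq (iter n (@coprim R) f).
Proof.
by move=> sf; elim: n => //= n IHn; apply: coprim_sq; exact: sq_integrable.
Qed.

(** The [n]-th power of [coprim] is the adjoint of the [n]-th power of [prim]. *)
Lemma Rintegral_taylor0 n f g : sq f -> sq g ->
  \int[mu]_(t in I01) (f t * taylor n (fun=> 0) g t) =
  \int[mu]_(t in I01) (iter n (@coprim R) f t * g t).
Proof.
elim: n f => // n IHn f sf sg; rewrite iterSr -IHn//; last exact/coprim_sq/sq_integrable.
rewrite -Rintegral_mul_prim; first by under eq_Rintegral do rewrite /= add0r.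
- exact: sq_integrable.
- by apply: taylor_integrable; exact: sq_integrable.
Qed.

(** The function whose [L^2] inner product with [g] is the value at [t] of the
    primitive of [g] of order [n.+1] with null integration constants. *)
Definition representer n (t : R) : R -> R := iter n (@coprim R) (\1_(`[0, t]%classic)).

Lemma indic_sq (A : set R) : measurable A -> sq (\1_A).
Proof.
move=> mA; apply: (@bounded_sq _ _ 1) => [|x _]; first exact: measurable_indic.
by rewrite indicE; case: (_ \in _); rewrite ?normr1 ?normr0.
Qed.

Lemma representer_sq n t : sq (representer n t).
Proof. by apply: iter_coprim_sq; exact: indic_sq. Qed.

Lemma representerE n g t : sq g -> I01 t ->
  taylor n.+1 (fun=> 0) g t = \int[mu]_(s in I01) (representer n t s * g s).
Proof.
move=> sg It; rewrite -Rintegral_taylor0//; last exact: indic_sq.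
rewrite /= add0r /prim.
have s01 : (`[0, t]%classic : set R) `<=` I01.
  move=> s; move: It; rewrite /= !in_itv/= => /andP[_ t1] /andP[-> st].
  exact: le_trans st t1.
rewrite -[in LHS](setIidr s01) Rintegral_mkcondr; apply: eq_Rintegral => x _.
by rewrite patchE indicE; case: ifP => _; rewrite ?mul1r ?mul0r.
Qed.

End taylor_bounds.

(** * Positive semidefinite forms *)

Section psd_forms.
Variables (R : realType) (V : lmodType R).
Implicit Types (a b : V -> V -> R) (u v w : V).

(** Positive semidefinite symmetric bilinear forms. Linearity in the second
    argument follows from symmetry. *)
Definition psd_form a :=
  [/\ forall k u v w, a (k *: u + v) w = k * a u w + a v w,
      forall u v, a u v = a v u & forall u, 0 <= a u u].

(** The seminorm of a form. *)
Definition fnorm a u : R := Num.sqrt (a u u).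

Lemma psd_formD a b : psd_form a -> psd_form b -> psd_form (fun u v => a u v + b u v).
Proof.
move=> [la sa pa] [lb sb pb]; split=> [k u v w|u v|u].
- by rewrite la lb; ring.
- by rewrite sa sb.
- exact: addr_ge0.
Qed.

Section theory.
Variable a : V -> V -> R.
Hypothesis ha : psd_form a.
Let la k u v w : a (k *: u + v) w = k * a u w + a v w. Proof. by case: ha. Qed.
Let sa u v : a u v = a v u. Proof. by case: ha. Qed.
Let pa u : 0 <= a u u. Proof. by case: ha. Qed.

Lemma psdDl u v w : a (u + v) w = a u w + a v w.
Proof. by rewrite -{1}(scale1r u) la mul1r. Qed.

Lemma psd0l w : a 0 w = 0.
Proof. by have := psdDl 0 0 w; rewrite addr0 => /(congr1 (fun x => x - a 0 w)); rewrite subrr addrK. Qed.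

Lemma psdZl k u w : a (k *: u) w = k * a u w.
Proof. by rewrite -{1}(addr0 (k *: u)) la psd0l addr0. Qed.

Lemma psdZr k u w : a u (k *: w) = k * a u w.
Proof. by rewrite sa psdZl sa. Qed.

Lemma psdDr u v w : a u (v + w) = a u v + a u w.
Proof. by rewrite sa psdDl !(sa u). Qed.

Lemma psdNl u w : a (- u) w = - a u w.
Proof. by rewrite -scaleN1r psdZl mulN1r. Qed.

Lemma psdNr u w : a u (- w) = - a u w.
Proof. by rewrite sa psdNl sa. Qed.

Lemma psd_suml (I : Type) (s : seq I) (e : I -> V) w :
  a (\sum_(i <- s) e i) w = \sum_(i <- s) a (e i) w.
Proof. by elim/big_rec2: _ => [|i x y _ <-]; [exact: psd0l|exact: psdDl]. Qed.

Lemma fnorm_ge0 u : 0 <= fnorm a u. Proof. exact: sqrtr_ge0. Qed.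

Lemma fnorm_sqr u : fnorm a u ^+ 2 = a u u. Proof. by rewrite sqr_sqrtr. Qed.

Lemma psd_CS u v : `|a u v| <= fnorm a u * fnorm a v.
Proof.
have : (a u v) ^+ 2 <= a u u * a v v.
  have h x y : 0 <= x ^+ 2 * a u u + x * y * 2 * a u v + y ^+ 2 * a v v.
    have := pa (x *: u + y *: v).
    by rewrite !(psdDl, psdDr, psdZl, psdZr) (sa v u); congr (0 <= _); ring.
  have hA : 0 <= a u u * (a u u * a v v - a u v ^+ 2) by have := h (- a u v) (a u u); nra.
  have hC : 0 <= a v v * (a u u * a v v - a u v ^+ 2) by have := h (a v v) (- a u v); nra.
  have := pa u; rewrite le_eqVlt => /predU1P[A0|A0]; last first.
    by rewrite -subr_ge0 -(pmulr_rge0 _ A0).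
  have := pa v; rewrite le_eqVlt => /predU1P[C0|C0]; last first.
    by rewrite -subr_ge0 -(pmulr_rge0 _ C0).
  by have := h 1 (- a u v); rewrite -A0 -C0; nra.
rewrite -!fnorm_sqr -exprMn -(real_normK (num_real (a u v))).
by rewrite ler_pXn2r// nnegrE ?mulr_ge0 ?fnorm_ge0.
Qed.

Lemma psd_normZ k u : fnorm a (k *: u) = `|k| * fnorm a u.
Proof. by rewrite /fnorm psdZl psdZr mulrA -expr2 sqrtrM ?sqr_ge0// sqrtr_sqr. Qed.

Lemma psd_normN u : fnorm a (- u) = fnorm a u.
Proof. by rewrite -scaleN1r psd_normZ normrN1 mul1r. Qed.

Lemma psd_norm0 : fnorm a 0 = 0.
Proof. by rewrite /fnorm psd0l sqrtr0. Qed.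

Lemma psd_normD u v : fnorm a (u + v) <= fnorm a u + fnorm a v.
Proof.
rewrite -(@ler_pXn2r _ 2)// ?nnegrE ?addr_ge0 ?fnorm_ge0//.
rewrite fnorm_sqr psdDl !psdDr (sa v u) sqrrD !fnorm_sqr.
by have := ler_normlW (psd_CS u v); lra.
Qed.

Lemma psd_norm_sum (I : Type) (s : seq I) (e : I -> V) :
  fnorm a (\sum_(i <- s) e i) <= \sum_(i <- s) fnorm a (e i).
Proof.
elim/big_rec2: _ => [|i x y _ h]; first by rewrite psd_norm0.
by rewrite (le_trans (psd_normD _ _))// lerD2l.
Qed.

(** On the span of a family that is independent modulo the kernel of [a], the
    coordinates are controlled by the seminorm: the Gram matrix is invertible. *)
Lemma gram_coord_bound k (e : 'I_k -> V) :
  (forall c : 'I_k -> R, fnorm a (\sum_i c i *: e i) = 0 -> forall i, c i = 0) ->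
  exists2 C : R, 0 <= C &
    forall c : 'I_k -> R, \sum_i `|c i| <= C * fnorm a (\sum_i c i *: e i).
Proof.
move=> he; pose G : 'M[R]_k := \matrix_(i, j) a (e i) (e j).
have GE (c : 'rV_k) j : (c *m G) 0 j = a (\sum_i c 0 i *: e i) (e j).
  rewrite psd_suml mxE; apply: eq_bigr => i _.
  by rewrite psdZl mxE.
have Gu : G \in unitmx.
  rewrite -row_free_unit -kermx_eq0; apply/eqP/row_matrixP => i; rewrite row0.
  set c := row i _; have cG : c *m G = 0 by rewrite -row_mul mulmx_ker row0.
  apply/rowP => j; rewrite [RHS]mxE; apply: (he (fun i => c 0 i)).
  apply/eqP; rewrite sqrtr_eq0 le_eqVlt; apply/orP; left; apply/eqP.
  have z l : a (\sum_i c 0 i *: e i) (e l) = 0 by rewrite -GE cG [LHS]mxE.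
  by rewrite psd_suml big1// => l _; rewrite psdZl sa z mulr0.
exists (\sum_i \sum_j fnorm a (e j) * `|invmx G j i|).
  by do 2 (apply: sumr_ge0 => ? _); rewrite mulr_ge0 ?fnorm_ge0.
move=> c; pose c' : 'rV_k := \row_i c i.
rewrite mulr_suml; apply: ler_sum => i _.
have -> : c i = ((c' *m G) *m invmx G) 0 i by rewrite mulmxK// mxE.
rewrite mxE (le_trans (ler_norm_sum _ _ _))// mulr_suml; apply: ler_sum => j _.
rewrite normrM mulrAC ler_wpM2r// GE mulrC.
have -> : \sum_i c i *: e i = \sum_i c' 0 i *: e i.
  by apply: eq_bigr => l _; rewrite mxE.
exact: psd_CS.
Qed.

End theory.
End psd_forms.

(** * The Sobolev space in Taylor coordinates *)

(** The positive order of the space is written [n.+1]. *)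

Section sobolev_elements.
Variables (R : realType) (n : nat).
Local Notation m := n.+1.
Local Notation H := (sobolev R m).
Local Notation mu := (@lebesgue_measure R).
Local Notation I01 := (`[0, 1]%classic : set R).
Local Notation integ g := (mu.-integrable I01 (EFin \o g)).
Local Notation sq := (@square_integrable01 R).
Implicit Types (u v w h : H) (f g : R -> R) (c : nat -> R).

Lemma within_continuous_ae_eq f g :
  {within I01, continuous f} -> {within I01, continuous g} ->
  {ae mu, forall t, I01 t -> f t = g t} -> forall t, I01 t -> f t = g t.
Proof.
move=> cf cg [N [mN N0 sN]] t It; apply: contrapT => fgt.
(* Otherwise the functions differ on a nondegenerate interval around [t] in the
   unit interval, which is not a null set. *)
have cd : {within I01, continuous (fun s => `|f s - g s|)}.
  by move=> s; apply: cvg_norm; apply: cvgB; [exact: cf|exact: cg].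
have d0 : 0 < `|f t - g t| by rewrite normr_gt0 subr_eq0; apply/eqP.
have /subspace_continuousP/(_ _ It) := cd.
move=> /cvgr_gt /(_ _ d0); rewrite near_withinE => -[e /= e0 he].
pose a := Num.max 0 (t - e); pose b := Num.min 1 (t + e).
move: (It); rewrite /= in_itv/= => /andP[t0 t1].
have ab : a < b by rewrite gt_max !lt_min; apply/andP; split; apply/andP; split; lra.
have sub : `]a, b[%classic `<=` N.
  move=> s /=; rewrite in_itv/= gt_max lt_min => /andP[/andP[s0 s1] /andP[s2 s3]].
  apply: sN => /= fgs.
  have Is : I01 s by rewrite /= in_itv/=; apply/andP; split; lra.
  have bs : `|t - s| < e by rewrite ltr_distlC; apply/andP; split; lra.
  have : 0 < `|f s - g s| by exact: (he s bs Is).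
  by rewrite (fgs Is) subrr normr0 ltxx.
have : (mu `]a, b[%classic <= mu N)%E by apply: le_measure; rewrite ?inE.
by rewrite N0 lebesgue_measure_itv/= lte_fin ab leNgt -EFinD lte_fin subr_gt0 ab.
Qed.

Lemma sobolev_eq0 u t : ~ I01 t -> u t = 0.
Proof. by move: (sobolev_valP u) => /set_mem[h _ _ _ _]; exact: h. Qed.

Lemma sobolev_continuous u : {within I01, continuous u}.
Proof. by move: (sobolev_valP u) => /set_mem[]. Qed.

Lemma sobolev_ext u v : (forall t, I01 t -> u t = v t) -> u = v.
Proof.
move=> uv; apply: val_inj; apply/funext => t.
by have [/uv //|nt] := pselect (I01 t); rewrite /= !sobolev_eq0.
Qed.

Lemma sobolevE k u v t : (k *: u + v) t = k * u t + v t. Proof. by []. Qed.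

Lemma sobolev0E t : (0 : H) t = 0. Proof. by []. Qed.

Lemma sobolevDE u v t : (u + v) t = u t + v t. Proof. by []. Qed.

Lemma sobolevZE k u t : (k *: u) t = k * u t. Proof. by []. Qed.

Lemma sobolevBE u v t : (u - v) t = u t - v t. Proof. by []. Qed.

Lemma sobolev_sumE (I : Type) (s : seq I) (e : I -> H) t :
  (\sum_(i <- s) e i) t = \sum_(i <- s) e i t.
Proof. by elim/big_rec2: _ => // i x y _ <-. Qed.

Lemma sobolev_sq u : sq u.
Proof. by apply: within_continuous_sq; exact: sobolev_continuous. Qed.

Lemma ae_square_integrable f g : measurable_fun I01 f -> sq g ->
  {ae mu, forall t, I01 t -> f t = g t} -> sq f.
Proof.
move=> mf [mg g2] fg; split=> //.
rewrite (_ : (\int[mu]_(t in I01) ((f t) ^+ 2)%:E = \int[mu]_(t in I01) ((g t) ^+ 2)%:E)%E)//.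
apply: ae_eq_integral => //.
- by apply/measurable_EFinP; exact: measurable_funX.
- by apply/measurable_EFinP; exact: measurable_funX.
- by apply: (@filterS _ _ (ae_filter_ringOfSetsType mu) _ _ _ fg) => t e It; rewrite /= e.
Qed.

Local Notation wd := (@weak_derivative R m).

Lemma weak_derivativeP j u : (0 < j <= m)%N ->
  is_weak_derivative j u (weak_derivative j u).
Proof.
move=> jm; apply: (@xgetPex _ (cst 0) [set g | is_weak_derivative j u g]).
by move: (sobolev_valP u) => /set_mem[_ _ _ w _]; exact: w.
Qed.

Lemma weak_derivative_sq u : sq (wd u).
Proof.
move: (sobolev_valP u) => /set_mem[_ _ _ w [g wg sg]].
have wu := @weak_derivativeP m u (leqnn _).
apply: ae_square_integrable sg _; last exact: is_weak_derivative_unique wu wg.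
by have [[mw _ _] _] := wu; apply: measurable_fun_itv_cc mw.
Qed.

(** The Taylor formula at 0 for the elements of the Sobolev space. It holds
    everywhere, since both sides are continuous. *)
Lemma sobolev_taylorP u :
  exists c, forall t, I01 t -> u t = taylor m c (wd u) t.
Proof.
have sw := weak_derivative_sq u; have iw := sq_integrable sw.
have wu := @weak_derivativeP m u (leqnn _).
have [c hc] := @weak_taylor _ m u (wd u) (sq_integrable (sobolev_sq u)) iw (proj2 wu).
exists c; apply: within_continuous_ae_eq hc; first exact: sobolev_continuous.
exact: taylor_continuous.
Qed.

Lemma taylor_sobolev_fun c g : sq g ->
  (fun t => if t \in I01 then taylor m c g t else 0) \in sobolev_fun m.
Proof.
move=> sg; have gi := sq_integrable sg; set h := fun t => _.
have hE : {in I01, h =1 taylor m c g} by move=> t It; rewrite /h It.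
have ch : {within I01, continuous h}.
  apply: (@subspace_eq_continuous _ _ _ (taylor m c g)).
    by move=> t It; exact/esym/hE.
  exact: taylor_continuous.
apply/mem_set; split.
- by move=> t nt; rewrite /h; case: ifP => // /set_mem /nt.
- exact: ch.
- exact: within_continuous_sq.
- move=> j /andP[_ jm]; exists (taylor (m - j) c g).
  by apply: taylor_is_weak_derivative => //; rewrite subnKC.
- exists g => //; apply: (@taylor_is_weak_derivative _ m 0 c) => //.
  by rewrite addn0.
Qed.

(** The element with Taylor coefficients [c] and [m]-th derivative [g]. *)
Definition sobolev_taylor c g (sg : sq g) : H := Sobolev (taylor_sobolev_fun c sg).

Lemma sobolev_taylorE c g (sg : sq g) t : I01 t -> sobolev_taylor c sg t = taylor m c g t.
Proof. by move=> It; rewrite /= mem_set. Qed.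

Lemma weak_derivative_taylor j u c g : (0 < j <= m)%N -> sq g ->
  (forall t, I01 t -> u t = taylor m c g t) ->
  {ae mu, forall t, I01 t -> weak_derivative j u t = taylor (m - j) c g t}.
Proof.
move=> jm sg uE; apply: is_weak_derivative_unique (weak_derivativeP u jm) _.
apply: taylor_is_weak_derivative; first exact: sq_integrable.
by move=> t /set_mem It; rewrite subnKC ?uE//; case/andP: jm.
Qed.

Lemma wd_taylor u c g : sq g -> (forall t, I01 t -> u t = taylor m c g t) ->
  {ae mu, forall t, I01 t -> wd u t = g t}.
Proof.
by move=> sg uE; have := @weak_derivative_taylor m u c g (leqnn _) sg uE; rewrite subnn.
Qed.

Lemma wd_lin k u v :
  {ae mu, forall t, I01 t -> wd (k *: u + v) t = k * wd u t + wd v t}.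
Proof.
have [c hc] := sobolev_taylorP u; have [d hd] := sobolev_taylorP v.
have su := weak_derivative_sq u; have sv := weak_derivative_sq v.
apply: (@wd_taylor _ (fun i => k * c i + d i)).
  exact: (square_integrable01_lin k su sv).
by move=> t It; rewrite taylor_lin ?sobolevE ?hc ?hd//; exact: sq_integrable.
Qed.

(** The energy form and the [L^2] form. *)
Definition energy_form u v : R := \int[mu]_(t in I01) (wd u t * wd v t).

Definition l2_form u v : R := \int[mu]_(t in I01) (u t * v t).

Lemma l2_form_psd : psd_form l2_form.
Proof.
split=> [k u v w|u v|u].
- have i1 := sq_mul_integrable (sobolev_sq u) (sobolev_sq w).
  have i2 := sq_mul_integrable (sobolev_sq v) (sobolev_sq w).
  rewrite /l2_form -RintegralZl// -RintegralD//; last exact: integrable01Z.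
  by apply: eq_Rintegral => t _; rewrite sobolevE; ring.
- by apply: eq_Rintegral => t _; rewrite mulrC.
- by apply: Rintegral_ge0 => t _; rewrite -expr2 sqr_ge0.
Qed.

Lemma energy_form_psd : psd_form energy_form.
Proof.
split=> [k u v w|u v|u].
- have su := weak_derivative_sq u; have sv := weak_derivative_sq v.
  have sw := weak_derivative_sq w; have sl := weak_derivative_sq (k *: u + v).
  have i1 := sq_mul_integrable su sw; have i2 := sq_mul_integrable sv sw.
  rewrite /energy_form -RintegralZl// -RintegralD//; last exact: integrable01Z.
  apply: Rintegral_ae.
  + by case/integrableP: (sq_mul_integrable sl sw) => /measurable_EFinP.
  + by case/integrableP: (integrable01D (integrable01Z k i1) i2) => /measurable_EFinP.
  + apply: (@filterS _ _ (ae_filter_ringOfSetsType mu) _ _ _ (wd_lin k u v)).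
    by move=> t e It; rewrite e//; ring.
- by apply: eq_Rintegral => t _; rewrite mulrC.
- by apply: Rintegral_ge0 => t _; rewrite -expr2 sqr_ge0.
Qed.

Lemma energyE u : energy u = energy_form u u.
Proof. by apply: eq_Rintegral => t _; rewrite expr2. Qed.

Lemma fnorm_energy u : fnorm energy_form u = norm2 (wd u).
Proof. by rewrite /fnorm /norm2 -energyE. Qed.

Lemma fnorm_l2 u : fnorm l2_form u = norm2 u.
Proof. by rewrite /fnorm /norm2; congr Num.sqrt; apply: eq_Rintegral => t _; rewrite expr2. Qed.

Lemma ae_norm2 f g : sq f -> sq g -> {ae mu, forall t, I01 t -> f t = g t} ->
  norm2 f = norm2 g.
Proof.
move=> sf sg fg; congr Num.sqrt; apply: Rintegral_ae.
- by apply: measurable_funX; case: sf.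
- by apply: measurable_funX; case: sg.
- by apply: (@filterS _ _ (ae_filter_ringOfSetsType mu) _ _ _ fg) => t e It; rewrite e.
Qed.

Lemma energy_form_taylor u v c d f g : sq f -> sq g ->
  (forall t, I01 t -> u t = taylor m c f t) ->
  (forall t, I01 t -> v t = taylor m d g t) ->
  energy_form u v = \int[mu]_(t in I01) (f t * g t).
Proof.
move=> sf sg uE vE; apply: Rintegral_ae.
- by case/integrableP: (sq_mul_integrable (weak_derivative_sq u) (weak_derivative_sq v)) => /measurable_EFinP.
- by case/integrableP: (sq_mul_integrable sf sg) => /measurable_EFinP.
- apply: (@filterS _ _ (ae_filter_ringOfSetsType mu) _ _ _
    (@filterI _ _ (ae_filter_ringOfSetsType mu) _ _ (wd_taylor sf uE) (wd_taylor sg vE))).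
  by move=> t [e1 e2] It; rewrite e1// e2.
Qed.

(** A monomial basis of the polynomials of degree less than [m]; the degree of
    [monomial i] is [m - 1 - i]. *)
Definition monomial (i : 'I_m) : H :=
  sobolev_taylor (fun j => (j == i)%:R) (cst_sq (0 : R)).

(** The remainder in the Taylor formula at 0. *)
Definition remainder u : H := sobolev_taylor (fun=> 0) (weak_derivative_sq u).

Lemma eq_taylor k c d g t : (forall i, (i < k)%N -> c i = d i) -> I01 t ->
  taylor k c g t = taylor k d g t.
Proof.
elim: k t => // k IHk t cd It; rewrite /= cd//; congr (_ + _).
by apply: eq_prim => // s /set_mem; apply: IHk => i ik; apply: cd; exact: ltnW.
Qed.

Lemma taylor_sum k (I : Type) (s : seq I) (a : I -> R) (e : I -> nat -> R) t : I01 t ->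
  \sum_(i <- s) a i * taylor k (e i) (cst 0) t =
  taylor k (fun j => \sum_(i <- s) a i * e i j) (cst 0) t.
Proof.
move=> It; elim: s => [|i s IHs].
  have := @taylor_lin _ k (-1) (fun=> 0) (fun=> 0) (cst 0) (cst 0) t
    (integrable_cst01 0) (integrable_cst01 0) It.
  rewrite !mulN1r !addNr big_nil => h; apply: (etrans (esym h)).
  by congr taylor; apply/funext => j; rewrite ?big_nil /=; ring.
rewrite big_cons IHs -taylor_lin//; [|exact: integrable_cst01..].
congr taylor; apply/funext => j /=; first by rewrite big_cons.
by rewrite mulr0 addr0.
Qed.

Lemma monomial_sumE c t : I01 t ->
  (\sum_(i < m) c i *: monomial i) t = taylor m c (cst 0) t.
Proof.
move=> It; rewrite sobolev_sumE.
under eq_bigr do rewrite sobolevZE sobolev_taylorE//.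
rewrite taylor_sum//; apply: eq_taylor => // j jm.
rewrite (bigD1 (Ordinal jm))//= eqxx mulr1 big1 ?addr0// => i ij.
by rewrite (_ : (j == i) = false) ?mulr0//; apply: contra_neqF ij => /eqP ji; apply/val_inj.
Qed.

Lemma monomial_sum_eq0 (c : 'I_m -> R) : \sum_(i < m) c i *: monomial i = 0 ->
  forall i, c i = 0.
Proof.
move=> c0 i; pose d j := if insub j is Some k then c k else 0.
have dE (k : 'I_m) : d k = c k by rewrite /d valK.
rewrite -dE; pose s : seq R := [seq j%:R / m%:R | j <- iota 0 m].
apply: (@taylor_unisolvent R m d s) => //.
- rewrite map_inj_uniq ?iota_uniq// => x y /(mulIf _) h.
  by apply/eqP; rewrite -(eqr_nat R); apply/eqP/h; rewrite invr_eq0 pnatr_eq0.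
- by rewrite size_map size_iota.
- move=> t /mapP[j]; rewrite mem_iota add0n => /andP[_ jm] ->.
  have It : I01 (j%:R / m%:R).
    by rewrite /= in_itv/= divr_ge0//= ler_pdivrMr ?ltr0Sn// mul1r ler_nat ltnW.
  split => //; rewrite -monomial_sumE//.
  by under eq_bigr do rewrite dE; rewrite c0.
Qed.

Lemma taylor_coef_decomp u c : (forall t, I01 t -> u t = taylor m c (wd u) t) ->
  u = \sum_(i < m) c i *: monomial i + remainder u.
Proof.
move=> uE; apply: sobolev_ext => t It; rewrite uE// sobolevDE monomial_sumE//.
rewrite sobolev_taylorE//; have := @taylor_lin _ m 1 c (fun=> 0) (cst 0) (wd u) t
    (integrable_cst01 0) (sq_integrable (weak_derivative_sq u)) It.
rewrite mul1r => <-; congr taylor; apply/funext => j /=; ring.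
Qed.

End sobolev_elements.

Arguments sobolev_taylor {R n} c {g} sg.
Arguments sobolev_taylorE {R n} c {g} sg {t} _.

(** ** Comparison of norms *)

Section norm_comparisons.
Variables (R : realType) (n : nat).
Local Notation m := n.+1.
Local Notation H := (sobolev R m).
Local Notation mu := (@lebesgue_measure R).
Local Notation I01 := (`[0, 1]%classic : set R).
Local Notation sq := (@square_integrable01 R).
Local Notation wd := (@weak_derivative R m).
Local Notation monomial := (@monomial R n).
Implicit Types (u v w h : H) (f g : R -> R) (c : nat -> R).

Lemma taylorZ k (a : R) c f t : mu.-integrable I01 (EFin \o f) -> I01 t ->
  taylor k (fun i => a * c i) (fun s => a * f s) t = a * taylor k c f t.
Proof.
move=> fi; elim: k t => //= k IHk t It.
rewrite (@eq_prim _ _ (fun s => a * taylor k c f s))//; last first.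
  by move=> s /set_mem; exact: IHk.
rewrite /prim RintegralZl//; first by ring.
by apply: integrable_itv0 => //; exact: taylor_integrable.
Qed.

Lemma norm2_eq0 g : sq g -> norm2 g = 0 -> {ae mu, forall t, I01 t -> g t = 0}.
Proof.
move=> sg /eqP; rewrite sqrtr_eq0 => g0.
have /integrableP[mg2 _] := sq_sqr_integrable sg.
have := @ae_eq_integral_abs _ _ _ mu I01 (measurable_itv _) (EFin \o (fun t => g t ^+ 2)) mg2.
move=> -[+ _]; have fi := @integrable_fin_num _ _ _ mu I01 (measurable_itv _) _ (sq_sqr_integrable sg).
pose G t := g t ^+ 2.
have -> : (\int[mu]_(x in I01) `|(EFin \o G) x| = 0)%E.
  under eq_integral do rewrite /= ger0_norm ?sqr_ge0//.
  rewrite -[LHS]fineK//; congr EFin; apply/eqP; rewrite eq_le g0.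
  exact: Rintegral_sqr_ge0.
move=> /(_ erefl); apply: (@filterS _ _ (ae_filter_ringOfSetsType mu)) => t h It.
by have [/eqP] := h It; rewrite sqrf_eq0 => /eqP.
Qed.

Lemma fnorm_l2_eq0 u : fnorm (@l2_form R n) u = 0 -> u = 0.
Proof.
rewrite fnorm_l2 => /(norm2_eq0 (sobolev_sq u)) h; apply: sobolev_ext.
apply: within_continuous_ae_eq h; first exact: sobolev_continuous.
by apply: continuous_subspaceT => t; exact: cvg_cst.
Qed.

Lemma remainderE u t : I01 t -> remainder u t = taylor m (fun=> 0) (wd u) t.
Proof. by move=> It; rewrite sobolev_taylorE. Qed.

Lemma sum_norm0 k : \sum_(i < k) `|(fun=> 0 : R) (nat_of_ord i)| = 0.
Proof. by rewrite big1// => i _; rewrite normr0. Qed.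

Lemma eq_norm2 f g : {in I01, f =1 g} -> norm2 f = norm2 g.
Proof.
by move=> fg; congr Num.sqrt; apply: eq_Rintegral => t It; rewrite fg.
Qed.

Lemma norm2_remainder u : norm2 (remainder u) <= norm2 (wd u).
Proof.
rewrite (@eq_norm2 _ (taylor m (fun=> 0) (wd u))); last first.
  by move=> t /set_mem; exact: remainderE.
apply: le_trans (taylor_norm2 _ _ (weak_derivative_sq u)) _.
by rewrite sum_norm0 add0r.
Qed.

(** The polynomial part of [u] is [u] minus its remainder, and the monomials are
    linearly independent in [L^2]. *)
Lemma taylor_coef_l2_bound : exists2 C : R, 0 <= C & forall u c,
  (forall t, I01 t -> u t = taylor m c (wd u) t) ->
  \sum_(i < m) `|c i| <= C * (norm2 u + norm2 (wd u)).
Proof.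
have [|C C0 hC] := gram_coord_bound (l2_form_psd R n) (e := monomial).
  by move=> c /fnorm_l2_eq0; exact: monomial_sum_eq0.
exists C => // u c uE; apply: le_trans (hC (fun i => c i)) _.
rewrite ler_wpM2l//.
have -> : \sum_(i < m) c i *: monomial i = u - remainder u.
  by rewrite {1}(taylor_coef_decomp uE) addrK.
apply: le_trans (psd_normD (l2_form_psd R n) _ _) _.
by rewrite (psd_normN (l2_form_psd R n)) !fnorm_l2 lerD2l norm2_remainder.
Qed.

Lemma ler_sum_ord_widen (c : nat -> R) k l : (k <= l)%N ->
  \sum_(i < k) `|c i| <= \sum_(i < l) `|c i|.
Proof.
move=> kl; rewrite -(subnKC kl) big_split_ord/= lerDl.
exact: sumr_ge0.
Qed.

Lemma sobolev_norm_le : exists2 C : R, 0 <= C & forall u c g, sq g ->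
  (forall t, I01 t -> u t = taylor m c g t) ->
  sobolev_norm u <= C * (\sum_(i < m) `|c i| + norm2 g).
Proof.
exists m.+1%:R => // u c g sg uE; set K := _ + _.
have K0 : 0 <= K by rewrite addr_ge0 ?norm2_ge0// sumr_ge0.
have bound k : (k <= m)%N -> norm2 (taylor k c g) ^+ 2 <= K ^+ 2.
  move=> km; rewrite lerXn2r ?nnegrE ?norm2_ge0//.
  apply: le_trans (taylor_norm2 _ _ sg) _.
  by rewrite lerD2r; exact: ler_sum_ord_widen.
rewrite -(@ler_pXn2r _ 2)// ?nnegrE ?sqrtr_ge0 ?mulr_ge0// sqr_sqrtr; last first.
  by rewrite addr_ge0 ?sumr_ge0// => *; exact: Rintegral_sqr_ge0.
apply: (@le_trans _ _ (K ^+ 2 + \sum_(1 <= j < m.+1) K ^+ 2)).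
  apply: lerD.
    rewrite -norm2_sqr (@eq_norm2 _ (taylor m c g)) ?bound//.
    by move=> t /set_mem; exact: uE.
  rewrite !big_nat; apply: ler_sum => j jm.
  have sj : sq (taylor (m - j) c g) by exact: taylor_sq.
  have [[mw _ _] _] := weak_derivativeP u jm.
  have ae := weak_derivative_taylor jm sg uE.
  have sw := ae_square_integrable (measurable_fun_itv_cc mw) sj ae.
  by rewrite -norm2_sqr (ae_norm2 sw sj ae) bound// leq_subr.
rewrite sumr_const_nat subSS subn0 -mulrS -[(K ^+ 2) *+ _]mulr_natl exprMn ler_wpM2r ?sqr_ge0//.
by rewrite -natrX ler_nat leq_pmull.
Qed.

Section boundary.
Variable B : {linear H -> 'rV[R]_m}.
Hypothesis hB : boundary_conditions_operator B.

(** Continuity of [B] for the Sobolev norm, in Taylor coordinates. *)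
Lemma boundary_bound : exists2 C : R, 0 <= C & forall u c g, sq g ->
  (forall t, I01 t -> u t = taylor m c g t) ->
  forall j, `|B u 0 j| <= C * (\sum_(i < m) `|c i| + norm2 g).
Proof.
have [C C0 hC] := sobolev_norm_le.
have [cB _ _] := hB.
have hj (j : 'I_m) : exists D, 0 <= D /\ forall u c g, sq g ->
    (forall t, I01 t -> u t = taylor m c g t) ->
    `|B u 0 j| <= D * (\sum_(i < m) `|c i| + norm2 g).
  have oV : open [set v : 'rV[R]_m | `|v 0 j| < 1].
    have /continuousP := @coord_continuous R^o 1 m 0 j.
    move=> /(_ [set x : R | `|x| < 1]); apply.
    have := @ball_open R R^o 0 1; congr open.
    by apply/seteqP; split => x; rewrite /ball/= sub0r normrN.
  have := cB _ oV; move=> /(_ 0) []; first by rewrite /= linear0 mxE normr0 ltr01.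
  move=> e e0 he.
  exists (2 / e * C); split; first by rewrite mulr_ge0// divr_ge0// ltW.
  move=> u c g sg uE; set K := _ + _.
  have K0 : 0 <= K by rewrite addr_ge0 ?norm2_ge0// sumr_ge0.
  apply/ler_addgt0Pl => d d0.
  (* The multiple [k *: u] has Sobolev norm less than [e]. The term [d * e] is there
     because [C * K] may vanish. *)
  pose k := e / (2 * (C * K) + d * e).
  have den0 : 0 < 2 * (C * K) + d * e by rewrite ltr_wpDl ?mulr_ge0 ?mulr_gt0.
  have k0 : 0 < k by rewrite divr_gt0.
  have sgk : sq (fun t => k * g t).
    have := square_integrable01_lin k sg (cst_sq 0).
    congr sq; apply/funext => t.
    by rewrite [LHS](_ : _ = k * g t + 0)// addr0.
  have kuE t : I01 t -> (k *: u) t = taylor m (fun i => k * c i) (fun t => k * g t) t.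
    move=> It; rewrite sobolevZE uE//.
    by rewrite taylorZ//; exact: sq_integrable.
  have nk : norm2 (fun t => k * g t) = k * norm2 g.
    rewrite /norm2; under eq_Rintegral do rewrite exprMn.
    rewrite RintegralZl//; last exact: sq_sqr_integrable.
    by rewrite sqrtrM ?sqr_ge0// sqrtr_sqr gtr0_norm.
  have := hC _ _ _ sgk kuE; rewrite nk.
  under eq_bigr do rewrite normrM gtr0_norm//.
  rewrite -mulr_sumr -mulrDr -/K => hN.
  have := he (k *: u); rewrite subr0 => /(_ _)/wrap[].
    apply: le_lt_trans hN _; rewrite /k mulrCA mulrAC ltr_pdivrMr// ltr_pM2l//.
    have : 0 < d * e by rewrite mulr_gt0.
    have : 0 <= C * K by rewrite mulr_ge0.
    by lra.
  rewrite /= linearZ mxE normrM gtr0_norm// -ltr_pdivlMl// mulr1 /k invf_div => h.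
  apply: le_trans (ltW h) _; rewrite mulrDl mulfK ?gt_eqF// addrC lerD2l.
  by rewrite le_eqVlt; apply/orP; left; apply/eqP; ring.
have [D hD] := choice hj; exists (\sum_j D j).
  by apply: sumr_ge0 => j _; case: (hD j).
move=> u c g sg uE j; have [D0 h] := hD j; apply: le_trans (h u c g sg uE) _.
rewrite ler_wpM2r ?addr_ge0 ?norm2_ge0 ?sumr_ge0//.
by rewrite (bigD1 j)//= lerDl sumr_ge0// => i _; case: (hD i).
Qed.

(** The boundary part of the Hilbert inner product. *)
Definition boundary_form u v : R := \sum_(j < m) B u 0 j * B v 0 j.

Lemma boundary_form_psd : psd_form boundary_form.
Proof.
split=> [k u v w|u v|u].
- rewrite /boundary_form mulr_sumr -big_split/=; apply: eq_bigr => j _.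
  by rewrite linearP !mxE; ring.
- by apply: eq_bigr => j _; rewrite mulrC.
- by apply: sumr_ge0 => j _; rewrite -expr2 sqr_ge0.
Qed.

Lemma sobolev_inner_psd : psd_form (sobolev_inner B).
Proof. exact: (psd_formD (energy_form_psd R n) boundary_form_psd). Qed.

Lemma fnorm_boundary_le u (M : R) : 0 <= M -> (forall j, `|B u 0 j| <= M) ->
  fnorm boundary_form u <= m%:R * M.
Proof.
move=> M0 hM; rewrite -(@ler_pXn2r _ 2)// ?nnegrE ?sqrtr_ge0 ?mulr_ge0//.
rewrite (fnorm_sqr boundary_form_psd).
apply: (@le_trans _ _ (\sum_(j < m) M ^+ 2)).
  apply: ler_sum => j _; rewrite -expr2 -(real_normK (num_real (B u 0 j))).
  by rewrite lerXn2r ?nnegrE.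
rewrite sumr_const card_ord -[(M ^+ 2) *+ _]mulr_natl exprMn ler_wpM2r ?sqr_ge0//.
by rewrite -natrX ler_nat leq_pmull.
Qed.

Lemma fnorm_energy_le_hilbert u : norm2 (wd u) <= hilbert_norm B u.
Proof.
rewrite -fnorm_energy; apply: ler_wsqrtr; rewrite lerDl.
by have [_ _ p] := boundary_form_psd; exact: p.
Qed.

Lemma fnorm_boundary_le_hilbert u : fnorm boundary_form u <= hilbert_norm B u.
Proof.
apply: ler_wsqrtr; rewrite lerDr.
by have [_ _ p] := energy_form_psd R n; exact: p.
Qed.

Lemma hilbert_norm_le_add u :
  hilbert_norm B u <= norm2 (wd u) + fnorm boundary_form u.
Proof.
rewrite -fnorm_energy -(@ler_pXn2r _ 2)// ?nnegrE ?addr_ge0 ?sqrtr_ge0//.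
rewrite (fnorm_sqr sobolev_inner_psd) sqrrD.
rewrite (fnorm_sqr (energy_form_psd R n)) (fnorm_sqr boundary_form_psd).
rewrite /sobolev_inner addrAC lerDl.
by rewrite mulrn_wge0// mulr_ge0 ?sqrtr_ge0.
Qed.

Lemma hilbert_norm_le : exists2 C : R, 0 <= C & forall u c,
  (forall t, I01 t -> u t = taylor m c (wd u) t) ->
  hilbert_norm B u <= C * (\sum_(i < m) `|c i| + norm2 (wd u)).
Proof.
have [C C0 hC] := boundary_bound.
exists (1 + m%:R * C); first by rewrite addr_ge0// mulr_ge0.
move=> u c uE; apply: le_trans (hilbert_norm_le_add u) _.
have K0 : 0 <= \sum_(i < m) `|c i| + norm2 (wd u).
  by rewrite addr_ge0 ?norm2_ge0// sumr_ge0.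
rewrite mulrDl mul1r lerD//; first by rewrite lerDr sumr_ge0.
rewrite -mulrA; apply: fnorm_boundary_le; first exact: mulr_ge0.
by move=> j; apply: hC => //; exact: weak_derivative_sq.
Qed.

(** As [taylor_coef_l2_bound], with the boundary form in place of the [L^2] form:
    only the null polynomial satisfies the boundary conditions. *)
Lemma taylor_coef_hilbert_bound : exists2 C : R, 0 <= C & forall u c,
  (forall t, I01 t -> u t = taylor m c (wd u) t) ->
  \sum_(i < m) `|c i| <= C * hilbert_norm B u.
Proof.
have [C C0 hC] := boundary_bound; have [_ _ kerB] := hB.
have [|D D0 hD] := gram_coord_bound boundary_form_psd (e := monomial).
  move=> c /eqP; rewrite sqrtr_eq0 => hc; apply: monomial_sum_eq0.
  set p := \sum_(i < m) _ in hc *.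
  have Bp : B p = 0.
    apply/rowP => j; rewrite mxE; apply/eqP; rewrite -sqrf_eq0 eq_le sqr_ge0 andbT.
    apply: le_trans hc; rewrite /boundary_form (bigD1 j)//= -expr2 lerDl.
    by apply: sumr_ge0 => i _; rewrite -expr2 sqr_ge0.
  suff : ([set h | B h = 0] `&` @polynomial_functions R m) p by rewrite kerB.
  split => //; pose d j := if insub j is Some k then c k else 0.
  exists (taylor_poly m d); first exact: size_taylor_poly.
  move=> t It; rewrite -taylor_polyE// -monomial_sumE//.
  by congr (sobolev_val _ t); apply: eq_bigr => i _; rewrite /d valK.
exists (D * (1 + m%:R * C)); first by rewrite mulr_ge0// addr_ge0// mulr_ge0.
move=> u c uE; apply: le_trans (hD (fun i => c i)) _.
rewrite -mulrA ler_wpM2l//.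
have -> : \sum_(i < m) c i *: monomial i = u - remainder u.
  by rewrite {1}(taylor_coef_decomp uE) addrK.
apply: le_trans (psd_normD boundary_form_psd _ _) _.
rewrite (psd_normN boundary_form_psd) mulrDl mul1r lerD ?fnorm_boundary_le_hilbert//.
rewrite -mulrA.
apply: (@le_trans _ _ (m%:R * (C * norm2 (wd u)))); last first.
  by rewrite !ler_wpM2l// fnorm_energy_le_hilbert.
apply: fnorm_boundary_le; first by rewrite mulr_ge0// norm2_ge0.
move=> j; apply: le_trans (hC _ _ _ (weak_derivative_sq u) (@remainderE u) j) _.
by rewrite sum_norm0 add0r.
Qed.

Lemma evaluation_bound : exists2 C : R, 0 <= C & forall u t, I01 t ->
  `|u t| <= C * hilbert_norm B u.
Proof.
have [C C0 hC] := taylor_coef_hilbert_bound.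
exists (C + 1); first exact: addr_ge0.
move=> u t It; have [c uE] := sobolev_taylorP u.
have su := weak_derivative_sq u.
rewrite uE//; apply: le_trans (taylor_bound _ _ (sq_integrable su) It) _.
rewrite mulrDl mul1r lerD ?hC//.
exact: le_trans (Rintegral_norm_le_norm2 su) (fnorm_energy_le_hilbert u).
Qed.

End boundary.
End norm_comparisons.

(** * Smoothing splines *)

Section splines.
Variables (R : realType) (n : nat).
Local Notation m := n.+1.
Local Notation H := (sobolev R m).
Local Notation mu := (@lebesgue_measure R).
Local Notation I01 := (`[0, 1]%classic : set R).
Local Notation sq := (@square_integrable01 R).
Local Notation wd := (@weak_derivative R m).
Local Notation monomial := (@monomial R n).
Local Notation E2 := (@energy_form R n).
Implicit Types (u v w h x : H) (f g : R -> R) (c : nat -> R).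

(** The Riesz representer of [v |-> remainder v t] for the energy form. *)
Definition kernel_fun (t : R) : H := sobolev_taylor (fun=> 0) (representer_sq n t).

Lemma energy_kernel t v : I01 t -> E2 (kernel_fun t) v = remainder v t.
Proof.
move=> It; have [c vE] := sobolev_taylorP v; have sv := weak_derivative_sq v.
rewrite (energy_form_taylor (representer_sq n t) sv
  (fun s Is => sobolev_taylorE (fun=> 0) (representer_sq n t) Is) vE).
by rewrite remainderE// representerE.
Qed.

Lemma energy_monomial i v : E2 (monomial i) v = 0.
Proof.
have [c vE] := sobolev_taylorP v; have sv := weak_derivative_sq v.
rewrite (energy_form_taylor (cst_sq (0 : R)) sv
  (fun s Is => sobolev_taylorE (fun j => (j == i)%:R) (cst_sq (0 : R)) Is) vE).
under eq_Rintegral do rewrite mul0r.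
by rewrite Rintegral_cst01.
Qed.

Lemma energy_eq0 w c : E2 w w = 0 -> (forall t, I01 t -> w t = taylor m c (wd w) t) ->
  forall t, I01 t -> w t = taylor m c (cst 0) t.
Proof.
move=> Ew wE t It; have sw := weak_derivative_sq w; rewrite wE//.
apply: ae_taylor => //; [exact: sq_integrable|exact: integrable_cst01|].
by apply: norm2_eq0 => //; rewrite -fnorm_energy /fnorm Ew sqrtr0.
Qed.

Section grid.
Variables (tau : seq R) (lambda : R).
Hypothesis tau_uniq : uniq tau.
Hypothesis tau_size : (m <= size tau)%N.
Hypothesis tau01 : forall t, t \in tau -> I01 t.
Hypothesis lambda_gt0 : 0 < lambda.
Local Notation N := (size tau).
Local Notation pt l := (nth 0 tau l).

(** The empirical inner product on the grid. *)
Definition emp u v : R := N%:R^-1 * \sum_(t <- tau) u t * v t.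

Lemma emp_psd : psd_form emp.
Proof.
split=> [k u v w|u v|u].
- rewrite /emp [k * _]mulrCA -mulrDr; congr (_ * _); rewrite mulr_sumr -big_split.
  by apply: eq_bigr => t _; rewrite sobolevE mulrDl -mulrA.
- by congr (_ * _); apply: eq_bigr => t _; rewrite mulrC.
- rewrite mulr_ge0 ?invr_ge0//; apply: sumr_ge0 => t _; rewrite -expr2 sqr_ge0//.
Qed.

Let N_gt0 : 0 < (N%:R : R). Proof. by rewrite ltr0n (leq_trans _ tau_size). Qed.

Lemma pt01 (l : 'I_N) : I01 (pt l).
Proof. by apply: tau01; exact: mem_nth. Qed.

Lemma sum_tau (F : R -> R) : \sum_(t <- tau) F t = \sum_(l < N) F (pt l).
Proof. by rewrite (big_nth 0) big_mkord. Qed.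

(** The natural spline with kernel coefficients [d] and polynomial part [c]. *)
Definition spline_of (d : 'I_N -> R) (c : 'I_m -> R) : H :=
  \sum_l d l *: kernel_fun (pt l) + \sum_i c i *: monomial i.

(** The natural side conditions make [spline_of d c] a representer of a
    combination of evaluations. *)
Lemma energy_spline_of (d : 'I_N -> R) (c : 'I_m -> R) v :
  (forall i, \sum_l d l * monomial i (pt l) = 0) ->
  E2 (spline_of d c) v = \sum_l d l * v (pt l).
Proof.
move=> hd; have hE := energy_form_psd R n; have [b vE] := sobolev_taylorP v.
rewrite (psdDl hE) !(psd_suml hE) [X in _ + X]big1 ?addr0; last first.
  by move=> i _; rewrite (psdZl hE) energy_monomial mulr0.
transitivity (\sum_(l < N) d l * (v (pt l) - (\sum_(i < m) b i *: monomial i) (pt l))).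
  apply: eq_bigr => l _; rewrite (psdZl hE) energy_kernel; last exact: pt01.
  by rewrite {2}(taylor_coef_decomp vE) sobolevDE addrC addKr.
under eq_bigr do rewrite mulrBr.
rewrite sumrB [X in _ - X](_ : _ = 0) ?subr0//.
under eq_bigr do rewrite sobolev_sumE mulr_sumr.
rewrite exchange_big big1 // => i _.
under eq_bigr do rewrite sobolevZE mulrCA.
by rewrite -mulr_sumr hd mulr0.
Qed.

Lemma polynomial_grid_eq0 (c : 'I_m -> R) :
  (forall l : 'I_N, (\sum_i c i *: monomial i) (pt l) = 0) -> forall i, c i = 0.
Proof.
move=> h i; pose d j := if insub j is Some k then c k else 0.
have dE (k : 'I_m) : d k = c k by rewrite /d valK.
rewrite -dE; apply: (@taylor_unisolvent R m d tau) => // t tt; split; first exact: tau01.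
have lt : (index t tau < N)%N by rewrite index_mem.
rewrite -monomial_sumE; last exact: tau01.
under eq_bigr do rewrite dE.
by have := h (Ordinal lt); rewrite [pt _]nth_index.
Qed.

(** The matrix of the linear system that characterizes the coefficients of the
    smoothing spline. A row vector lists the kernel coefficients [d], then the
    polynomial coefficients [c]. In its product with the matrix, the first entries
    are the values of [spline_of d c] at the grid points plus [N * lambda * d], the
    last ones express the side conditions on [d]. *)
Definition grid_matrix : 'M[R]_(N + m) :=
  block_mx (\matrix_(l, j) (kernel_fun (pt l) (pt j)) + (N%:R * lambda)%:M)
    (\matrix_(l, i) monomial i (pt l))
    (\matrix_(i, l) monomial i (pt l)) 0.

Lemma grid_matrixE (z : 'rV[R]_(N + m)) :
  let d l := z 0 (lshift m l) in let c i := z 0 (rshift N i) in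
  (forall j, (z *m grid_matrix) 0 (lshift m j) =
    spline_of d c (pt j) + N%:R * lambda * d j) /\
  (forall i, (z *m grid_matrix) 0 (rshift N i) = \sum_l d l * monomial i (pt l)).
Proof.
move=> d c; rewrite -[z in z *m _]hsubmxK /grid_matrix mul_row_block mulmx0 addr0.
split=> [j|i].
- rewrite row_mxEl mulmxDr mul_mx_scalar !mxE /spline_of sobolevDE !sobolev_sumE.
  rewrite -!addrA; congr (_ + _).
    by apply: eq_bigr => l _; rewrite !mxE sobolevZE.
  rewrite addrC; congr (_ + _).
  by apply: eq_bigr => i _; rewrite !mxE sobolevZE.
- by rewrite row_mxEr !mxE; apply: eq_bigr => l _; rewrite !mxE.
Qed.

(** The spline of a vector in the kernel takes the values [- N * lambda * d] on the
    grid, so its energy is nonpositive and [d] is null; what remains is a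
    polynomial of degree less than [m] that vanishes at [m] or more points. *)
Lemma grid_matrix_unit : grid_matrix \in unitmx.
Proof.
rewrite -row_free_unit -kermx_eq0; apply/eqP/row_matrixP => r; rewrite row0.
set z := row r _; have zM : z *m grid_matrix = 0 by rewrite -row_mul mulmx_ker row0.
have [] := grid_matrixE z; rewrite zM.
pose d l := z 0 (lshift m l); pose c i := z 0 (rshift N i) => h1 h2.
rewrite -/d -/c in h1 h2.
have hd i : \sum_l d l * monomial i (pt l) = 0 by rewrite -h2 mxE.
have hs (j : 'I_N) : spline_of d c (pt j) = - (N%:R * lambda * d j).
  by apply/eqP; rewrite -addr_eq0 -h1 mxE.
have d0 l : d l = 0.
  have := energy_spline_of c (spline_of d c) hd.
  have : 0 <= E2 (spline_of d c) (spline_of d c).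
    by have [_ _ p] := energy_form_psd R n; exact: p.
  move=> + e; rewrite e; under eq_bigr do rewrite hs mulrN mulrCA.
  rewrite sumrN oppr_ge0 -mulr_sumr pmulr_rle0 ?mulr_gt0// => s0.
  have /eqP := le_anti (introT andP (conj s0 (sumr_ge0 _ (fun i _ => sqr_ge0 (d i))))).
  rewrite psumr_eq0; last by move=> i _; exact: sqr_ge0.
  by move=> /allP/(_ l (mem_index_enum _)); rewrite /= -expr2 sqrf_eq0 => /eqP.
have c0 : forall i, c i = 0.
  apply: polynomial_grid_eq0 => l; have := hs l; rewrite d0 mulr0 oppr0 => e.
  by rewrite -[RHS]e /spline_of [X in X + _]big1 ?add0r// => j _; rewrite d0 scale0r.
by apply/rowP => k; rewrite [RHS]mxE; case: (split_ordP k) => j ->;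
  [exact: d0|exact: c0].
Qed.

(** The solution of the system with the values of [x] as data. *)
Definition spline_coef x : 'rV[R]_(N + m) :=
  row_mx (\row_j x (pt j)) 0 *m invmx grid_matrix.

Definition spline x : H :=
  spline_of (fun l => spline_coef x 0 (lshift m l)) (fun i => spline_coef x 0 (rshift N i)).

(** The Euler equation of the penalized least squares problem. *)
Lemma spline_euler x v : emp (x - spline x) v = lambda * E2 (spline x) v.
Proof.
have [h1 h2] := grid_matrixE (spline_coef x).
rewrite mulmxKV ?grid_matrix_unit// in h1 h2.
rewrite energy_spline_of; last by move=> i; rewrite -h2 row_mxEr mxE.
rewrite /emp sum_tau !mulr_sumr; apply: eq_bigr => l _.
have := h1 l; rewrite row_mxEl mxE sobolevBE -/(spline x) => ->.
by rewrite addrAC subrr add0r -!mulrA mulKf ?gt_eqF.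
Qed.

Lemma spline_criterionE x h :
  spline_criterion lambda tau x h = emp (x - h) (x - h) + lambda * E2 h h.
Proof.
rewrite /spline_criterion energyE /emp; congr (_ * _ + _).
Qed.

(** The cross terms vanish by the Euler equation. *)
Lemma spline_criterion_add x w :
  spline_criterion lambda tau x (spline x + w) =
  spline_criterion lambda tau x (spline x) + (emp w w + lambda * E2 w w).
Proof.
have hE := energy_form_psd R n; have he := emp_psd.
have := spline_euler x w; rewrite !spline_criterionE.
have -> : x - (spline x + w) = (x - spline x) - w by rewrite (opprD (spline x) w) addrA.
move: (spline x) (x - spline x) => s y eu.
rewrite !(psdDl he, psdDr he, psdNl he, psdNr he, psdDl hE, psdDr hE).
have [_ sE _] := hE; have [_ se _] := he.
rewrite (sE w s) (se w y) eu.
move: (emp y y) (emp w w) (E2 s s) (E2 s w) (E2 w w) => a b c d e; ring.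
Qed.

(** Uniqueness of the minimizer: by [spline_criterion_add], the difference [w] of two
    minimizers has null energy, so it is a polynomial of degree less than [m], and
    it vanishes on the grid. *)
Lemma smoothing_splineE x : smoothing_spline lambda tau x = spline x.
Proof.
have hE := energy_form_psd R n; have he := emp_psd.
have Ege0 w : 0 <= E2 w w by have [_ _ p] := hE; exact: p.
have ege0 w : 0 <= emp w w by have [_ _ p] := he; exact: p.
set s := smoothing_spline _ _ _.
have smin h : spline_criterion lambda tau x s <= spline_criterion lambda tau x h.
  move: h; apply: (@xgetPex _ 0 [set h | forall g : H,
    spline_criterion lambda tau x h <= spline_criterion lambda tau x g]).
  exists (spline x) => h; rewrite -(subrKC (spline x) h).
  rewrite spline_criterion_add lerDl addr_ge0// mulr_ge0// ltW//.
pose w := s - spline x.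
have := smin (spline x); rewrite -{1}(subrKC (spline x) s) spline_criterion_add.
rewrite gerDl -/w => h0.
have lE : 0 <= lambda * E2 w w by rewrite mulr_ge0// ltW.
have w0 : emp w w = 0.
  by apply/eqP; rewrite eq_le ege0 andbT; apply: le_trans h0; rewrite lerDl.
have Ew : E2 w w = 0.
  apply/eqP; rewrite eq_le Ege0 andbT -(pmulr_rle0 _ lambda_gt0).
  by apply: le_trans h0; rewrite lerDr.
have [c wE] := sobolev_taylorP w.
have wE0 := energy_eq0 Ew wE.
have wl t : t \in tau -> w t = 0.
  move=> tt; move: w0 => /eqP; rewrite mulf_eq0 invr_eq0 gt_eqF//=.
  rewrite psumr_eq0; last by move=> i _; rewrite -expr2 sqr_ge0.
  by move=> /allP/(_ t tt); rewrite /= -expr2 sqrf_eq0 => /eqP.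
apply/eqP; rewrite -subr_eq0 -/w; apply/eqP; apply: sobolev_ext => t It.
rewrite wE0// (@eq_taylor _ m c (fun=> 0)) ?sobolev0E//.
  have := @taylorZ R m 0 (fun=> 0) (cst 0) t (integrable_cst01 0) It.
  by rewrite !mul0r.
apply: (@taylor_unisolvent R m c tau) => // r rt; split; first exact: tau01.
by rewrite -wE0 ?wl//; exact: tau01.
Qed.

Lemma smoothing_spline_min x h :
  spline_criterion lambda tau x (smoothing_spline lambda tau x) <=
  spline_criterion lambda tau x h.
Proof.
rewrite smoothing_splineE -(subrKC (spline x) h) spline_criterion_add lerDl.
have [_ _ pE] := energy_form_psd R n; have [_ _ pe] := emp_psd.
by rewrite addr_ge0// mulr_ge0// ltW.
Qed.

(** The smoothing spline depends linearly on the values of [x] on the grid. *)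
Lemma smoothing_spline_sum : exists s : 'I_N -> H, forall x,
  smoothing_spline lambda tau x = \sum_(j < N) x (pt j) *: s j.
Proof.
pose A := invmx grid_matrix.
exists (fun j : 'I_N => spline_of (fun l => A (lshift m j) (lshift m l))
  (fun i => A (lshift m j) (rshift N i))) => x.
have cE k : spline_coef x 0 k = \sum_(j < N) x (pt j) * A (lshift m j) k.
  rewrite mxE big_split_ord/= [X in _ + X]big1 ?addr0; last first.
    by move=> i _; rewrite row_mxEr mxE mul0r.
  by apply: eq_bigr => j _; rewrite row_mxEl mxE.
rewrite smoothing_splineE /spline /spline_of.
under [RHS]eq_bigr do rewrite scalerDr !scaler_sumr.
rewrite big_split/=; congr (_ + _).
  rewrite exchange_big/=; apply: eq_bigr => l _.
  by rewrite cE scaler_suml; apply: eq_bigr => j _; rewrite scalerA.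
rewrite exchange_big/=; apply: eq_bigr => l _.
by rewrite cE scaler_suml; apply: eq_bigr => j _; rewrite scalerA.
Qed.

End grid.
End splines.

(** * Approximation by simple functions *)

Section simple_approximation.
Variables (R : realType) (d : measure_display) (T : measurableType d).
Implicit Types (f g : T -> R).
Import HBNNSimple.

Lemma linear_simple (C : set (T -> R)) (s : {nnsfun T >-> R}) :
  (forall A, measurable A -> C \1_A) ->
  (forall (k : R) f g, C f -> C g -> C (k *: f + g)) -> C s.
Proof.
move=> CI CL.
have C0 : C (fun=> 0).
  have := CL (-1) _ _ (CI _ measurableT) (CI _ measurableT).
  by congr C; apply/funext => x; rewrite [LHS](_ : _ = -1 * \1_setT x + \1_setT x)//; ring.
have -> : s = (fun x => \sum_(y <- finmap.enum_fset (fset_set (range s))) y * \1_(s @^-1` [set y]) x) :> (T -> R).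
  by apply/funext => x; rewrite fimfunE fsbig_finite.
elim: (finmap.enum_fset (fset_set (range s))) => [|y r IHr].
  by rewrite (_ : (fun _ => _) = fun=> 0)//; apply/funext => x; rewrite big_nil.
rewrite (_ : (fun _ => _) = y *: \1_(s @^-1` [set y]) +
  (fun x => \sum_(y <- r) y * \1_(s @^-1` [set y]) x)).
  by apply: CL IHr; apply: CI; exact: measurable_funPTI.
by apply/funext => x; rewrite big_cons.
Qed.

(** A linear class of functions containing the indicators contains, for every
    measurable [f], a sequence dominated by [f] that converges to [f]. *)
Lemma dominated_simple_approximation (C : set (T -> R)) f :
  (forall A, measurable A -> C \1_A) ->
  (forall (k : R) f g, C f -> C g -> C (k *: f + g)) ->
  measurable_fun setT f ->
  exists q : nat -> T -> R, [/\ forall k, C (q k),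
    forall k x, `|q k x| <= `|f x| & forall x, q k x @[k --> \oo] --> f x].
Proof.
move=> CI CL mf.
have approx (g : T -> R) : measurable_fun setT g -> (forall x, 0 <= g x) ->
    exists q : nat -> T -> R, [/\ forall k, C (q k),
      forall k x, 0 <= q k x <= g x & forall x, q k x @[k --> \oo] --> g x].
  move=> mg g0; have mg' : measurable_fun setT (EFin \o g) by exact/measurable_EFinP.
  have [q [ndq cq]] := approximation measurableT mg' (fun x _ => g0 x).
  have cq' x : q k x @[k --> \oo] --> g x by have := cq x I; exact: fine_cvg.
  exists (fun k => q k); split=> [k|k x|x]; [exact: linear_simple| |exact: cq'].
  apply/andP; split; first exact: fun_ge0.
  have nd : nondecreasing_seq (fun k => q k x) by move=> i j ij; exact/lefP/ndq.
  have := nondecreasing_cvgn_le nd (cvgP _ (cq' x)) k.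
  by rewrite (cvg_lim _ (cq' x)).
(* The positive and negative parts of [f] are approximated separately. *)
have [p [Cp p0 cp]] : exists q : nat -> T -> R, [/\ forall k, C (q k),
    forall k x, 0 <= q k x <= Num.max (f x) 0 &
    forall x, q k x @[k --> \oo] --> Num.max (f x) 0].
  apply: (approx (fun x => Num.max (f x) 0)) => [|x]; last by rewrite le_max lexx orbT.
  by apply: measurable_maxr => //; exact: measurable_cst.
have [r [Cr r0 cr]] : exists q : nat -> T -> R, [/\ forall k, C (q k),
    forall k x, 0 <= q k x <= Num.max (- f x) 0 &
    forall x, q k x @[k --> \oo] --> Num.max (- f x) 0].
  apply: (approx (fun x => Num.max (- f x) 0)) => [|x]; last by rewrite le_max lexx orbT.
  apply: measurable_maxr; last exact: measurable_cst.
  exact: measurableT_comp.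
exists (fun k x => -1 * r k x + p k x); split=> [k|k x|x].
- exact: CL.
- have := p0 k x; have := r0 k x; rewrite !maxEle oppr_le0.
  case: (leP (f x) 0) => [fx|fx]; last first.
    rewrite (ltW fx) => /andP[h1 h2] /andP[h3 h4].
    by rewrite (gtr0_norm fx) ler_norml; apply/andP; split; lra.
  rewrite (ler0_norm fx); case: ifP => _ /andP[h1 h2] /andP[h3 h4];
    by rewrite ler_norml; apply/andP; split; lra.
- have -> : f x = -1 * Num.max (- f x) 0 + Num.max (f x) 0.
    rewrite !maxEle oppr_le0; case: (leP (f x) 0) => fx; last by rewrite (ltW fx); ring.
    by case: ifP => f0; [have -> : f x = 0 by [apply/eqP; rewrite eq_le fx]; ring|ring].
  by apply: cvgD => //; apply: cvgM => //; exact: cvg_cst.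
Qed.

End simple_approximation.

Section l2_induction.
Variable R : realType.
Local Notation mu := (@lebesgue_measure R).
Local Notation I01 := (`[0, 1]%classic : set R).
Local Notation sq := (@square_integrable01 R).
Implicit Types f g : R -> R.

Lemma norm2_dominated (q : nat -> R -> R) f g :
  (forall k, sq (q k)) -> sq f -> sq g ->
  (forall t, I01 t -> q k t @[k --> \oo] --> f t) ->
  (forall k t, I01 t -> `|f t - q k t| <= g t) ->
  norm2 (fun t => f t - q k t) @[k --> \oo] --> (0 : R).
Proof.
move=> sq_ sf sg cq hg.
suff h : \int[mu]_(t in I01) (f t - q k t) ^+ 2 @[k --> \oo] --> (0 : R).
  have := cvg_comp _ _ h (@sqrt_continuous R 0).
  by rewrite sqrtr0; exact.
rewrite -[X in _ --> X](Rintegral_cst01 (0 : R)).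
apply: (@Rintegral_dominated R _ (fun=> 0) (fun t => g t ^+ 2)).
- by move=> k; apply: measurable_funX; apply: measurable_funB; [case: sf|case: (sq_ k)].
- move=> t It; have -> : (0 : R) = (f t - f t) ^+ 2 by rewrite subrr expr0n.
  rewrite expr2; under eq_fun do rewrite expr2.
  by apply: cvgM; apply: cvgB; [exact: cvg_cst|exact: cq|exact: cvg_cst|exact: cq].
- exact: sq_sqr_integrable.
- move=> k t It; rewrite normrX lerXn2r ?nnegrE ?hg//.
  exact: le_trans (hg k t It).
Qed.

(** A linear class of square integrable functions, closed in [L^2], that contains
    the indicators of intervals contains every square integrable function. *)
Lemma square_integrable01_ind (C : set (R -> R)) :
  (forall a b : R, 0 <= a -> b <= 1 -> C \1_(`]a, b[%classic)) ->
  (forall (k : R) f g, C f -> C g -> C (k *: f + g)) ->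
  (forall (q : nat -> R -> R) f, (forall k, sq (q k)) -> sq f -> (forall k, C (q k)) ->
    norm2 (fun t => f t - q k t) @[k --> \oo] --> (0 : R) -> C f) ->
  forall f, sq f -> C f.
Proof.
move=> CI CL Ccl.
have Cae f g : sq f -> sq g -> {ae mu, forall t, I01 t -> f t = g t} -> C f -> C g.
  move=> sf sg fg Cf; apply: (Ccl (fun=> f)) => //.
  rewrite (_ : norm2 _ = 0); first exact: cvg_cst.
  rewrite (@ae_norm2 _ _ (fun=> 0)); last 3 first.
  - have := square_integrable01_lin (-1) sf sg; congr sq; apply/funext => t.
    by rewrite [LHS](_ : _ = -1 * f t + g t)//; ring.
  - exact: cst_sq.
  - by apply: (@filterS _ _ (ae_filter_ringOfSetsType mu) _ _ _ fg) => t e It; rewrite e// subrr.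
  by rewrite /norm2; under eq_Rintegral do rewrite expr0n; rewrite Rintegral_cst01 sqrtr0.
have ae1 (c : R) : {ae mu, forall t, t <> c}.
  exists [set c]; split => //; first exact: lebesgue_measure_set1.
  by move=> t /= /contrapT.
have Cray (x : R) : C \1_(`]x, +oo[%classic).
  apply: (@Cae (\1_(`](Num.max 0 x), 1[%classic))).
  - exact: indic_sq.
  - exact: indic_sq.
  - have h01 := @filterI _ _ (ae_filter_ringOfSetsType mu) _ _ (ae1 0) (ae1 1).
    apply: (@filterS _ _ (ae_filter_ringOfSetsType mu) _ _ _ h01) => t [/eqP t0 /eqP t1].
    rewrite /= in_itv/= => /andP[t0' t1']; rewrite !indicE !mem_setE/= !in_itv/= andbT.
    by rewrite gt_max !lt_neqAle t0' t1' t1 eq_sym t0 /= andbT.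
  - by apply: CI => //; rewrite le_max lexx.
have CT : C \1_setT.
  apply: (@Cae (\1_(`]0, 1[%classic))); [exact: indic_sq|exact: indic_sq| |exact: CI].
  have h01 := @filterI _ _ (ae_filter_ringOfSetsType mu) _ _ (ae1 0) (ae1 1).
  apply: (@filterS _ _ (ae_filter_ringOfSetsType mu) _ _ _ h01) => t [/eqP t0 /eqP t1].
  rewrite /= in_itv/= => /andP[t0' t1']; rewrite !indicE !mem_setE/= !in_itv/= in_setT.
  by rewrite !lt_neqAle t0' t1' t1 eq_sym t0.
pose rT := measurableTypeR R.
(* Borel sets are generated by the half-lines unbounded to the right, which are stable under
   intersection, and the sets with indicator in [C] form a Dynkin system. *)
have Cm (A : set rT) : measurable A -> C \1_A.
  move=> mA; apply: (@dynkin_induction _ rT (@RGenOInfty.G R) (fun A => C \1_A)) => //.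
  - exact: RGenOInfty.measurableE.
  - move=> _ _ [x ->] [y ->]; exists (Num.max x y); apply/seteqP; split=> t /=.
      by rewrite !in_itv/= !andbT gt_max => -[-> ->].
    by rewrite !in_itv/= !andbT gt_max => /andP[].
  - by move=> _ [x ->]; exact: Cray.
  - move=> S _ CS; have := CL (-1) _ _ CS CT; congr C; apply/funext => t.
    rewrite [LHS](_ : _ = -1 * \1_S t + \1_setT t)// !indicE in_setT in_setC.
    by case: (t \in S); rewrite /=; ring.
  - move=> F mF tF CF.
    have mU k : measurable (\big[setU/set0]_(i < k) F i : set rT) by exact: bigsetU_measurable.
    apply: (Ccl (fun k => \1_(\big[setU/set0]_(i < k) F i))).
    + by move=> k; apply: indic_sq; exact: mU.
    + by apply: indic_sq; exact: bigcupT_measurable.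
    + elim=> [|k IHk].
        rewrite big_ord0; have := CL (-1) _ _ CT CT; congr C; apply/funext => t.
        by rewrite [LHS](_ : _ = -1 * \1_setT t + \1_setT t)// indic0/=; ring.
      rewrite big_ord_recr/=; have := CL 1 _ _ IHk (CF k); congr C; apply/funext => t.
      rewrite [LHS](_ : _ = 1 * \1_(\big[setU/set0]_(i < k) F i) t + \1_(F k) t)//.
      have tF' : trivIset xpredT F by exact: sub_trivIset tF.
      have /seteqP[dj _] := trivIset_bigsetUI tF' (m := k) isT (leqnn k).
      rewrite !indicE in_setU; case: (boolP (t \in \big[setU/set0]_(i < k) F i)) => tU;
        case: (boolP (t \in F k)) => tk /=; try by ring.
      by exfalso; apply: (dj t); split; exact: set_mem.
    + apply: (@norm2_dominated _ _ (cst 1)).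
      * by move=> k; apply: indic_sq; exact: mU.
      * by apply: indic_sq; exact: bigcupT_measurable.
      * exact: cst_sq.
      * move=> t _; rewrite [in X in _ --> X]indicE.
        have [[j _ Fj]|nF] := pselect ((\bigcup_k F k) t).
          rewrite mem_set; last by exists j.
          apply: cvg_near_cst; near=> k; rewrite indicE mem_set// -bigcup_mkord.
          by exists j => //=; near: k; exact: nbhs_infty_gt.
        rewrite memNset//; apply: cvg_near_cst; apply: nearW => k.
        rewrite indicE memNset// -bigcup_mkord => -[j _ Fj]; apply: nF.
        by exists j.
      * move=> k t _; rewrite !indicE.
        by do 2 case: (_ \in _); rewrite /= ?subrr ?subr0 ?sub0r ?normrN ?normr1 ?normr0.
  - exact: (eq_ind _ (fun M : set (set rT) => M A) mA _ (RGenOInfty.measurableE R)).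
move=> f sf; have [mf _] := sf.
have mf' : measurable_fun (setT : set rT) (f \_ I01).
  exact: (iffLR (measurable_restrictT _ (measurable_itv _)) mf).
have [q [Cq bq cq]] := @dominated_simple_approximation R _ rT
  [set g | sq g /\ C g] (f \_ I01) (fun A mA => conj (indic_sq mA) (Cm A mA))
  (fun k f g Cf Cg => conj (square_integrable01_lin k (proj1 Cf) (proj1 Cg))
    (CL k f g (proj2 Cf) (proj2 Cg))) mf'.
have fE t : I01 t -> (f \_ I01) t = f t by move=> It; rewrite patchE mem_set.
apply: (Ccl q) => //; [by move=> k; case: (Cq k)|by move=> k; case: (Cq k)|].
apply: (@norm2_dominated q f (fun t => 2 * `|f t|)) => //.
- by move=> k; case: (Cq k).
- have := square_integrable01_lin 2 (norm_sq sf) (cst_sq 0); congr sq; apply/funext => t.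
  by rewrite [LHS](_ : _ = 2 * `|f t| + 0)// addr0.
- by move=> t It; have := cq t; rewrite fE.
- move=> k t It; rewrite (le_trans (ler_normB _ _))//.
  by have := bq k t; rewrite fE//; lra.
Unshelve. all: by end_near. Qed.

End l2_induction.

(** * Quasi-uniform grids *)

Section grids.
Variable R : realType.
Local Notation mu := (@lebesgue_measure R).
Local Notation I01 := (`[0, 1]%classic : set R).
Local Notation integ g := (mu.-integrable I01 (EFin \o g)).
Implicit Types (tau : seq R) (f : R -> R).

Lemma mesh_max_ge0 tau : 0 <= mesh_max tau.
Proof. exact: bigmax_ge_id. Qed.

(** The grid is [mesh_max]-dense in the unit interval. *)
Lemma mesh_max_cover tau t : (0 < size tau)%N -> I01 t ->
  exists2 s, s \in tau & `|t - s| <= mesh_max tau.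
Proof.
move=> tau0; rewrite /= in_itv/= => /andP[t0 t1].
(* The first grid point beyond [t], if any. *)
pose j := find (fun s => t < s) tau.
have jn : (j < (size tau).+1)%N by rewrite ltnS find_size.
have gap := le_bigmax 0 (fun l : 'I_(size tau).+1 => nth 1 tau l - nth 0 (0 :: tau) l)
  (Ordinal jn).
have tj : t <= nth 1 tau j.
  have [hj|hj] := ltnP j (size tau); last by rewrite nth_default.
  by apply: ltW; apply: (@nth_find _ 1 (fun s => t < s)); rewrite has_find.
case E : j => [|k].
  exists (nth 1 tau 0); first exact: mem_nth.
  apply: le_trans gap; rewrite /= E/= subr0; rewrite E in tj.
  by rewrite distrC ger0_norm ?subr_ge0// gerBl.
have kj : (k < j)%N by rewrite E.
have kn : (k < size tau)%N by rewrite (leq_trans kj)// find_size.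
exists (nth 0 tau k); first exact: mem_nth.
have := before_find 0 kj => /negbT; rewrite -leNgt => kt.
apply: le_trans gap; rewrite /= E/= ger0_norm ?subr_ge0//.
by rewrite lerD2r -E.
Qed.

Lemma nth_gap_gt0 tau l : sorted <=%R tau -> uniq tau -> (l.+1 < size tau)%N ->
  nth 0 tau l < nth 0 tau l.+1.
Proof.
move=> st ut ls; have slt : sorted <%R tau by rewrite lt_sorted_uniq_le ut.
by apply: (sorted_ltn_nth lt_trans 0 slt) => //; rewrite inE// (ltn_trans _ ls).
Qed.

Lemma mesh_min_gt0 tau : sorted <=%R tau -> uniq tau -> 0 < mesh_min tau.
Proof.
move=> st ut; apply: lt_bigmin => // l _.
by rewrite subr_gt0 nth_gap_gt0//; case: l => l /=; case: (size tau).
Qed.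

(** The gaps between consecutive points have total length at most 1. *)
Lemma mesh_min_le tau : sampling_grid tau -> (0 < size tau)%N ->
  (size tau).-1%:R * mesh_min tau <= 1.
Proof.
move=> [st t01] tau0.
apply: (@le_trans _ _ (\sum_(0 <= l < (size tau).-1) (nth 0 tau l.+1 - nth 0 tau l))).
  rewrite big_mkord mulr_natl -[X in _ *+ X](card_ord (size tau).-1) -sumr_const.
  by apply: ler_sum => l _; exact: bigmin_le.
rewrite telescope_sumr//.
have n1 : nth 0 tau (size tau).-1 \in `[0, 1]%R by apply: t01; rewrite mem_nth// prednK.
have n0 : nth 0 tau 0 \in `[0, 1]%R by apply: t01; rewrite mem_nth.
by move: n1 n0; rewrite !in_itv/= => /andP[? ?] /andP[? ?]; lra.
Qed.

Lemma size_mesh_max tau (K : R) : sampling_grid tau -> uniq tau ->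
  (1 < size tau)%N -> mesh_max tau / mesh_min tau <= K ->
  (size tau)%:R * mesh_max tau <= 2 * K.
Proof.
move=> gt ut s1; have [st _] := gt; have mn0 := mesh_min_gt0 st ut.
rewrite ler_pdivrMr// => hK.
have := mesh_min_le gt (ltnW s1); have mx := mesh_max_ge0 tau.
have K0 : 0 <= K.
  by rewrite -(pmulr_lge0 _ mn0) (le_trans mx).
have : (size tau)%:R <= 2 * (size tau).-1%:R :> R.
  rewrite -natrM ler_nat; case: (size tau) s1 => [|[|k]]//= _.
  by rewrite mul2n -addnn addSn ltnS leq_addl.
move=> hN h1; apply: le_trans (ler_wpM2r mx hN) _.
apply: (@le_trans _ _ (2 * (size tau).-1%:R * (K * mesh_min tau))).
  by rewrite ler_wpM2l// mulr_ge0.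
by rewrite mulrACA -[leRHS]mulr1 ler_wpM2l// mulr_ge0.
Qed.

(** A quadrature bound for functions that are Hölder continuous of exponent 1/2:
    the intervals of length [2 * delta] around the points of the grid cover the
    unit interval. *)
Lemma Rintegral_covering tau (delta L : R) f : 0 <= delta ->
  (forall t, I01 t -> exists2 s, s \in tau & `|t - s| <= delta) ->
  (forall s, s \in tau -> I01 s) ->
  square_integrable01 f ->
  (forall s t, I01 s -> I01 t -> (f t - f s) ^+ 2 <= `|t - s| * L) ->
  0 <= L ->
  norm2 f ^+ 2 <=
  2 * delta * \sum_(s <- tau) (2 * f s ^+ 2 + 2 * (delta * L)).
Proof.
move=> d0 cov tau01 sf hol L0; rewrite norm2_sqr.
pose J s : set R := `[s - delta, s + delta]%classic.
pose K s := 2 * f s ^+ 2 + 2 * (delta * L).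
have K0 s : 0 <= K s by apply: addr_ge0; apply: mulr_ge0 => //; [exact: sqr_ge0|exact: mulr_ge0].
(* The square of [f] is at most [K s] on the interval around [s]. *)
have [iF leF] : integ (fun t => \sum_(s <- tau) K s * \1_(J s) t) /\
   \int[mu]_(t in I01) (\sum_(s <- tau) K s * \1_(J s) t) <=
   2 * delta * \sum_(s <- tau) K s.
  elim: tau {cov tau01} => [|s r [IH1 IH2]].
    have e : (fun t : R => \sum_(s <- [::]) K s * \1_(J s) t) = cst 0.
      by apply/funext => t; rewrite big_nil.
    by rewrite e big_nil mulr0; split; [exact: integrable_cst01|rewrite Rintegral_cst01].
  have e : (fun t : R => \sum_(s <- s :: r) K s * \1_(J s) t) =
      (fun t => K s * \1_(J s) t + \sum_(s <- r) K s * \1_(J s) t).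
    by apply/funext => t; rewrite big_cons.
  have iJ : integ (\1_(J s)) by apply: sq_integrable; apply: indic_sq; exact: measurable_itv.
  rewrite e; split; first by apply: integrable01D => //; exact: integrable01Z.
  rewrite RintegralD//; last exact: integrable01Z.
  rewrite RintegralZl// big_cons mulrDr lerD// mulrC ler_wpM2r//.
  have -> : \int[mu]_(t in I01) (\1_(J s) t) = \int[mu]_(t in I01 `&` J s) 1.
    rewrite Rintegral_mkcondr; apply: eq_Rintegral => x _.
    by rewrite patchE indicE; case: ifP.
  have -> : \int[mu]_(t in I01 `&` J s) 1 = 1 * fine (mu (I01 `&` J s)).
    by apply: Rintegral_cst; apply: measurableI; exact: measurable_itv.
  have mJ : mu (J s) = (2 * delta)%:E.
    rewrite lebesgue_measure_itv/= lte_fin; case: ltP => [h|h]; last first.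
      by congr (_%:E); lra.
    by rewrite -EFinD; congr (_%:E); lra.
  rewrite mul1r -lee_fin fineK; last first.
    rewrite ge0_fin_numE//; apply: le_lt_trans (_ : _ <= mu (J s))%E _; last by rewrite mJ ltry.
    by apply: le_measure; rewrite ?inE; [apply: measurableI| |]; try exact: measurable_itv; exact: subIsetr.
  rewrite -mJ; apply: le_measure; rewrite ?inE; [apply: measurableI| |]; try exact: measurable_itv.
  exact: subIsetr.
apply: le_trans leF; apply: le_Rintegral => //; first exact: sq_sqr_integrable.
move=> t It; have [s ss ts] := cov t It.
rewrite (big_rem s ss)/= -[leLHS]addr0 lerD//; last first.
  by apply: sumr_ge0 => r _; rewrite mulr_ge0// indicE ler0n.
have Jst : J s t by rewrite /J /= in_itv/= -ler_distlC distrC.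
have -> : \1_(J s) t = 1 :> R by rewrite indicE mem_set.
have := hol s t (tau01 s ss) It; rewrite mulr1 /K => h.
have h2 : `|t - s| * L <= delta * L by rewrite ler_wpM2r.
by have := sqr_ge0 (f t - 2 * f s); nra.
Qed.

End grids.

(** * Convergence of the splines *)

Section convergence.
Variables (R : realType) (n : nat).
Local Notation m := n.+1.
Local Notation H := (sobolev R m).
Local Notation mu := (@lebesgue_measure R).
Local Notation I01 := (`[0, 1]%classic : set R).
Local Notation sq := (@square_integrable01 R).
Local Notation wd := (@weak_derivative R m).
Local Notation E2 := (@energy_form R n).
Implicit Types (u v w h x : H) (f g : R -> R) (c : nat -> R).

Lemma cvg0_le (a b : nat -> R) : (\forall k \near \oo, 0 <= a k <= b k) ->
  b k @[k --> \oo] --> (0 : R) -> a k @[k --> \oo] --> (0 : R).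
Proof. by move=> ab; apply: (squeeze_cvgr ab); exact: cvg_cst. Qed.

Lemma cvg0_norm_le (a b : nat -> R) : (forall k, `|a k| <= b k) ->
  b k @[k --> \oo] --> (0 : R) -> a k @[k --> \oo] --> (0 : R).
Proof.
move=> ab hb; apply/cvgr0Pnorm_le => e e0.
move/cvgr0Pnorm_le : hb => /(_ e e0); apply: filterS => k.
by apply: le_trans; apply: (le_trans (ab k)); exact: ler_norm.
Qed.

Lemma cvg0Z (k : R) (a : nat -> R) : a d @[d --> \oo] --> (0 : R) ->
  k * a d @[d --> \oo] --> (0 : R).
Proof. by move=> ha; rewrite -(mulr0 k); apply: cvgM => //; exact: cvg_cst. Qed.

Lemma cvg0D (a b : nat -> R) : a d @[d --> \oo] --> (0 : R) ->
  b d @[d --> \oo] --> (0 : R) -> a d + b d @[d --> \oo] --> (0 : R).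
Proof. by move=> ha hb; rewrite -(addr0 (0 : R)); exact: cvgD. Qed.

Lemma cvg0_sqr (a : nat -> R) : (forall d, 0 <= a d) ->
  a d ^+ 2 @[d --> \oo] --> (0 : R) -> a d @[d --> \oo] --> (0 : R).
Proof.
move=> a0 h; have := cvg_comp _ _ h (@sqrt_continuous R 0); rewrite sqrtr0.
apply: cvg_trans; apply: near_eq_cvg; apply: nearW => d /=.
by rewrite sqrtr_sqr ger0_norm.
Qed.

Lemma Rintegral_CS_norm2 f g : sq f -> sq g ->
  `|\int[mu]_(t in I01) (f t * g t)| <= norm2 f * norm2 g.
Proof.
move=> sf sg; rewrite -(@ler_pXn2r _ 2)// ?nnegrE ?mulr_ge0 ?norm2_ge0//.
by rewrite exprMn !norm2_sqr real_normK ?num_real// Rintegral_CS.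
Qed.

Section one_grid.
Variables (tau : seq R) (lambda : R).
Hypothesis tau_grid : sampling_grid tau.
Hypothesis tau_uniq : uniq tau.
Hypothesis tau_size : (m <= size tau)%N.
Hypothesis lambda_gt0 : 0 < lambda.
Local Notation S := (smoothing_spline lambda tau).

Lemma grid01 t : t \in tau -> I01 t.
Proof. by case: tau_grid => _ h /h. Qed.

Let E2ge0 u : 0 <= E2 u u.
Proof. by have [_ _ p] := energy_form_psd R n; exact: p. Qed.

Let empge0 u : 0 <= emp tau u u.
Proof. by have [_ _ p] := emp_psd n tau; exact: p. Qed.

(** The spline does at least as well as [x] itself. *)
Lemma spline_le x : emp tau (x - S x) (x - S x) + lambda * E2 (S x) (S x) <=
  lambda * E2 x x.
Proof.
have := smoothing_spline_min tau_uniq tau_size grid01 lambda_gt0 x x.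
by rewrite !spline_criterionE subrr (psd0l (emp_psd n tau)) add0r.
Qed.

Lemma spline_emp_le x : emp tau (x - S x) (x - S x) <= lambda * E2 x x.
Proof. by apply: le_trans (spline_le x); rewrite lerDl mulr_ge0// ltW. Qed.

Lemma spline_energy_le x : E2 (S x) (S x) <= E2 x x.
Proof.
rewrite -(ler_pM2l lambda_gt0); apply: le_trans (spline_le x).
by rewrite lerDr.
Qed.

(** The energy of [S x] is the energy of [x], minus twice the inner product of [x]
    with the error, plus the energy of the error. *)
Lemma spline_error_energy_le x : E2 (x - S x) (x - S x) <= 2 * E2 x (x - S x).
Proof.
have hE := energy_form_psd R n; have [_ sE _] := hE.
have := spline_energy_le x.
rewrite !(psdDl hE, psdDr hE, psdNl hE, psdNr hE) (sE (S x) x).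
move: (E2 x x) (E2 x (S x)) (E2 (S x) (S x)) => a b c; lra.
Qed.

Lemma spline_error_norm_le x : norm2 (wd (x - S x)) <= 2 * norm2 (wd x).
Proof.
have hE := energy_form_psd R n.
rewrite -!fnorm_energy; apply: le_trans (psd_normD hE _ _) _.
rewrite (psd_normN hE) mulrDl mul1r lerD2l; apply: ler_wsqrtr.
exact: spline_energy_le.
Qed.

End one_grid.

(** On quasi-uniform grids the [L^2] norm is controlled by the empirical norm,
    up to a small multiple of the full norm. *)
Lemma empirical_l2_bound (K : R) : 0 <= K -> exists2 C : R, 0 <= C &
  forall (tau : seq R) u, sampling_grid tau -> uniq tau -> (1 < size tau)%N ->
    mesh_max tau / mesh_min tau <= K ->
    norm2 u ^+ 2 <= 8 * K * emp tau u u +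
      8 * K * mesh_max tau * (C * norm2 u + (C + 1) * norm2 (wd u)) ^+ 2.
Proof.
move=> K0; have [C C0 hC] := taylor_coef_l2_bound R n.
exists C => // tau u gt ut s1 hK; have [c uE] := sobolev_taylorP u.
have sw := weak_derivative_sq u.
set M := norm2 (wd u); set s := norm2 u; set D := mesh_max tau.
have M0 : 0 <= M := norm2_ge0 _; have s0 : 0 <= s := norm2_ge0 _.
have D0 : 0 <= D := mesh_max_ge0 tau.
have hcM := hC u c uE; set A := \sum_(i < m) `|c i| in hcM.
have A0 : 0 <= A by exact: sumr_ge0.
have hol r t : I01 r -> I01 t -> (u t - u r) ^+ 2 <= `|t - r| * (A + M) ^+ 2.
  move=> Ir It; rewrite !uE//; apply: (le_trans (taylor_holder _ _ sw Ir It)).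
  rewrite ler_wpM2l// lerXn2r ?nnegrE ?addr_ge0 ?sumr_ge0 ?norm2_ge0//.
  by rewrite lerD2r; exact: ler_sum_ord_widen.
have := Rintegral_covering D0 (fun t => mesh_max_cover (ltnW s1)) _
  (sobolev_sq u) hol (sqr_ge0 _).
have N0 : 0 < (size tau)%:R :> R by rewrite ltr0n ltnW.
have ND := size_mesh_max gt ut s1 hK; rewrite -/D in ND.
move=> /(_ _)/wrap[]; first by case: gt => _ h r /h.
rewrite big_split/= -mulr_sumr big_const_seq count_predT iter_addr_0.
have -> : \sum_(r <- tau) u r ^+ 2 = (size tau)%:R * emp tau u u.
  by rewrite /emp mulrA mulfV ?gt_eqF// mul1r; apply: eq_bigr => r _; rewrite expr2.
have e0 : 0 <= emp tau u u by have [_ _ p] := emp_psd n tau; exact: p.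
move: (emp tau u u) e0 => e e0 h.
have AM : (A + M) ^+ 2 <= (C * s + (C + 1) * M) ^+ 2.
  rewrite lerXn2r ?nnegrE ?addr_ge0 ?mulr_ge0 ?addr_ge0//.
  by rewrite mulrDl mul1r addrA lerD2r -mulrDr.
set L := (A + M) ^+ 2 in h AM; set L' := (_ + _) ^+ 2 in AM *.
have L0 : 0 <= L by exact: sqr_ge0.
apply: (@le_trans _ _ (4 * (((size tau)%:R * D) * e) + 4 * (((size tau)%:R * D) * (D * L)))).
  by apply: le_trans h _; rewrite le_eqVlt; apply/orP; left; apply/eqP;
    rewrite -[_ *+ size tau]mulr_natr; ring.
apply: (@le_trans _ _ (4 * (2 * K * e) + 4 * (2 * K * (D * L')))).
  apply: lerD; rewrite ler_pM2l//; first by rewrite ler_wpM2r.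
  apply: (@le_trans _ _ (2 * K * (D * L))); first by rewrite ler_wpM2r// mulr_ge0.
  by rewrite !ler_wpM2l// mulr_ge0.
by rewrite le_eqVlt; apply/orP; left; apply/eqP; ring.
Qed.

Section grid_sequence.
Variables (tau : nat -> seq R) (lambda : nat -> R).
Hypothesis tau_grid : forall d, sampling_grid (tau d).
Hypothesis tau_uniq : forall d, uniq (tau d).
Hypothesis tau_size : forall d, (m <= size (tau d))%N.
Hypothesis lambda_gt0 : forall d, 0 < lambda d.
Hypothesis quasi_uniform : exists K : R, forall d, mesh_max (tau d) / mesh_min (tau d) <= K.
Hypothesis size_cvg : (size (tau d))%:R @[d --> \oo] --> (+oo : set_system R).
Hypothesis lambda_cvg : lambda @ \oo --> (0 : R).
Local Notation S d := (smoothing_spline (lambda d) (tau d)).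

Lemma mesh_max_cvg0 : mesh_max (tau d) @[d --> \oo] --> (0 : R).
Proof.
have [K hK] := quasi_uniform.
apply: (@cvg0_le _ (fun d => 2 * K * (size (tau d))%:R^-1)).
  near=> d; have s1 : (1 < size (tau d))%N.
    rewrite -(ltr_nat R); near: d.
    by move/cvgryPgt : size_cvg; exact.
  rewrite mesh_max_ge0 ler_pdivlMr ?ltr0n ?(ltnW s1)// mulrC.
  exact: size_mesh_max.
apply: cvg0Z; apply/gtr0_cvgV0; last exact: size_cvg.
by apply: nearW => d; rewrite ltr0n (leq_trans _ (tau_size d)).
Unshelve. all: by end_near. Qed.

Lemma spline_error_l2_cvg x : norm2 (x - S d x) @[d --> \oo] --> (0 : R).
Proof.
have [K' hK'] := quasi_uniform; pose K := Num.max 0 K'.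
have K0 : 0 <= K by rewrite le_max lexx.
have hK d : mesh_max (tau d) / mesh_min (tau d) <= K by rewrite le_max hK' orbT.
have [C C0 hC] := empirical_l2_bound K0.
pose D := (C + 1) * (2 * norm2 (wd x)).
have D0 : 0 <= D by rewrite !mulr_ge0 ?addr_ge0 ?norm2_ge0.
pose b d := 8 * K * mesh_max (tau d).
pose a d := 8 * K * (lambda d * E2 x x).
have b0 d : 0 <= b d by rewrite !mulr_ge0 ?mesh_max_ge0.
have bcvg : b d @[d --> \oo] --> (0 : R).
  by apply: cvg0Z; exact: mesh_max_cvg0.
have acvg : a d @[d --> \oo] --> (0 : R).
  apply: cvg0Z; rewrite -(mul0r (E2 x x)).
  by apply: cvgM; [exact: lambda_cvg|exact: cvg_cst].
have sqcvg : norm2 (x - S d x) ^+ 2 @[d --> \oo] --> (0 : R).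
  apply: (@cvg0_le _ (fun d => 2 * a d + 4 * D ^+ 2 * b d)); last first.
    by apply: cvg0D; exact: cvg0Z.
  near=> d; rewrite sqr_ge0 /=.
  have s1 : (1 < size (tau d))%N.
    by rewrite -(ltr_nat R); near: d; move/cvgryPgt : size_cvg; exact.
  (* The [L^2] norm of the error also occurs in the upper bound; with this
     coefficient it is absorbed by the left-hand side. *)
  have bs : 2 * C ^+ 2 * b d <= 2^-1.
    near: d; have /cvgr0Pnorm_le := cvg0Z (2 * C ^+ 2) bcvg.
    move=> /(_ 2^-1 _)/wrap[]; first by rewrite invr_gt0.
    by apply: filterS => d; apply: le_trans; exact: ler_norm.
  have := hC (tau d) (x - S d x) (tau_grid d) (tau_uniq d) s1 (hK d).
  have he := spline_emp_le (tau_grid d) (tau_uniq d) (tau_size d) (lambda_gt0 d) x.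
  have hn := spline_error_norm_le (tau_grid d) (tau_uniq d) (tau_size d) (lambda_gt0 d) x.
  rewrite -/(b d); have bd0 := b0 d.
  set s := norm2 _ => h; have s0 : 0 <= s := norm2_ge0 _.
  have h1 : s ^+ 2 <= a d + b d * (C * s + D) ^+ 2.
    apply: le_trans h _; apply: lerD.
      by rewrite /a ler_wpM2l// mulr_ge0.
    rewrite ler_wpM2l// lerXn2r ?nnegrE ?addr_ge0 ?mulr_ge0 ?addr_ge0 ?norm2_ge0//.
    by rewrite lerD2l /D ler_wpM2l// addr_ge0.
  clear h; clearbody s; move: (a d) (b d) bd0 bs h1 => ad bd bd0 bs h1.
  clear -s0 bd0 bs h1.
  have h2 : (C * s + D) ^+ 2 <= 2 * C ^+ 2 * s ^+ 2 + 2 * D ^+ 2.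
    rewrite -subr_ge0 (_ : _ - _ = (C * s - D) ^+ 2) ?sqr_ge0//; ring.
  have h3 := ler_wpM2l bd0 h2.
  have h4 := ler_wpM2r (sqr_ge0 s) bs.
  have h5 : bd * (2 * C ^+ 2 * s ^+ 2 + 2 * D ^+ 2) =
    2 * C ^+ 2 * bd * s ^+ 2 + 2 * D ^+ 2 * bd by ring.
  rewrite h5 in h3; move: h1 h3 h4; clear.
  move: (s ^+ 2) (bd * _ ^+ 2) (2 * C ^+ 2 * bd * _) => s2 X Y.
  rewrite (_ : 4 * D ^+ 2 * bd = 2 * (2 * D ^+ 2 * bd)); last by ring.
  move: (2 * D ^+ 2 * bd) => Z; lra.
by apply: cvg0_sqr sqcvg => d; exact: norm2_ge0.
Unshelve. all: by end_near. Qed.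

(** The [m]-th derivatives of the errors converge weakly to 0 in [L^2]: they are
    bounded, and against a test function they are integrated by parts. *)
Lemma spline_error_weak_cvg x f : sq f ->
  \int[mu]_(t in I01) (f t * wd (x - S d x) t) @[d --> \oo] --> (0 : R).
Proof.
pose u d : H := x - S d x.
have su d : sq (wd (u d)) := weak_derivative_sq (u d).
pose M := 2 * norm2 (wd x) + 1.
have M0 : 0 < M by rewrite ltr_wpDl// mulr_ge0 ?norm2_ge0.
have uM d : norm2 (wd (u d)) <= M.
  apply: le_trans (spline_error_norm_le (tau_grid d) (tau_uniq d) (tau_size d) (lambda_gt0 d) x) _.
  by rewrite lerDl.
pose W := [set f | \int[mu]_(t in I01) (f t * wd (u d) t) @[d --> \oo] --> (0 : R)].
have Wcl (q : nat -> R -> R) g : (forall k, sq (q k)) -> sq g -> (forall k, W (q k)) ->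
    norm2 (fun t => g t - q k t) @[k --> \oo] --> (0 : R) -> W g.
  move=> sq_ sg Wq gq; apply/cvgr0Pnorm_le => e e0.
  have e2 : 0 < e / 2 / M by rewrite !divr_gt0.
  have /cvgr0Pnorm_le/(_ _ e2) := gq => -[k _ /(_ k (leqnn k))/= hk].
  have e3 : 0 < e / 2 by rewrite divr_gt0.
  have /cvgr0Pnorm_le/(_ _ e3) := Wq k; apply: filterS => d hd.
  have sgq : sq (fun t => g t - q k t).
    have := square_integrable01_lin (-1) (sq_ k) sg; congr sq; apply/funext => t.
    by rewrite [LHS](_ : _ = -1 * q k t + g t)//; ring.
  have -> : \int[mu]_(t in I01) (g t * wd (u d) t) =
     \int[mu]_(t in I01) ((g t - q k t) * wd (u d) t) +
     \int[mu]_(t in I01) (q k t * wd (u d) t).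
    rewrite -RintegralD//; [|exact: sq_mul_integrable..].
    by apply: eq_Rintegral => t _; ring.
  rewrite (le_trans (ler_normD _ _))// (splitr e) lerD//.
  apply: le_trans (Rintegral_CS_norm2 sgq (su d)) _.
  rewrite (ger0_norm (norm2_ge0 _)) in hk.
  apply: (@le_trans _ _ (e / 2 / M * M)); last by rewrite divfK ?gt_eqF.
  by apply: ler_pM => //; exact: norm2_ge0.
have Wtest phi : test_function phi -> W phi.
  move=> tp; have tm := test_function_derive1n m tp.
  apply: (@cvg0_norm_le _ (fun d => norm2 (u d) * norm2 (derive1n m phi))) => [d|].
    have [_ /(_ _ tp)] := weak_derivativeP (j := m) (u d) (leqnn _).
    move=> /(congr1 (fun z => (-1) ^+ m * z)); rewrite mulrA -expr2 sqrr_sign mul1r.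
    under [in X in _ = X -> _]eq_Rintegral do rewrite mulrC.
    move=> <-; rewrite normrM normr_sign mul1r.
    apply: Rintegral_CS_norm2; first exact: sobolev_sq.
    exact: test_function_sq.
  rewrite -(mul0r (norm2 (derive1n m phi))); apply: cvgM; last exact: cvg_cst.
  exact: spline_error_l2_cvg.
move=> sf; suff [_ //] : [set f | sq f /\ W f] f.
move: f sf; apply: square_integrable01_ind.
- move=> a b a0 b1; have sI := indic_sq (measurable_itv `]a, b[ : measurable (`]a, b[%classic : set R)).
  split=> //; apply: (Wcl (smooth_bump a b)) => //.
  + by move=> k; apply: test_function_sq; exact: smooth_bump_test_function.
  + by move=> k; apply: Wtest; exact: smooth_bump_test_function.
  + apply: (@norm2_dominated _ _ _ (cst 1)) => //.
    * by move=> k; apply: test_function_sq; exact: smooth_bump_test_function.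
    * exact: cst_sq.
    * by move=> t _; exact: smooth_bump_cvg.
    * move=> k t _; have := smooth_bump_ge0 a b k t; have := smooth_bump_le1 a b k t.
      rewrite indicE /=; case: (_ \in _) => /= h1 h2; rewrite ler_norml; apply/andP; split; lra.
- move=> k g h [sg Wg] [sh Wh]; split; first exact: square_integrable01_lin.
  rewrite /W/=; have := cvg0D (cvg0Z k Wg) Wh.
  apply: cvg_trans; apply: near_eq_cvg; apply: nearW => d /=.
  have ig := sq_mul_integrable sg (su d); have ih := sq_mul_integrable sh (su d).
  rewrite -RintegralZl// -RintegralD//; last exact: integrable01Z.
  by apply: eq_Rintegral => t _; rewrite [in RHS](_ : (_ + _) t = k * g t + h t)//; ring.
- move=> q g sq_ sg hq cv; split=> //; apply: (Wcl q) => // k.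
  by case: (hq k).
Qed.

Lemma spline_error_energy_cvg x : norm2 (wd (x - S d x)) @[d --> \oo] --> (0 : R).
Proof.
have h := spline_error_weak_cvg x (weak_derivative_sq x).
have h2 : 2 * \int[mu]_(t in I01) (wd x t * wd (x - S d x) t) @[d --> \oo] --> (0 : R).
  exact: cvg0Z.
have sqcvg : norm2 (wd (x - S d x)) ^+ 2 @[d --> \oo] --> (0 : R).
  apply: cvg0_le h2; apply: nearW => d; rewrite sqr_ge0/=.
  have := spline_error_energy_le (tau_grid d) (tau_uniq d) (tau_size d) (lambda_gt0 d) x.
  by rewrite -[X in X <= _](fnorm_sqr (energy_form_psd R n)) fnorm_energy.
by apply: cvg0_sqr sqcvg => d; exact: norm2_ge0.
Qed.

Section hilbert.
Variable B : {linear H -> 'rV[R]_m}.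
Hypothesis hB : boundary_conditions_operator B.

Theorem spline_hilbert_cvg x : hilbert_norm B (x - S d x) @[d --> \oo] --> (0 : R).
Proof.
have [C C0 hC] := hilbert_norm_le hB; have [D D0 hD] := taylor_coef_l2_bound R n.
apply: (@cvg0_le _ (fun d => C * (D * (norm2 (x - S d x) + norm2 (wd (x - S d x))) +
   norm2 (wd (x - S d x))))).
  apply: nearW => d; rewrite sqrtr_ge0/=; have [c uE] := sobolev_taylorP (x - S d x).
  apply: le_trans (hC _ _ uE) _; apply: ler_wpM2l => //; rewrite lerD2r.
  exact: (hD _ c uE).
have e := spline_error_energy_cvg x; have l := spline_error_l2_cvg x.
by apply: cvg0Z; apply: cvg0D => //; apply: cvg0Z; exact: cvg0D.
Qed.

End hilbert.
End grid_sequence.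

(** The smoothing spline is a finite combination of evaluations, which are bounded
    for the Hilbert norm. *)
Lemma smoothing_spline_lipschitz (B : {linear H -> 'rV[R]_m}) (tau : seq R) (lambda : R) :
  boundary_conditions_operator B -> sampling_grid tau -> uniq tau ->
  (m <= size tau)%N -> 0 < lambda ->
  exists2 C : R, 0 <= C & forall u v,
    hilbert_norm B (smoothing_spline lambda tau u - smoothing_spline lambda tau v) <=
    C * hilbert_norm B (u - v).
Proof.
move=> hB gt ut st l0; have [C C0 hC] := evaluation_bound hB.
have [s hs] := smoothing_spline_sum ut st (grid01 gt) l0.
have hN := sobolev_inner_psd B.
exists (C * \sum_j hilbert_norm B (s j)).
  by rewrite mulr_ge0// sumr_ge0// => j _; exact: sqrtr_ge0.
move=> u v; have -> : smoothing_spline lambda tau u - smoothing_spline lambda tau v =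
    \sum_(j < size tau) (u - v) (nth 0 tau j) *: s j.
  rewrite !hs -sumrB; apply: eq_bigr => j _.
  by rewrite -scalerBl.
apply: le_trans (psd_norm_sum hN _ _) _; rewrite mulrAC mulr_sumr.
apply: ler_sum => j _; rewrite (psd_normZ hN) ler_wpM2r ?sqrtr_ge0// hC//.
by apply: (grid01 gt); exact: mem_nth.
Qed.

End convergence.

(** * Recovery of events and decision rules *)

Section recovery.
Variables (R : realType) (d d' : measure_display).
Variables (Omega : measurableType d) (P : probability Omega R).
Variables (T : measurableType d') (X : Omega -> T) (Z : nat -> Omega -> T).
Hypothesis mX : measurable_fun setT X.
Hypothesis mZ : forall k, measurable_fun setT (Z k).

Lemma measurable_preimage (f : Omega -> T) A : measurable_fun setT f -> measurable A ->
  measurable (f @^-1` A).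
Proof. by move=> mf mA; rewrite -[_ @^-1` _]setTI; exact: mf. Qed.

Lemma measurable_setY (A B : set Omega) : measurable A -> measurable B ->
  measurable (A `+` B).
Proof. by move=> mA mB; apply: measurableU; exact: measurableD. Qed.

Lemma probability_cvg0 (E : nat -> set Omega) : (forall k, measurable (E k)) ->
  (forall w, \forall k \near \oo, ~ E k w) ->
  forall e : R, 0 < e -> \forall k \near \oo, (P (E k) <= e%:E)%E.
Proof.
move=> mE hE e e0.
have cv : ((\int[P]_w (\1_(E k) w)%:E) @[k --> \oo] --> \int[P]_w 0)%E.
  apply: (@dominated_cvg _ _ _ P setT measurableT (fun k w => (\1_(E k) w)%:E) _ (cst 1%E)).
  - by move=> k; apply/measurable_EFinP; exact: measurable_indic.
  - move=> w _; apply: cvg_near_cst; near=> k; rewrite indicE memNset//.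
    by near: k; exact: hE.
  - by [].
  - by apply: finite_measure_integrable_cst.
  - move=> k w _; rewrite indicE; case: (_ \in _); rewrite ?abse0 ?lee01//.
    by rewrite abse1.
have : (P (E k) @[k --> \oo] --> 0)%E.
  move: cv; rewrite integral0; under eq_fun do rewrite integral_indic// setIT; exact.
move=> /fine_cvgP[+ /cvgr0Pnorm_le/(_ e e0)]; apply: filterS2 => k fk /= hk.
by rewrite -(fineK fk) lee_fin (le_trans (ler_norm _)).
Unshelve. all: by end_near. Qed.

(** The event that [X] lies in [A] agrees, up to an event of small probability,
    with an event that depends only on [Z k], for large [k]. *)
Definition recoverable A := measurable A /\ forall e : R, 0 < e ->
  exists D : nat -> set T, (forall k, measurable (D k)) /\
    \forall k \near \oo, (P ((Z k @^-1` D k) `+` (X @^-1` A)) <= e%:E)%E.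

Lemma recoverable0 : recoverable set0.
Proof.
split=> // e e0; exists (fun=> set0); split=> //; apply: nearW => k.
by rewrite !preimage_set0 setYK measure0 lee_fin ltW.
Qed.

Lemma recoverableC A : recoverable A -> recoverable (~` A).
Proof.
move=> [mA hA]; split; first exact: measurableC.
move=> e e0; have [D [mD hD]] := hA e e0.
exists (fun k => ~` D k); split; first by move=> k; exact: measurableC.
apply: filterS hD => k; congr (P _ <= _)%E.
apply/seteqP; split => w /=.
  by move=> [[h1 h2]|[h1 h2]]; [right|left]; split.
by move=> [[h1 /contrapT h2]|[h1 /contrapT h2]]; [right|left]; split.
Qed.

Lemma recoverableU A B : recoverable A -> recoverable B -> recoverable (A `|` B).
Proof.
move=> [mA hA] [mB hB]; split; first exact: measurableU.
move=> e e0; have e2 : 0 < e / 2 by rewrite divr_gt0.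
have [D [mD hD]] := hA _ e2; have [F [mF hF]] := hB _ e2.
exists (fun k => D k `|` F k); split; first by move=> k; exact: measurableU.
apply: filterS2 hD hF => k h1 h2.
have mYA : measurable ((Z k @^-1` D k) `+` (X @^-1` A)).
  by apply: measurable_setY; apply: measurable_preimage.
have mYB : measurable ((Z k @^-1` F k) `+` (X @^-1` B)).
  by apply: measurable_setY; apply: measurable_preimage.
apply: (@le_trans _ _ (P (((Z k @^-1` D k) `+` (X @^-1` A)) `|`
    ((Z k @^-1` F k) `+` (X @^-1` B))))).
  apply: le_measure; rewrite ?inE.
  - by apply: measurable_setY; apply: measurable_preimage => //; exact: measurableU.
  - exact: measurableU.
  - by move=> w /=; tauto.
apply: le_trans (measureU2 _ mYA mYB) _.
by rewrite (splitr e) EFinD leeD.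
Qed.

Lemma recoverable_bigcup (A : nat -> set T) : (forall i, recoverable (A i)) ->
  recoverable (\bigcup_i A i).
Proof.
move=> rA; have mA i : measurable (A i) by case: (rA i).
have mU : measurable (\bigcup_i A i) by exact: bigcupT_measurable.
split=> // e e0; have e2 : 0 < e / 2 by rewrite divr_gt0.
pose U k := \big[setU/set0]_(i < k) A i.
have rU k : recoverable (U k).
  rewrite /U; elim: k => [|k IHk]; first by rewrite big_ord0; exact: recoverable0.
  by rewrite big_ord_recr/=; exact: recoverableU.
have mUk k : measurable (U k) by case: (rU k).
have [k _ /(_ k (leqnn k))/= hk] : \forall k \near \oo,
    (P (X @^-1` (\bigcup_i A i `\` U k)) <= (e / 2)%:E)%E.
  apply: probability_cvg0 e2 => [k|w].
    by apply: measurable_preimage => //; exact: measurableD.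
  have [[j _ Aj]|nA] := pselect ((\bigcup_i A i) (X w)); last first.
    by apply: nearW => k [].
  near=> k => -[_]; apply; rewrite /U -bigcup_mkord; exists j => //=.
  by near: k; exact: nbhs_infty_gt.
have [_ /(_ _ e2)[D [mD hD]]] := rU k.
exists D; split=> //; apply: filterS hD => j hj.
have mY : measurable ((Z j @^-1` D j) `+` (X @^-1` U k)).
  by apply: measurable_setY; apply: measurable_preimage.
have mV : measurable (X @^-1` (\bigcup_i A i `\` U k)).
  by apply: measurable_preimage => //; exact: measurableD.
apply: (@le_trans _ _ (P (((Z j @^-1` D j) `+` (X @^-1` U k)) `|`
    (X @^-1` (\bigcup_i A i `\` U k))))).
  apply: le_measure; rewrite ?inE.
  - by apply: measurable_setY; apply: measurable_preimage.
  - exact: measurableU.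
  - have UA : U k `<=` \bigcup_i A i.
      by rewrite /U -bigcup_mkord => x [i _ Ai]; exists i.
    move=> w /= [[h1 h2]|[h1 h2]].
      by left; left; split=> // /UA.
    have [h3|h3] := pselect (U k (X w)); last by right.
    by left; right.
apply: le_trans (measureU2 _ mY mV) _.
by rewrite (splitr e) EFinD leeD.
Unshelve. all: by end_near. Qed.

Lemma recoverable_sigma_algebra : sigma_algebra setT recoverable.
Proof.
split; [exact: recoverable0| |exact: recoverable_bigcup].
by move=> A rA; rewrite setTD; exact: recoverableC.
Qed.

(** ** Mean square recovery *)

(** The second moment, possibly infinite. *)
Definition mean_square (f : Omega -> R) : \bar R := (\int[P]_w (f w ^+ 2)%:E)%E.

Lemma mean_square_ge0 f : (0 <= mean_square f)%E.
Proof. by apply: integral_ge0 => w _; rewrite lee_fin sqr_ge0. Qed.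

Lemma mean_square_le (a b : R) (f g h : Omega -> R) : 0 <= a -> 0 <= b ->
  measurable_fun setT f -> measurable_fun setT g -> measurable_fun setT h ->
  (forall w, f w ^+ 2 <= a * g w ^+ 2 + b * h w ^+ 2) ->
  (mean_square f <= a%:E * mean_square g + b%:E * mean_square h)%E.
Proof.
move=> a0 b0 mf mg mh fgh.
have msq (k : Omega -> R) : measurable_fun setT k ->
    measurable_fun setT (fun w => (k w ^+ 2)%:E).
  by move=> mk; apply/measurable_EFinP; exact: measurable_funX.
rewrite /mean_square -!ge0_integralZl//; try exact: msq;
  try by move=> w _; rewrite lee_fin sqr_ge0.
rewrite -ge0_integralD//; last 4 first.
- by move=> w _; rewrite mule_ge0// lee_fin sqr_ge0.
- by apply: emeasurable_funM => //; exact: msq.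
- by move=> w _; rewrite mule_ge0// lee_fin sqr_ge0.
- by apply: emeasurable_funM => //; exact: msq.
apply: ge0_le_integral => //.
- by move=> w _; rewrite lee_fin sqr_ge0.
- exact: msq.
- by apply: emeasurable_funD; apply: emeasurable_funM => //; exact: msq.
- by move=> w _; rewrite -!EFinM -EFinD lee_fin.
Qed.

(** The square integrable functions of [X] that are close in mean square to
    functions of [Z k], for large [k]. *)
Definition ms_recoverable (phi : T -> R) := measurable_fun setT phi /\
  (mean_square (phi \o X) < +oo)%E /\
  forall e : R, 0 < e -> exists psi : nat -> T -> R,
    (forall k, measurable_fun setT (psi k)) /\
    \forall k \near \oo, (mean_square (fun w => psi k (Z k w) - phi (X w))%R <= e%:E)%E.

Lemma ms_recoverable_indic A : recoverable A -> ms_recoverable \1_A.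
Proof.
move=> [mA hA]; split; first exact: measurable_indic.
split.
  have e : (\int[P]_(w in setT) 1 = 1 * P setT)%E by exact: integral_cst.
  apply: (@le_lt_trans _ _ (\int[P]_w 1)%E); last by rewrite e probability_setT mule1 ltry.
  apply: ge0_le_integral => //.
  - by move=> w _; rewrite lee_fin sqr_ge0.
  - apply/measurable_EFinP; apply: measurable_funX; apply: measurableT_comp => //.
  - by move=> w _; rewrite lee_fin /= indicE; case: (_ \in _); rewrite ?expr1n ?expr0n.
move=> e e0; have [D [mD hD]] := hA e e0.
exists (fun k => \1_(D k)); split; first by move=> k; exact: measurable_indic.
apply: filterS hD => k; congr (_ <= _)%E.
have mY : measurable ((Z k @^-1` D k) `+` (X @^-1` A)).
  by apply: measurable_setY; apply: measurable_preimage.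
transitivity (\int[P]_w (\1_((Z k @^-1` D k) `+` (X @^-1` A)) w)%:E)%E.
  by rewrite integral_indic// setIT.
apply: eq_integral => w _; congr (_%:E); rewrite !indicE.
have -> : (w \in (Z k @^-1` D k) `+` (X @^-1` A)) =
    (Z k w \in D k) (+) (X w \in A).
  apply/idP/idP; rewrite !inE /=.
    by move=> [[h1 h2]|[h1 h2]]; rewrite (mem_set h1) (memNset h2).
  case: (boolP (Z k w \in D k)) => [/set_mem h1|/negP h1];
    case: (boolP (X w \in A)) => [/set_mem h2|/negP h2] //= _.
    by left; split=> // /mem_set.
  by right; split=> // /mem_set.
by do 2 case: (_ \in _); rewrite /= ?subrr ?subr0 ?sub0r ?sqrrN ?expr1n ?expr0n.
Qed.

Lemma ms_recoverable_lin (k : R) (f g : T -> R) : ms_recoverable f -> ms_recoverable g ->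
  ms_recoverable (k *: f + g).
Proof.
move=> [mf [sf hf]] [mg [sg hg]].
have mfg : measurable_fun setT (k *: f + g).
  by apply: measurable_funD => //; apply: measurable_funM => //; exact: measurable_cst.
have sq2 (x y : R) : (k * x + y) ^+ 2 <= 2 * k ^+ 2 * x ^+ 2 + 2 * y ^+ 2.
  by have := sqr_ge0 (k * x - y); nra.
have k0 : 0 <= 2 * k ^+ 2 by rewrite mulr_ge0// sqr_ge0.
split=> //; split.
  apply: le_lt_trans (@mean_square_le (2 * k ^+ 2) 2 _ (f \o X) (g \o X) _ _ _ _ _ _) _ => //.
  - exact: measurableT_comp.
  - exact: measurableT_comp.
  - exact: measurableT_comp.
  - by move=> w; exact: sq2.
  - by rewrite lte_add_pinfty// lte_mul_pinfty// lee_fin.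
move=> e e0; pose e1 := e / (2 * (2 * k ^+ 2 + 1)).
have e10 : 0 < e1 by rewrite divr_gt0// mulr_gt0// ltr_wpDl.
have e4 : 0 < e / 4 by rewrite divr_gt0.
have [p [mp hp]] := hf _ e10; have [q [mq hq]] := hg _ e4.
exists (fun j => k *: p j + q j); split.
  by move=> j; apply: measurable_funD => //; apply: measurable_funM => //; exact: measurable_cst.
apply: filterS2 hp hq => j h1 h2.
apply: le_trans (@mean_square_le (2 * k ^+ 2) 2 _ (fun w => p j (Z j w) - f (X w))
   (fun w => q j (Z j w) - g (X w)) _ _ _ _ _ _) _ => //.
- apply: measurable_funB; apply: measurableT_comp => //.
  by apply: measurable_funD => //; apply: measurable_funM => //; exact: measurable_cst.
- by apply: measurable_funB; exact: measurableT_comp.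
- by apply: measurable_funB; exact: measurableT_comp.
- move=> w; apply: le_trans (sq2 _ _); rewrite le_eqVlt; apply/orP; left; apply/eqP.
  have -> : (k *: p j + q j) (Z j w) = k * p j (Z j w) + q j (Z j w) by [].
  have -> : (k *: f + g) (X w) = k * f (X w) + g (X w) by [].
  by congr (_ ^+ 2); ring.
apply: (@le_trans _ _ ((2 * k ^+ 2)%:E * e1%:E + 2%:E * (e / 4)%:E)%E).
  by apply: leeD; apply: lee_pmul => //; exact: mean_square_ge0.
rewrite -!EFinM -EFinD lee_fin /e1.
have : 2 * k ^+ 2 * (e / (2 * (2 * k ^+ 2 + 1))) <= e / 2.
  rewrite mulrA ler_pdivrMr ?mulr_gt0 ?ltr_wpDl//.
  have ek : 0 <= e * k ^+ 2 by apply: mulr_ge0; [exact: ltW|exact: sqr_ge0].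
  by nra.
by lra.
Qed.

Lemma mean_square_cvg0 (q : nat -> T -> R) (f : T -> R) :
  (forall k, measurable_fun setT (q k)) -> measurable_fun setT f ->
  (mean_square (f \o X) < +oo)%E ->
  (forall k x, `|q k x| <= `|f x|) ->
  (forall x, q k x @[k --> \oo] --> f x) ->
  forall e : R, 0 < e -> \forall k \near \oo,
    (mean_square (fun w => q k (X w) - f (X w))%R <= e%:E)%E.
Proof.
move=> mq mf sf bq cq e e0.
have cv : (mean_square (fun w => q k (X w) - f (X w))%R @[k --> \oo] --> \int[P]_w 0)%E.
  apply: (@dominated_cvg _ _ _ P setT measurableT
    (fun k w => ((q k (X w) - f (X w)) ^+ 2)%:E) _ (fun w => (4 * (f (X w)) ^+ 2)%:E)).
  - move=> k; apply/measurable_EFinP; apply: measurable_funX.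
    by apply: measurable_funB; exact: measurableT_comp.
  - move=> w _; apply: cvg_EFin; first exact: nearW.
    have -> : (0 : R) = (f (X w) - f (X w)) * (f (X w) - f (X w)) by rewrite subrr mulr0.
    rewrite /comp/=; under eq_fun do rewrite expr2.
    by apply: cvgM; apply: cvgB; [exact: cq|exact: cvg_cst|exact: cq|exact: cvg_cst].
  - by [].
  - apply/integrableP; split.
      apply/measurable_EFinP; apply: measurable_funM; first exact: measurable_cst.
      by apply: measurable_funX; exact: measurableT_comp.
    apply: (@le_lt_trans _ _ (4%:E * mean_square (f \o X))%E); last first.
      by rewrite lte_mul_pinfty// lee_fin.
    rewrite -ge0_integralZl//; last 2 first.
    + by apply/measurable_EFinP; apply: measurable_funX; exact: measurableT_comp.
    + by move=> w _; rewrite lee_fin sqr_ge0.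
    rewrite le_eqVlt; apply/orP; left; apply/eqP; apply: eq_integral => w _.
    by rewrite /= -EFinM ger0_norm// mulr_ge0// sqr_ge0.
  - move=> k w _; rewrite /= lee_fin ger0_norm ?sqr_ge0//.
    have := bq k (X w); move: (q k (X w)) (f (X w)) => a b; rewrite ler_norml => /andP[h1 h2].
    rewrite -(real_normK (num_real b)); have := normr_ge0 b.
    have : `|a - b| <= 2 * `|b|.
      by rewrite (le_trans (ler_normB _ _))// mulrDl mul1r lerD2r ler_norml h1.
    rewrite -(real_normK (num_real (a - b))); have := normr_ge0 (a - b).
    by nra.
move: cv; rewrite integral0 => /fine_cvgP[+ /cvgr0Pnorm_le/(_ e e0)].
apply: filterS2 => k fk /= hk.
by rewrite -(fineK fk) lee_fin (le_trans (ler_norm _)).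
Qed.

Lemma ms_recoverableP (phi : T -> R) :
  (forall A, measurable A -> recoverable A) -> measurable_fun setT phi ->
  (mean_square (phi \o X) < +oo)%E -> ms_recoverable phi.
Proof.
move=> rec mphi sphi; split=> //; split=> // e e0.
have [q [Cq bq cq]] := @dominated_simple_approximation R _ T
  [set f | ms_recoverable f] phi (fun A mA => ms_recoverable_indic (rec A mA))
  (fun k f g => @ms_recoverable_lin k f g) mphi.
have mq k : measurable_fun setT (q k) by case: (Cq k).
have e4 : 0 < e / 4 by rewrite divr_gt0.
have [k _ /(_ k (leqnn k))/= hk] := mean_square_cvg0 mq mphi sphi bq cq e4.
have [_ [_ /(_ _ e4)[psi [mpsi hpsi]]]] := Cq k.
exists psi; split=> //; apply: filterS hpsi => j hj.
apply: le_trans (@mean_square_le 2 2 _ (fun w => psi j (Z j w) - q k (X w))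
   (fun w => q k (X w) - phi (X w)) _ _ _ _ _ _) _ => //.
- by apply: measurable_funB; exact: measurableT_comp.
- by apply: measurable_funB; exact: measurableT_comp.
- by apply: measurable_funB; exact: measurableT_comp.
- move=> w; move: (psi j _) (q k _) (phi _) => a b c.
  by have := sqr_ge0 (a - b - (b - c)); nra.
apply: (@le_trans _ _ (2%:E * (e / 4)%:E + 2%:E * (e / 4)%:E)%E).
  by apply: leeD; apply: lee_pmul => //; exact: mean_square_ge0.
by rewrite -!EFinM -EFinD lee_fin; lra.
Qed.

End recovery.

(** * Bayes risks *)

Section hilbert_borel.
Variables (R : realType) (n : nat) (B : {linear sobolev R n.+1 -> 'rV[R]_n.+1}).
Local Notation H := (sobolev R n.+1).
Local Notation Hborel := (g_sigma_algebraType (hilbert_open B)).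
Local Notation N := (hilbert_norm B).

Let hN := sobolev_inner_psd B.

Lemma hilbert_normB (u v : H) : N (u - v) = N (v - u).
Proof. by rewrite -opprB /hilbert_norm -/(fnorm _ _) (psd_normN hN). Qed.

Lemma hilbert_norm_triangle (u v w : H) : N (u - w) <= N (u - v) + N (v - w).
Proof.
have -> : u - w = (u - v) + (v - w) by rewrite addrA subrK.
exact: (psd_normD hN).
Qed.

Lemma hilbert_openP (U : set H) : hilbert_open B U -> measurable (U : set Hborel).
Proof. by move=> oU; exact: sub_sigma_algebra. Qed.

Lemma lipschitz_measurable (S : H -> H) (C : R) : 0 <= C ->
  (forall u v, N (S u - S v) <= C * N (u - v)) ->
  measurable_fun (setT : set Hborel) (S : Hborel -> Hborel).
Proof.
move=> C0 hS; apply: (@measurability _ _ Hborel Hborel setT S (hilbert_open B) erefl) => _ [U oU <-].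
rewrite setTI; apply: hilbert_openP => u /= /oU[e e0 he].
exists (e / (C + 1)); first by rewrite divr_gt0// ltr_wpDl.
move=> v vu; apply: he; apply: le_lt_trans (hS v u) _.
apply: (@le_lt_trans _ _ ((C + 1) * N (v - u))).
  by rewrite ler_wpM2r ?sqrtr_ge0// lerDl.
by rewrite mulrC -ltr_pdivlMr// ltr_wpDl.
Qed.

(** The points at distance at least [1 / (k + 1)] from the complement of [U]. It is
    a closed set. *)
Definition shrink (U : set H) (k : nat) : set H :=
  [set u | forall v, N (v - u) < k.+1%:R^-1 -> U v].

Lemma shrink_measurable U k : measurable (shrink U k : set Hborel).
Proof.
rewrite -[shrink U k]setCK; apply: measurableC; apply: hilbert_openP.
move=> u /= /existsNP[v /not_implyP[vu nUv]].
exists (k.+1%:R^-1 - N (v - u)); first by rewrite subr_gt0.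
move=> w wu hw; apply: nUv; apply: hw.
apply: le_lt_trans (hilbert_norm_triangle v u w) _.
by rewrite (hilbert_normB u w) addrC -ltrBrDr.
Qed.

Section recover.
Variables (d : measure_display) (Omega : measurableType d) (P : probability Omega R).
Variables (X : Omega -> Hborel) (S : nat -> H -> H).
Hypothesis mX : measurable_fun setT X.
Hypothesis mS : forall k, measurable_fun (setT : set Hborel) (S k : Hborel -> Hborel).
Hypothesis S_cvg : forall x : H, N (x - S k x) @[k --> \oo] --> (0 : R).
Local Notation Z k := (fun w => S k (X w) : Hborel).

Let mZ k : measurable_fun setT (Z k).
Proof. exact: measurableT_comp. Qed.

Let S_near (x : H) (e : R) : 0 < e -> \forall k \near \oo, N (x - S k x) < e.
Proof.
move=> e0; have e2 : 0 < e / 2 by rewrite divr_gt0.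
move/cvgr0Pnorm_le : (@S_cvg x) => /(_ _ e2); apply: filterS => k.
by rewrite ger0_norm ?sqrtr_ge0// => /le_lt_trans; apply; lra.
Qed.

Lemma hilbert_open_recoverable (U : set H) : hilbert_open B U ->
  recoverable P X (fun k => Z k) U.
Proof.
move=> oU; have mU := hilbert_openP oU; split=> // e e0.
have e2 : 0 < e / 2 by rewrite divr_gt0.
have [k _ /(_ k (leqnn k))/= hk] : \forall k \near \oo,
    (P (X @^-1` (U `\` shrink U k)) <= (e / 2)%:E)%E.
  apply: probability_cvg0 e2 => [k|w].
    by apply: measurable_preimage => //; apply: measurableD => //; exact: shrink_measurable.
  have [Uw|nU] := pselect (U (X w)); last by apply: nearW => k [].
  have [r r0 hr] := oU _ Uw; have := nbhs_infty_ger r^-1; apply: filterS => k rk.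
  move=> [_ nsh]; apply: nsh => v vX; apply: hr; apply: lt_le_trans vX _.
  by rewrite invf_ple ?posrE// (le_trans rk)// ler_nat.
(* The radius of [shrink U l] is at most half that of [shrink U k]. So, when [Z j]
   is within the smaller radius of [X], if [X] is in [shrink U k] then [Z j] is in
   [shrink U l], and if [Z j] is in [shrink U l] then [X] is in [U]. *)
pose l := (2 * k).+1.
have kl : 2 * l.+1%:R^-1 <= k.+1%:R^-1 :> R.
  by rewrite ler_pdivrMr// mulrC ler_pdivlMr// -natrM ler_nat /l mulnSr addn2.
have l0 : 0 < l.+1%:R^-1 :> R by rewrite invr_gt0.
pose E j := (Z j @^-1` shrink U l `\` X @^-1` U) `|`
  (X @^-1` shrink U k `\` Z j @^-1` shrink U l).
have mZs j : measurable (Z j @^-1` shrink U l).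
  exact: measurable_preimage (mZ j) (shrink_measurable U l).
have mXs : measurable (X @^-1` shrink U k).
  exact: measurable_preimage mX (shrink_measurable U k).
have mXU : measurable (X @^-1` U) by exact: measurable_preimage mX mU.
have mE j : measurable (E j).
  by apply: measurableU; exact: measurableD.
exists (fun=> shrink U l); split; first by move=> _; exact: shrink_measurable.
have : \forall j \near \oo, (P (E j) <= (e / 2)%:E)%E.
  apply: probability_cvg0 e2 => // w; apply: filterS (S_near (X w) l0) => j hj.
  move=> [[h1 h2]|[h1 h2]].
    by apply: h2; apply: h1.
  apply: h2 => v hv; apply: h1; apply: le_lt_trans (hilbert_norm_triangle v (Z j w) (X w)) _.
  rewrite (hilbert_normB (Z j w)); apply: lt_le_trans (ltrD hv hj) _.
  by rewrite -mulr2n -[leLHS]mulr_natl.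
apply: filterS => j hj.
have mV : measurable (X @^-1` (U `\` shrink U k)).
  by apply: measurable_preimage => //; apply: measurableD => //; exact: shrink_measurable.
apply: (@le_trans _ _ (P (E j `|` X @^-1` (U `\` shrink U k)))).
  apply: le_measure; rewrite ?inE.
  - by apply: measurable_setY; apply: measurable_preimage => //; exact: shrink_measurable.
  - exact: measurableU.
  - move=> w /= [[h1 h2]|[h1 h2]]; first by left; left.
    have [h3|h3] := pselect (shrink U k (X w)); last by right.
    by left; right.
apply: le_trans (measureU2 _ (mE j) mV) _.
by rewrite (splitr e) EFinD leeD.
Unshelve. all: by end_near. Qed.

Lemma hilbert_measurable_recoverable (A : set Hborel) : measurable A ->
  recoverable P X (fun k => Z k) A.
Proof.
have hs := recoverable_sigma_algebra P mX mZ.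
have hG : hilbert_open B `<=` recoverable P X (fun k => Z k).
  by move=> U; exact: hilbert_open_recoverable.
exact: (smallest_sub hs hG).
Qed.

(** ** Comparison of the risks *)

Variables (Y : Omega -> R) (task : learning_task).

Lemma bayes_risk_ge0 (V : Omega -> Hborel) : (0 <= bayes_risk B P task V Y)%E.
Proof.
apply/ereal_infP => _ [phi _ <-]; rewrite /risk; case: task; first exact: measure_ge0.
by rewrite unlock; apply: integral_ge0 => w _; rewrite lee_fin sqr_ge0.
Qed.

(** A rule for [S k X] gives a rule for [X] by composition with [S k]. *)
Lemma bayes_risk_le k : (bayes_risk B P task X Y <= bayes_risk B P task (Z k) Y)%E.
Proof.
apply/ereal_infP => _ [phi [mphi tphi] <-]; apply: ereal_inf_lbound.
exists (fun x => phi (S k x)) => //; split; first exact: (measurableT_comp mphi (mS k)).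
by case: task tphi => //= h x; exact: h.
Qed.

Lemma cvg_bayes_risk : bayes_risk B P task X Y \is a fin_num ->
  (forall e : R, 0 < e -> \forall k \near \oo,
    (bayes_risk B P task (Z k) Y <= bayes_risk B P task X Y + e%:E)%E) ->
  bayes_risk B P task (Z k) Y @[k --> \oo] --> bayes_risk B P task X Y.
Proof.
set L := bayes_risk B P task X Y => fL h; rewrite -(fineK fL).
have fin k : (bayes_risk B P task (Z k) Y <= L + 1%:E)%E ->
    bayes_risk B P task (Z k) Y \is a fin_num.
  move=> hk; rewrite ge0_fin_numE ?bayes_risk_ge0//; apply: le_lt_trans hk _.
  by rewrite -(fineK fL) -EFinD ltry.
apply: cvg_EFin; first by apply: filterS (h 1 ltr01); exact: fin.
apply/cvgrPdist_le => e e0; apply: filterS2 (h 1 ltr01) (h e e0) => k /fin fk hk.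
have := bayes_risk_le k; move: hk fk; rewrite -/L /=.
move: (bayes_risk B P task (Z k) Y) => r; rewrite -(fineK fL) => + fr.
rewrite -(fineK fr) -EFinD !lee_fin => h1 h2.
by rewrite distrC ger0_norm ?subr_ge0// lerBlDl.
Qed.

End recover.

(** ** Convergence of the risks *)

Section classification.
Variables (d : measure_display) (Omega : measurableType d) (P : probability Omega R).
Variables (X : Omega -> Hborel) (S : nat -> H -> H) (Y : Omega -> R).
Hypothesis mX : measurable_fun setT X.
Hypothesis mS : forall k, measurable_fun (setT : set Hborel) (S k : Hborel -> Hborel).
Hypothesis S_cvg : forall x : H, N (x - S k x) @[k --> \oo] --> (0 : R).
Hypothesis mY : measurable_fun setT Y.
Local Notation Z k := (fun w => S k (X w) : Hborel).

Let mZ k : measurable_fun setT (Z k).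
Proof. exact: measurableT_comp. Qed.

Lemma measurable_error (phi : Hborel -> R) (V : Omega -> Hborel) :
  measurable_fun setT phi -> measurable_fun setT V ->
  measurable [set w | phi (V w) <> Y w].
Proof.
move=> mphi mV; have mf : measurable_fun setT (fun w => phi (V w) - Y w).
  by apply: measurable_funB => //; exact: measurableT_comp.
rewrite (_ : [set _ | _] = ~` ((fun w => phi (V w) - Y w) @^-1` [set 0])); last first.
  apply/seteqP; split => w /=; first by move=> h /eqP; rewrite subr_eq0 => /eqP.
  by move=> h e; apply: h; rewrite e subrr.
by apply: measurableC; rewrite -[X in measurable X]setTI; exact: mf.
Qed.

Lemma classification_cvg :
  bayes_risk B P Classification (Z k) Y @[k --> \oo] -->
  bayes_risk B P Classification X Y.
Proof.
have fL : bayes_risk B P Classification X Y \is a fin_num.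
  rewrite ge0_fin_numE ?bayes_risk_ge0//.
  apply: (@le_lt_trans _ _ (P [set w | cst 1 (X w) <> Y w])).
    apply: ereal_inf_lbound; exists (cst 1) => //; split; first exact: measurable_cst.
    by move=> x; right.
  apply: (le_lt_trans (probability_le1 P _)); last exact: ltry.
  by apply: (@measurable_error (cst 1)).
apply: cvg_bayes_risk => // e e0.
have e2 : 0 < e / 2 by rewrite divr_gt0.
have [_ [phi [mphi tphi] <-] hphi] := lb_ereal_inf_adherent e2 fL.
pose A : set Hborel := phi @^-1` [set 1].
have mA : measurable A by rewrite /A -[_ @^-1` _]setTI; exact: mphi.
have [_ /(_ _ e2)[D [mD hD]]] := hilbert_measurable_recoverable P mX mS S_cvg mA.
apply: filterS hD => k hk.
(* The rule with value 1 on [D k] and -1 elsewhere: when it errs and [phi] does not,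
   [X] is in [A] and [Z k] is not in [D k], or conversely. *)
pose psi (x : Hborel) : R := 2 * \1_(D k) x - 1.
have mpsi : measurable_fun setT psi.
  apply: measurable_funB; last exact: measurable_cst.
  by apply: measurable_funM; [exact: measurable_cst|exact: measurable_indic].
apply: (@le_trans _ _ (P [set w | psi (Z k w) <> Y w])).
  apply: ereal_inf_lbound; exists psi => //; split => // x.
  by rewrite /psi indicE; case: (_ \in _); [right|left]; rewrite /=; lra.
have m1 := measurable_error mphi mX.
have m2 : measurable ((Z k @^-1` D k) `+` (X @^-1` A)).
  by apply: measurable_setY; apply: measurable_preimage.
apply: (@le_trans _ _ (P ([set w | phi (X w) <> Y w] `|`
    ((Z k @^-1` D k) `+` (X @^-1` A))))).
  apply: le_measure; rewrite ?inE; [exact: measurable_error|exact: measurableU|].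
  move=> w /= hw; apply: contrapT => /not_orP[/contrapT h1 h2]; apply: hw.
  rewrite -h1 /psi indicE; have [DZ|nDZ] := pselect (D k (Z k w)).
    rewrite mem_set//=; have [-> |nA] := pselect (A (X w)); first by lra.
    by exfalso; apply: h2; left.
  rewrite memNset//=; have [AX|nA] := pselect (A (X w)).
    by exfalso; apply: h2; right.
  have [-> |//] := tphi (X w); lra.
apply: le_trans (measureU2 _ m1 m2) _.
by rewrite [in leRHS](splitr e) EFinD addeA leeD// ltW.
Qed.

Lemma regression_cvg : ('E_P[fun w => ((Y w) ^+ 2)%R] < +oo)%E ->
  bayes_risk B P Regression (Z k) Y @[k --> \oo] -->
  bayes_risk B P Regression X Y.
Proof.
move=> Y2.
have riskE (V : Omega -> Hborel) phi :
    risk B P Regression V Y phi = mean_square P (fun w => phi (V w) - Y w).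
  by rewrite /risk unlock.
have sY : (mean_square P Y < +oo)%E by move: Y2; rewrite unlock.
have fL : bayes_risk B P Regression X Y \is a fin_num.
  rewrite ge0_fin_numE ?bayes_risk_ge0//; apply: le_lt_trans sY.
  apply: ereal_inf_lbound; exists (cst 0); first by split => //; exact: measurable_cst.
  rewrite riskE; apply: eq_integral => w _; by rewrite /= sub0r sqrrN.
apply: cvg_bayes_risk => // e e0.
have e2 : 0 < e / 2 by rewrite divr_gt0.
have [_ [phi [mphi _] <-] hphi] := lb_ereal_inf_adherent e2 fL.
rewrite riskE -/(bayes_risk B P Regression X Y) in hphi.
have mphiY (V : Omega -> Hborel) (f : Hborel -> R) : measurable_fun setT f ->
    measurable_fun setT V -> measurable_fun setT (fun w => f (V w) - Y w).
  by move=> mf mV; apply: measurable_funB => //; exact: measurableT_comp.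
set a := mean_square P _ in hphi.
have fa : a \is a fin_num.
  rewrite ge0_fin_numE ?mean_square_ge0//; apply: lt_trans hphi _.
  by rewrite -(fineK fL) -EFinD ltry.
have sphi : (mean_square P (phi \o X) < +oo)%E.
  apply: le_lt_trans (@mean_square_le _ _ _ P 2 2 _ (fun w => phi (X w) - Y w) Y _ _ _ _ _ _) _ => //.
  - exact: measurableT_comp.
  - exact: mphiY.
  - by move=> w /=; have := sqr_ge0 (phi (X w) - 2 * Y w); nra.
  - by rewrite -/a -(fineK fa) lte_add_pinfty// ?lte_mul_pinfty ?lee_fin// ltry.
have rec A mA := hilbert_measurable_recoverable P mX mS S_cvg (A := A) mA.
have [_ [_ ms]] := ms_recoverableP mX mZ rec mphi sphi.
(* The mean square errors are compared by
   [(x - z) ^ 2 <= (1 + s) (y - z) ^ 2 + (1 + 1 / s) (x - y) ^ 2], for the decisions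
   [x] of the new rule, [y] of [phi], and the value [z] of [Y]. The choices of [s]
   and [eta] make [s * r] and [(1 + 1 / s) * eta] at most [e / 4]. *)
pose r := fine a; have r0 : 0 <= r by rewrite fine_ge0// mean_square_ge0.
pose s := e / (4 * (r + 1)).
have s0 : 0 < s by rewrite divr_gt0// mulr_gt0// ltr_wpDl.
pose eta := e / 4 / (1 + s^-1).
have eta0 : 0 < eta by rewrite !divr_gt0// addr_gt0// invr_gt0.
have [psi [mpsi hpsi]] := ms _ eta0.
apply: filterS hpsi => k hk.
apply: (@le_trans _ _ (mean_square P (fun w => psi k (Z k w) - Y w))).
  by rewrite -riskE; apply: ereal_inf_lbound; exists (psi k).
have s1 : 0 <= 1 + s^-1 by rewrite addr_ge0// invr_ge0 ltW.
apply: le_trans (@mean_square_le _ _ _ P (1 + s) (1 + s^-1) _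
  (fun w => phi (X w) - Y w) (fun w => psi k (Z k w) - phi (X w)) _ _ _ _ _ _) _ => //.
- by rewrite addr_ge0// ltW.
- exact: mphiY.
- exact: mphiY.
- apply: measurable_funB; first exact: (measurableT_comp (mpsi k) (mZ k)).
  exact: (measurableT_comp mphi mX).
- move=> w; move: (psi k _) (phi _) (Y w) => x y z.
  rewrite -subr_ge0.
  have -> : (1 + s) * (y - z) ^+ 2 + (1 + s^-1) * (x - y) ^+ 2 - (x - z) ^+ 2 =
     s * ((y - z) - s^-1 * (x - y)) ^+ 2.
    have sV : s * s^-1 = 1 by rewrite mulfV// gt_eqF.
    rewrite (_ : s * _ = s * (y - z) ^+ 2 - 2 * (s * s^-1) * ((y - z) * (x - y)) +
      (s * s^-1) * s^-1 * (x - y) ^+ 2); last by ring.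
    by rewrite sV; ring.
  by rewrite mulr_ge0 ?sqr_ge0// ltW.
apply: (@le_trans _ _ ((1 + s)%:E * a + (1 + s^-1)%:E * eta%:E)%E).
  by apply: leeD => //; apply: lee_pmul => //; exact: mean_square_ge0.
rewrite -(fineK fa) -/r -(fineK fL) -!EFinM -!EFinD lee_fin.
have hr : r <= fine (bayes_risk B P Regression X Y) + e / 2.
  by rewrite -lee_fin EFinD !fineK// ltW.
have -> : (1 + s^-1) * eta = e / 4.
  by rewrite /eta mulrC divfK// gt_eqF// addr_gt0// invr_gt0.
have sr : s * r <= e / 4.
  rewrite /s mulrAC ler_pdivrMr ?mulr_gt0 ?ltr_wpDl//.
  rewrite (_ : e / 4 * (4 * (r + 1)) = e * (r + 1)); last by field.
  by rewrite ler_pM2l// lerDl.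
by rewrite mulrDl mul1r; lra.
Qed.

End classification.
End hilbert_borel.

Theorem corollary3 (R : realType) (m : nat)
    (B : {linear sobolev R m -> 'rV[R]_m})
    (tau : nat -> seq R) (lambda : nat -> R)
    (disp : measure_display) (Omega : measurableType disp)
    (P : probability Omega R)
    (X : {RV P >-> g_sigma_algebraType (hilbert_open B)}) (Y : {RV P >-> R})
    (task : learning_task)
    (m_ge1 : (1 <= m)%N)
    (hB : boundary_conditions_operator B)
    (htau : forall d, sampling_grid (tau d))
    (hlambda : forall d, 0 < lambda d)
    (hY : task_valued task Y)
    (A1 : forall d, [/\ uniq (tau d), (m <= size (tau d))%N
                      & independent_from_sampling B (tau d)])
    (A2 : exists K : R, forall d, mesh_max (tau d) / mesh_min (tau d) <= K)
    (A3 : ((fun d => (size (tau d))%:R : R) @ \oo --> +oo) /\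
          (lambda @ \oo --> (0 : R)))
    (A4 : (task = Classification /\
             ('E_P[fun w => energy (X w)] < +oo)%E) \/
          ((forall d, {subset tau d <= tau d.+1}) /\
             ('E_P[fun w => ((Y w) ^+ 2)%R] < +oo)%E)) :
  (fun d => bayes_risk B P task
     (fun w => smoothing_spline (lambda d) (tau d) (X w)) Y) @ \oo -->
  bayes_risk B P task X Y.
Proof.
case: m m_ge1 B X hB A1 A4 => [//|n] _ B X hB A1 A4.
have [size_cvg lambda_cvg] := A3.
have tau_uniq d : uniq (tau d) by case: (A1 d).
have tau_size d : (n.+1 <= size (tau d))%N by case: (A1 d).
have S_cvg (x : sobolev R n.+1) : hilbert_norm B
    (x - smoothing_spline (lambda d) (tau d) x) @[d --> \oo] --> (0 : R).
  exact: spline_hilbert_cvg.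
have mS d : measurable_fun (setT : set (g_sigma_algebraType (hilbert_open B)))
    (smoothing_spline (lambda d) (tau d) : g_sigma_algebraType (hilbert_open B) ->
       g_sigma_algebraType (hilbert_open B)).
  have [C C0 hC] := smoothing_spline_lipschitz hB (htau d) (tau_uniq d) (tau_size d)
    (hlambda d).
  exact: lipschitz_measurable hC.
have mX : measurable_fun setT X by [].
have mY : measurable_fun setT Y by [].
case: A4 => [[-> _]|[_ Y2]].
  exact: (@classification_cvg R n B disp Omega P X
    (fun d => smoothing_spline (lambda d) (tau d)) Y).
case: task hY => _.
  exact: (@classification_cvg R n B disp Omega P X
    (fun d => smoothing_spline (lambda d) (tau d)) Y).
exact: (@regression_cvg R n B disp Omega P X
  (fun d => smoothing_spline (lambda d) (tau d)) Y).
Qed.
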